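(* For $\operatorname{Re}z>0$ and $\tau>0$, $$\ln G(z;\tau)=P_\tau(z)\ln z+Q_\tau(z)-\int_0^\infty e^{-zx}f_3(x;\tau)\,dx,$$ where, with $f(x)=\dfrac{x^2}{(1-e^{-x})(1-e^{-\tau x})}$ and $f_3(x;\tau)=x^{-3}\big(f(x)-f(0)-f'(0)x-\tfrac12f''(0)x^2\big)$, $$P_\tau(z)=\frac{z^2}{2\tau}-\frac{1+\tau}{2\tau}z+\frac{1+3\tau+\tau^2}{12\tau}=\tfrac12B_{2,2}(z;1,\tau),$$ $$Q_\tau(z)=-\frac{\frac32+\ln\tau}{2\tau}z^2+\left(\frac{\ln(2\pi\tau)}{2}+\frac{1+\tau+\ln\tau}{2\tau}\right)z+b_0(\tau),$$ and $b_0(\tau)$ is determined by $G(1;\tau)=1$. In particular $b_0(1)=\zeta'(-1)-\tfrac12\ln2\pi$.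
   Context: For $\tau>0$, $G(z;\tau)$ is the Barnes double gamma function: the entire function $G(z;\tau)=\frac{z}{\tau}e^{c_1 z/\tau+c_2 z^2/(2\tau^2)}\prod_{(k,l)\in\mathbb{Z}_{\ge0}^2\setminus\{(0,0)\}}\big(1+\frac{z}{k\tau+l}\big)e^{-\frac{z}{k\tau+l}+\frac{z^2}{2(k\tau+l)^2}}$, with real constants $c_1,c_2$ (depending on $\tau$) uniquely determined by $G(z+1;\tau)=\Gamma(z/\tau)G(z;\tau)$ and $G(z+\tau;\tau)=(2\pi)^{(\tau-1)/2}\tau^{1/2-z}\Gamma(z)G(z;\tau)$; it satisfies $G(1;\tau)=1$ and has no zeros in $\operatorname{Re}z>0$. $\ln G(z;\tau)$ is the analytic branch on $\operatorname{Re}z>0$ that is real for $z>0$, and $\ln z$ is principal. $f$ is extended analytically to $x=0$. $B_{2,2}(z;1,\tau)$ is the double Bernoulli polynomial, defined by $\frac{t^2e^{zt}}{(e^t-1)(e^{\tau t}-1)}=\sum_{k\ge0}B_{2,k}(z;1,\tau)\frac{t^k}{k!}$. $\zeta$ is the Riemann zeta function. *)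

(* Defs.v *)
From Stdlib Require Import Reals Factorial List.
From Coquelicot Require Import Coquelicot.

Local Open Scope R_scope.
Local Open Scope C_scope.

Definition Cexp (z : C) : C :=
  (exp (Re z) * cos (Im z), exp (Re z) * sin (Im z))%R.

(* Principal argument, with values in (-PI, PI] for z <> 0. *)
Definition Carg (z : C) : R :=
  if Rle_dec 0 (Im z) then acos (Re z / Cmod z)%R
  else (- acos (Re z / Cmod z))%R.

Definition Cln (z : C) : C := (ln (Cmod z), Carg z).

(* Positive real base, complex exponent. *)
Definition Rcpow (x : R) (s : C) : C := Cexp (s * RtoC (ln x)).

Definition analytic_at (f : C -> C) (z0 : C) : Prop :=
  exists (a : nat -> C) (r : R), (0 < r)%R /\
    forall z : C, (Cmod (z - z0) < r)%R ->
      @is_pseries C_AbsRing C_NormedModule a (z - z0) (f z).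

Definition Cprod {I : Type} (a : I -> C) (s : list I) : C :=
  fold_right Cmult (RtoC 1) (map a s).

(* Unordered convergence, along the finite subsets of the index set D, of the
   product of the a i to p (p = 0 is allowed). *)
Definition is_unordered_prod {I : Type} (D : I -> Prop) (a : I -> C) (p : C)
    : Prop :=
  forall eps : R, (0 < eps)%R ->
    exists s0 : list I, List.Forall D s0 /\
      forall s : list I, NoDup s -> List.Forall D s -> incl s0 s ->
        (Cmod (Cprod a s - p) < eps)%R.

(* Euler-Gauss limit n! n^z / (z (z+1) ... (z+n)); at the poles of the Gamma
   function the value of [Gamma] is irrelevant. *)
Definition Gamma_seq (z : C) (n : nat) : C :=
  RtoC (INR (fact n)) * Rcpow (INR n) z
    / Cprod (fun k : nat => z + RtoC (INR k)) (seq 0 (S n)).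

Definition Gamma (z : C) : C :=
  (real (Lim_seq (fun n => Re (Gamma_seq z n))),
   real (Lim_seq (fun n => Im (Gamma_seq z n)))).

Definition Gamma_pole (z : C) : Prop := exists n : nat, z = RtoC (- INR n).

Definition barnes_factor (tau : R) (z : C) (kl : nat * nat) : C :=
  let w := RtoC (INR (fst kl) * tau + INR (snd kl)) in
  (1 + z / w) * Cexp (- (z / w) + z ^ 2 / (2 * w ^ 2)).

Definition is_barnes_double_gamma (tau : R) (G : C -> C) : Prop :=
  (forall z : C, analytic_at G z) /\
  exists c1 c2 : R,
    (forall z : C, exists p : C,
       is_unordered_prod (fun kl => kl <> (0%nat, 0%nat))
         (barnes_factor tau z) p /\
       G z = z / RtoC tau
             * Cexp (RtoC c1 * z / RtoC tau
                     + RtoC c2 * z ^ 2 / (2 * RtoC tau ^ 2))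
             * p) /\
    (forall z : C, ~ Gamma_pole (z / RtoC tau) ->
       G (z + 1) = Gamma (z / RtoC tau) * G z) /\
    (forall z : C, ~ Gamma_pole z ->
       G (z + RtoC tau)
       = RtoC (Rpower (2 * PI) ((tau - 1) / 2))
         * Rcpow tau (RtoC (1 / 2) - z) * Gamma z * G z).

(* L is the branch of the logarithm of G, analytic on Re z > 0, that is real
   on the positive half-line. *)
Definition is_real_log_branch (G L : C -> C) : Prop :=
  (forall z : C, (0 < Re z)%R -> analytic_at L z /\ Cexp (L z) = G z) /\
  (forall x : R, (0 < x)%R -> Im (L (RtoC x)) = 0%R).

(* B k z tau stands for B_{2,k}(z;1,tau). *)
Definition is_double_bernoulli (B : nat -> C -> R -> C) : Prop :=
  forall (tau : R) (z : C), (0 < tau)%R ->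
    exists r : R, (0 < r)%R /\
      forall t : C, t <> 0 -> (Cmod t < r)%R ->
        @is_pseries C_AbsRing C_NormedModule
          (fun k => B k z tau / RtoC (INR (fact k))) t
          (t ^ 2 * Cexp (z * t)
           / ((Cexp t - 1) * (Cexp (RtoC tau * t) - 1))).

Definition is_riemann_zeta (zeta : C -> C) : Prop :=
  (forall s : C, (1 < Re s)%R ->
     @is_series C_AbsRing C_NormedModule
       (fun n => / Rcpow (INR (S n)) s) (zeta s)) /\
  (forall s : C, s <> 1 -> analytic_at zeta s).

Local Open Scope R_scope.

Definition barnes_f_formula (tau x : R) : R :=
  x ^ 2 / ((1 - exp (- x)) * (1 - exp (- tau * x))).

(* The singularity at 0 is removable, so the analytic extension takes there
   the value of the limit. *)
Definition barnes_f (tau x : R) : R :=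
  if Req_EM_T x 0 then real (Lim (barnes_f_formula tau) 0) else barnes_f_formula tau x.

(* Only the values at x > 0 matter. *)
Definition barnes_f3 (tau x : R) : R :=
  (barnes_f tau x - barnes_f tau 0 - Derive (barnes_f tau) 0 * x
   - 1 / 2 * Derive_n (barnes_f tau) 2 0 * x ^ 2) / x ^ 3.

Local Open Scope C_scope.

Definition barnes_P (tau : R) (z : C) : C :=
  z ^ 2 / RtoC (2 * tau) - RtoC ((1 + tau) / (2 * tau)) * z
  + RtoC ((1 + 3 * tau + tau ^ 2) / (12 * tau)).

Definition barnes_Q (tau b : R) (z : C) : C :=
  - (RtoC ((3 / 2 + ln tau) / (2 * tau)) * z ^ 2)
  + RtoC (ln (2 * PI * tau) / 2 + (1 + tau + ln tau) / (2 * tau)) * z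
  + RtoC b.

Definition integrand (tau : R) (z : C) (x : R) : C :=
  Cexp (- (z * RtoC x)) * RtoC (barnes_f3 tau x).

(* The right-hand side, with b in place of b_0(tau). *)
Definition barnes_rhs (tau b : R) (z : C) : C :=
  barnes_P tau z * Cln z + barnes_Q tau b z
  - @RInt_gen C_R_CompleteNormedModule (integrand tau z)
      (at_point 0%R) (Rbar_locally p_infty).

(* Main.v *)
(* Let F(z) = P(z) ln z + Q(z) - L(z), where L is the Laplace transform of f_3 and b_0 = 0 in Q.
   Since (1 - e^(-x)) (1 - e^(-tau x)) f(x) = x^2, the double difference
   F(z + 1 + tau) - F(z + 1) - F(z + tau) + F(z) has the third derivative of ln z, and letting
   z -> infinity shows that it equals ln z - ln tau.
   Summing over a square of lattice points k tau + l with k, l < N and comparing with the partial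
   products of G gives ln G - F as a limit of real quadratic polynomials in z, hence as such a
   polynomial. The functional equation z -> z + 1 and the asymptotics of Gamma make it
   constant, and G(1) = 1 fixes the constant. Stirling's constant itself is extracted from the
   two functional equations at tau = 2.
   At tau = 1 the sum of k ln k for k <= n is expressed by F, so b_0(1) is the constant in its asymptotic
   expansion. That constant involves zeta'(-1): the remainder of the Euler-Maclaurin expansion of
   (s - 1) zeta(s) is locally bounded and tends to 0 near 2 + i, so by Vitali's theorem, propagated
   along the segment from 2 + i to -1, it tends to 0 with its derivative at -1. *)

From Stdlib Require Import Reals Lra Lia Psatz List Factorial FinFun.
From Coquelicot Require Import Coquelicot.
Require Import Defs.

Open Scope R_scope.

(** * Complex exponential, logarithm and derivatives along real parameters *)

(** Derivatives in z are taken along horizontal lines, where real calculus applies; the analyticity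
    of ln G enters through its continuity on vertical lines. Squares of lattice points are chosen
    because a double difference telescopes over them to four corners, three of which run off to
    infinity, where F is known up to o(1). The constants c1 and c2 are never computed: like the
    convergence factors and the far corners, they only contribute quadratic polynomials with real
    coefficients. A limit of such polynomials is settled by three real points, where logarithms are
    unambiguous. F(x + 1) - F(x) satisfies the recursion of ln Gamma(x / tau) and has its growth, so
    Gamma, given by Euler's limit, is known up to one universal constant, which the power of 2 pi in
    the second functional equation then determines. G(1) = 1 is not assumed; it has to be extracted
    from the behaviour of the product near 0. About zeta only its series for Re s > 1 and local
    power series elsewhere are given, so information about the Euler-Maclaurin remainder has to be
    carried to -1 disk by disk. *)

Lemma Cexp_plus (a b : C) : Cexp (a + b) = (Cexp a * Cexp b)%C.
Proof.
  unfold Cexp, Cmult, Cplus, Re, Im; simpl.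
  rewrite exp_plus, cos_plus, sin_plus. f_equal; ring.
Qed.

Lemma Cexp_RtoC (x : R) : Cexp (RtoC x) = RtoC (exp x).
Proof. unfold Cexp, RtoC, Re, Im; simpl. rewrite cos_0, sin_0. f_equal; ring. Qed.

Lemma Cexp_0 : Cexp 0 = 1%C.
Proof. rewrite Cexp_RtoC, exp_0. reflexivity. Qed.

Lemma Cmod_Cexp (z : C) : Cmod (Cexp z) = exp (Re z).
Proof.
  unfold Cmod, Cexp; simpl.
  replace (_ + _) with (exp (Re z) * exp (Re z) * (Rsqr (sin (Im z)) + Rsqr (cos (Im z))))
    by (unfold Rsqr; ring).
  rewrite sin2_cos2, Rmult_1_r. apply sqrt_square. left; apply exp_pos.
Qed.

Lemma Cexp_neq_0 (z : C) : Cexp z <> 0%C.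
Proof. apply Cmod_gt_0. rewrite Cmod_Cexp. apply exp_pos. Qed.

Lemma Cexp_opp (z : C) : Cexp (- z) = (/ Cexp z)%C.
Proof.
  assert (H : (Cexp (- z) * Cexp z)%C = 1%C).
  { rewrite <- Cexp_plus. replace (- z + z)%C with (RtoC 0) by ring. apply Cexp_0. }
  assert (Hz := Cexp_neq_0 z).
  replace (Cexp (- z)) with (Cexp (- z) * Cexp z * / Cexp z)%C by (field; auto).
  rewrite H. ring.
Qed.

Lemma Cexp_minus (a b : C) : Cexp (a - b) = (Cexp a / Cexp b)%C.
Proof. unfold Cminus. rewrite Cexp_plus, Cexp_opp. reflexivity. Qed.

Lemma Re_plus (a b : C) : Re (a + b) = Re a + Re b. Proof. reflexivity. Qed.
Lemma Im_plus (a b : C) : Im (a + b) = Im a + Im b. Proof. reflexivity. Qed.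
Lemma Re_opp (a : C) : Re (- a) = - Re a. Proof. reflexivity. Qed.
Lemma Im_opp (a : C) : Im (- a) = - Im a. Proof. reflexivity. Qed.
Lemma Re_minus (a b : C) : Re (a - b) = Re a - Re b. Proof. reflexivity. Qed.
Lemma Im_minus (a b : C) : Im (a - b) = Im a - Im b. Proof. reflexivity. Qed.
Lemma Re_mult (a b : C) : Re (a * b) = Re a * Re b - Im a * Im b. Proof. reflexivity. Qed.
Lemma Im_mult (a b : C) : Im (a * b) = Re a * Im b + Im a * Re b. Proof. reflexivity. Qed.
Lemma Re_RtoC (x : R) : Re (RtoC x) = x. Proof. reflexivity. Qed.
Lemma Im_RtoC (x : R) : Im (RtoC x) = 0. Proof. reflexivity. Qed.
Lemma C_ext (a b : C) : Re a = Re b -> Im a = Im b -> a = b.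
Proof. destruct a, b; unfold Re, Im; simpl; intros; subst; reflexivity. Qed.

Lemma Cinv_coords (z : C) :
  (/ z)%C = (Re z / (Re z ^ 2 + Im z ^ 2), - Im z / (Re z ^ 2 + Im z ^ 2)).
Proof. reflexivity. Qed.

Lemma Im_0_RtoC (z : C) : Im z = 0 -> z = RtoC (Re z).
Proof. intros H. apply C_ext; simpl; auto. Qed.

Lemma im_le_Cmod (z : C) : Rabs (Im z) <= Cmod z.
Proof. eapply Rle_trans; [apply Rmax_r | apply Rmax_Cmod]. Qed.

Lemma Cmod_le_abs (z : C) : Cmod z <= Rabs (Re z) + Rabs (Im z).
Proof.
  assert (z = (RtoC (Re z) + Ci * RtoC (Im z))%C) as ->
    by (apply C_ext; unfold Re, Im; simpl; ring).
  eapply Rle_trans; [apply Cmod_triangle|].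
  rewrite Cmod_mult, Cmod_Ci, !Cmod_R, Re_plus, Im_plus, Re_mult, Im_mult; simpl.
  right; f_equal; [|rewrite Rmult_1_l]; f_equal; ring.
Qed.

Lemma Cmod_minus_sym (a b : C) : Cmod (a - b) = Cmod (b - a).
Proof. rewrite <- Cmod_opp. f_equal. ring. Qed.

Lemma Cmod_triangle_inv (a b : C) : Cmod a - Cmod b <= Cmod (a - b).
Proof.
  assert (H := Cmod_triangle (a - b) b).
  replace (a - b + b)%C with a in H by ring. lra.
Qed.

Lemma Re_pos_neq_0 (z : C) : 0 < Re z -> z <> 0%C.
Proof. intros H E. rewrite E in H. simpl in H. lra. Qed.

Lemma Cmod_2 (z : C) : Cmod z * Cmod z = Re z * Re z + Im z * Im z.
Proof.
  unfold Cmod. rewrite sqrt_sqrt. unfold Re, Im; ring.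
  assert (0 <= fst z ^ 2) by apply pow2_ge_0.
  assert (0 <= snd z ^ 2) by apply pow2_ge_0. lra.
Qed.

(** The definition of [Carg] splits on the sign of the imaginary part, and its [acos] is not
    differentiable at 1, that is on the positive half-line. In the right half-plane [atan] gives one
    smooth formula. *)
Lemma Carg_Re_pos (z : C) : 0 < Re z -> Carg z = atan (Im z / Re z).
Proof.
  intros H.
  assert (Hm : 0 < Cmod z) by (apply Cmod_gt_0, Re_pos_neq_0, H).
  assert (E := Cmod_2 z).
  set (x := Re z) in *. set (y := Im z) in *. set (m := Cmod z) in *.
  assert (Hr : m = x * sqrt (1 + (y / x)²)).
  { apply Rsqr_inj; [lra| |].
    - apply Rmult_le_pos; [lra|apply sqrt_pos].
    - rewrite Rsqr_mult, Rsqr_sqrt.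
      + unfold Rsqr. rewrite E. field. lra.
      + assert (0 <= (y/x)²) by apply Rle_0_sqr. lra. }
  assert (Hc : cos (atan (y / x)) = x / m).
  { rewrite cos_atan, Hr. field. split; [|lra].
    apply Rgt_not_eq, sqrt_lt_R0. assert (0 <= (y/x)²) by apply Rle_0_sqr. lra. }
  unfold Carg. fold x y m. rewrite <- Hc.
  assert (B := atan_bound (y / x)). assert (P := PI_RGT_0).
  destruct (Rle_dec 0 y) as [Hy|Hy].
  - apply acos_cos. split; [|lra].
    destruct Hy as [Hy|Hy].
    + rewrite <- atan_0. left; apply atan_increasing.
      apply Rdiv_lt_0_compat; lra.
    + rewrite <- Hy. unfold Rdiv; rewrite Rmult_0_l, atan_0. lra.
  - rewrite <- cos_neg, acos_cos; [ring|].
    assert (atan (y / x) < 0).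
    { rewrite <- atan_0. apply atan_increasing.
      assert (0 < - y / x) by (apply Rdiv_lt_0_compat; lra).
      unfold Rdiv in *. lra. }
    lra.
Qed.

Lemma Cln_coords (z : C) : 0 < Re z ->
  Cln z = (/ 2 * ln (Re z ^ 2 + Im z ^ 2), atan (Im z / Re z)).
Proof.
  intros H. unfold Cln. rewrite Carg_Re_pos by auto. f_equal.
  assert (Hm : 0 < Cmod z) by (apply Cmod_gt_0, Re_pos_neq_0, H).
  replace (Re z ^ 2 + Im z ^ 2) with (Cmod z * Cmod z) by (rewrite Cmod_2; ring).
  rewrite ln_mult by auto. field.
Qed.

Lemma Cexp_Cln (z : C) : 0 < Re z -> Cexp (Cln z) = z.
Proof.
  intros H.
  assert (Hm : 0 < Cmod z) by (apply Cmod_gt_0, Re_pos_neq_0, H).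
  unfold Cexp. change (Re (Cln z)) with (ln (Cmod z)). change (Im (Cln z)) with (Carg z).
  rewrite exp_ln, Carg_Re_pos by auto.
  assert (E := Cmod_2 z).
  assert (Hr : Cmod z = Re z * sqrt (1 + (Im z / Re z)²)).
  { apply Rsqr_inj; [lra| |].
    - apply Rmult_le_pos; [lra|apply sqrt_pos].
    - rewrite Rsqr_mult, Rsqr_sqrt.
      + unfold Rsqr. rewrite E. field. lra.
      + assert (0 <= (Im z/Re z)²) by apply Rle_0_sqr. lra. }
  assert (0 < sqrt (1 + (Im z / Re z)²)).
  { apply sqrt_lt_R0. assert (0 <= (Im z/Re z)²) by apply Rle_0_sqr. lra. }
  rewrite cos_atan, sin_atan, Hr.
  apply C_ext; [unfold Re at 1|unfold Im at 1]; simpl; field; lra.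
Qed.

Lemma Cln_RtoC (x : R) : 0 < x -> Cln (RtoC x) = RtoC (ln x).
Proof.
  intros H. unfold Cln. rewrite Carg_Re_pos by auto.
  rewrite Cmod_R, Rabs_right by lra.
  rewrite Im_RtoC, Re_RtoC. unfold Rdiv. rewrite Rmult_0_l, atan_0. reflexivity.
Qed.

Lemma is_derive_value (f : R -> R) (t a b : R) : is_derive f t a -> a = b -> is_derive f t b.
Proof. intros H E; rewrite <- E; exact H. Qed.

(** [auto_derive] treats an abstract function through an [ex_derive] hypothesis and a [Derive] term,
    so every [is_derive] hypothesis is first rewritten into that form. *)
Ltac derive_tac :=
  repeat match goal with
  | H : is_derive ?u ?t ?l |- _ =>
    rewrite <- (is_derive_unique u t l H); apply (ex_intro (is_derive u t) l) in H;
    change (ex_derive u t) in H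
  end;
  auto_derive;
  [repeat split; try assumption
  | repeat match goal with |- context [Derive (fun x => ?f x) ?t] =>
      change (Derive (fun x => f x) t) with (Derive f t) end; try ring].

Section RealDerivatives.
Variables (u v p q : R -> R) (t a b c d : R).
Hypotheses (Hu : is_derive u t a) (Hv : is_derive v t b)
  (Hp : is_derive p t c) (Hq : is_derive q t d).

Lemma is_derive_mult_minus :
  is_derive (fun s => u s * p s - v s * q s) t (a * p t + u t * c - (b * q t + v t * d)).
Proof. derive_tac. Qed.

Lemma is_derive_mult_plus :
  is_derive (fun s => u s * p s + v s * q s) t (a * p t + u t * c + (b * q t + v t * d)).
Proof. derive_tac. Qed.

Lemma is_derive_exp_cos :
  is_derive (fun s => exp (u s) * cos (v s)) t (a * (exp (u t) * cos (v t)) - b * (exp (u t) * sin (v t))).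
Proof. derive_tac. Qed.

Lemma is_derive_exp_sin :
  is_derive (fun s => exp (u s) * sin (v s)) t (a * (exp (u t) * sin (v t)) + b * (exp (u t) * cos (v t))).
Proof. derive_tac. Qed.

Lemma is_derive_inv_re : 0 < u t * u t + v t * v t ->
  is_derive (fun s => u s / (u s ^ 2 + v s ^ 2)) t
    ((- a * (u t ^ 2 - v t ^ 2) - b * (2 * u t * v t)) / (u t ^ 2 + v t ^ 2) ^ 2).
Proof. intros N. derive_tac; [simpl; nra | field; simpl in *; nra]. Qed.

Lemma is_derive_inv_im : 0 < u t * u t + v t * v t ->
  is_derive (fun s => - v s / (u s ^ 2 + v s ^ 2)) t
    ((- b * (u t ^ 2 - v t ^ 2) + a * (2 * u t * v t)) / (u t ^ 2 + v t ^ 2) ^ 2).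
Proof. intros N. derive_tac; [simpl; nra | field; simpl in *; nra]. Qed.

Lemma is_derive_ln_mod : 0 < u t ->
  is_derive (fun s => / 2 * ln (u s ^ 2 + v s ^ 2)) t ((a * u t + b * v t) / (u t ^ 2 + v t ^ 2)).
Proof. intros N. derive_tac; [simpl; nra | field; simpl in *; nra]. Qed.

Lemma is_derive_atan_div : 0 < u t ->
  is_derive (fun s => atan (v s / u s)) t ((b * u t - a * v t) / (u t ^ 2 + v t ^ 2)).
Proof. intros N. derive_tac; [lra | unfold Rsqr; field; split; nra]. Qed.

Lemma is_derive_projection (g : R -> R) (g' m x y : R) : is_derive g t g' ->
  is_derive (fun s => g s * m - (x * u s + y * v s)) t (g' * m - (x * a + y * b)).
Proof. intros Hg. derive_tac. Qed.

End RealDerivatives.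

(** Differentiation in a real parameter, componentwise, so that the real mean value theorem and
    [auto_derive] apply. Complex functions are differentiated in this sense along lines and
    circles. *)
Definition Cder (f : R -> C) (t : R) (l : C) : Prop :=
  is_derive (fun s => Re (f s)) t (Re l) /\ is_derive (fun s => Im (f s)) t (Im l).

Lemma Cder_ext (f g : R -> C) (t : R) (l : C) :
  (forall s, f s = g s) -> Cder f t l -> Cder g t l.
Proof.
  intros E [H1 H2]; split; [eapply is_derive_ext; [|apply H1]|eapply is_derive_ext; [|apply H2]];
  intros s; simpl; rewrite E; reflexivity.
Qed.

Lemma Cder_const (c : C) (t : R) : Cder (fun _ => c) t 0%C.
Proof. split; [exact (is_derive_const (Re c) t)|exact (is_derive_const (Im c) t)]. Qed.

Lemma Cder_RtoC (f : R -> R) (t l : R) : is_derive f t l -> Cder (fun s => RtoC (f s)) t (RtoC l).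
Proof. intros H; split; [exact H | exact (is_derive_const 0 t)]. Qed.

Lemma Cder_plus (f g : R -> C) (t : R) (a b : C) :
  Cder f t a -> Cder g t b -> Cder (fun s => (f s + g s)%C) t (a + b)%C.
Proof. intros [H1 H2] [H3 H4]; split; [exact (is_derive_plus _ _ t _ _ H1 H3)|exact (is_derive_plus _ _ t _ _ H2 H4)]. Qed.

Lemma Cder_opp (f : R -> C) (t : R) (a : C) :
  Cder f t a -> Cder (fun s => (- f s)%C) t (- a)%C.
Proof. intros [H1 H2]; split; [exact (is_derive_opp _ t _ H1)|exact (is_derive_opp _ t _ H2)]. Qed.

Lemma Cder_minus (f g : R -> C) (t : R) (a b : C) :
  Cder f t a -> Cder g t b -> Cder (fun s => (f s - g s)%C) t (a - b)%C.
Proof. intros H1 H2. apply Cder_plus; auto. apply Cder_opp; auto. Qed.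

Lemma Cder_mult (f g : R -> C) (t : R) (a b : C) :
  Cder f t a -> Cder g t b -> Cder (fun s => (f s * g s)%C) t (a * g t + f t * b)%C.
Proof.
  intros [H1 H2] [H3 H4]. split.
  - apply is_derive_value with (Re a * Re (g t) + Re (f t) * Re b - (Im a * Im (g t) + Im (f t) * Im b)).
    + exact (is_derive_mult_minus _ _ _ _ t _ _ _ _ H1 H2 H3 H4).
    + rewrite Re_plus, !Re_mult. ring.
  - apply is_derive_value with (Re a * Im (g t) + Re (f t) * Im b + (Im a * Re (g t) + Im (f t) * Re b)).
    + exact (is_derive_mult_plus _ _ _ _ t _ _ _ _ H1 H2 H4 H3).
    + rewrite Im_plus, !Im_mult. ring.
Qed.

Lemma Cder_scal (c : C) (f : R -> C) (t : R) (a : C) :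
  Cder f t a -> Cder (fun s => (c * f s)%C) t (c * a)%C.
Proof.
  intros H. replace (c * a)%C with (0 * f t + c * a)%C by ring.
  apply (Cder_mult (fun _ => c)); auto. apply Cder_const.
Qed.

Lemma Cder_Cexp (f : R -> C) (t : R) (a : C) :
  Cder f t a -> Cder (fun s => Cexp (f s)) t (a * Cexp (f t))%C.
Proof.
  intros [H1 H2]; split.
  - exact (is_derive_exp_cos _ _ t _ _ H1 H2).
  - exact (is_derive_exp_sin _ _ t _ _ H1 H2).
Qed.

Lemma Cder_inv (f : R -> C) (t : R) (a : C) :
  Cder f t a -> f t <> 0%C -> Cder (fun s => (/ f s)%C) t (- (a / (f t * f t)))%C.
Proof.
  intros [H1 H2] N.
  assert (P : 0 < Re (f t) * Re (f t) + Im (f t) * Im (f t)).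
  { rewrite <- Cmod_2. apply Cmod_gt_0 in N. nra. }
  split.
  - eapply is_derive_value; [exact (is_derive_inv_re _ _ t _ _ H1 H2 P)|].
    unfold Cdiv. rewrite Re_opp, Cinv_coords, !Re_mult, !Im_mult. simpl. field. simpl in P; nra.
  - eapply is_derive_value; [exact (is_derive_inv_im _ _ t _ _ H1 H2 P)|].
    unfold Cdiv. rewrite Im_opp, Cinv_coords, !Re_mult, !Im_mult. simpl. field. simpl in P; nra.
Qed.

Lemma Cder_Cln (f : R -> C) (t : R) (a : C) :
  Cder f t a -> 0 < Re (f t) -> Cder (fun s => Cln (f s)) t (a / f t)%C.
Proof.
  intros [H1 H2] P.
  assert (L : locally t (fun s => 0 < Re (f s))).
  { assert (Hc : continuous (fun s => Re (f s)) t).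
    { apply @ex_derive_continuous. eexists; eauto. }
    apply (Hc (fun y => 0 < y)). apply (open_gt 0 (Re (f t))). auto. }
  split.
  - eapply is_derive_ext_loc with (f := fun s => / 2 * ln (Re (f s) ^ 2 + Im (f s) ^ 2)).
    { revert L; apply filter_imp; intros s Hs. rewrite Cln_coords by auto. reflexivity. }
    eapply is_derive_value; [exact (is_derive_ln_mod _ _ t _ _ H1 H2 P)|].
    unfold Cdiv. rewrite Cinv_coords, Re_mult. simpl. simpl in P. field. nra.
  - eapply is_derive_ext_loc with (f := fun s => atan (Im (f s) / Re (f s))).
    { revert L; apply filter_imp; intros s Hs. rewrite Cln_coords by auto. reflexivity. }
    eapply is_derive_value; [exact (is_derive_atan_div _ _ t _ _ H1 H2 P)|].
    unfold Cdiv. rewrite Cinv_coords, Im_mult. simpl. simpl in P. field. nra.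
Qed.

Lemma Cder_line (A B : C) (t : R) : Cder (fun s => (A + RtoC s * B)%C) t B.
Proof.
  split.
  - eapply is_derive_ext with (f := fun s => Re A + (s * Re B - 0 * Im B)); [reflexivity|].
    auto_derive; auto. ring.
  - eapply is_derive_ext with (f := fun s => Im A + (s * Im B + 0 * Re B)); [reflexivity|].
    auto_derive; auto. ring.
Qed.

(* Projecting on the direction of [f b - f a] reduces the claim to the real
   mean value theorem. *)
Lemma Cder_le (f f' : R -> C) (g g' : R -> R) (a b : R) :
  a <= b ->
  (forall t, a <= t <= b -> Cder f t (f' t)) ->
  (forall t, a <= t <= b -> is_derive g t (g' t)) ->
  (forall t, a <= t <= b -> Cmod (f' t) <= g' t) ->
  Cmod (f b - f a) <= g b - g a.
Proof.
  intros Hab Hf Hg Hle.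
  set (v := (f b - f a)%C).
  destruct (Req_dec (Cmod v) 0) as [Z|Z].
  { rewrite Z.
    destruct (MVT_gen g a b g') as [c [Hc E]].
    - intros t Ht. apply Hg. rewrite Rmin_left, Rmax_right in Ht; lra.
    - intros t Ht. rewrite Rmin_left, Rmax_right in Ht by lra.
      apply derivable_continuous_pt. eexists. apply is_derive_Reals, Hg; lra.
    - rewrite Rmin_left, Rmax_right in Hc by lra. rewrite E.
      apply Rmult_le_pos; [|lra]. eapply Rle_trans; [apply Cmod_ge_0|apply Hle; lra]. }
  assert (Pv : 0 < Cmod v) by (assert (T := Cmod_ge_0 v); lra).
  set (p := fun t => g t * Cmod v - (Re v * Re (f t) + Im v * Im (f t))).
  set (p' := fun t => g' t * Cmod v - (Re v * Re (f' t) + Im v * Im (f' t))).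
  assert (Hp : forall t, a <= t <= b -> is_derive p t (p' t)).
  { intros t Ht. destruct (Hf t Ht) as [H1 H2]. assert (H3 := Hg t Ht).
    exact (is_derive_projection _ _ t _ _ H1 H2 g _ _ _ _ H3). }
  assert (Pp : forall t, a <= t <= b -> 0 <= p' t).
  { intros t Ht. unfold p'.
    assert (H1 := Hle t Ht).
    (* Cauchy-Schwarz: the projection of [f' t] on [v] is the real part of conj(v) f', hence at most
       |v| |f'|. *)
    assert (H2 : Re v * Re (f' t) + Im v * Im (f' t) = Re (Cconj v * f' t)).
    { rewrite Re_mult. unfold Cconj, Re, Im; simpl. ring. }
    rewrite H2.
    assert (H3 := re_le_Cmod (Cconj v * f' t)).
    rewrite Cmod_mult, Cmod_conj in H3.
    assert (H4 := Rle_abs (Re (Cconj v * f' t))).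
    nra. }
  destruct (MVT_gen p a b p') as [c [Hc E]].
  - intros t Ht. apply Hp. rewrite Rmin_left, Rmax_right in Ht; lra.
  - intros t Ht. rewrite Rmin_left, Rmax_right in Ht by lra.
    apply derivable_continuous_pt. eexists. apply is_derive_Reals, Hp; lra.
  - rewrite Rmin_left, Rmax_right in Hc by lra.
    assert (H := Pp c Hc).
    (* Since [p] is nondecreasing, this difference is nonnegative; dividing it by [Cmod v] gives the
       claim. *)
    assert (E2 : p b - p a = (g b - g a) * Cmod v - Cmod v * Cmod v).
    { rewrite Cmod_2. unfold p, v. rewrite !Re_minus, !Im_minus. ring. }
    nra.
Qed.

Lemma Cder_zero_const (f : R -> C) (a b : R) :
  a <= b -> (forall t, a <= t <= b -> Cder f t 0%C) -> f b = f a.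
Proof.
  intros Hab H.
  assert (E := Cder_le f (fun _ => RtoC 0) (fun _ => 0) (fun _ => 0) a b Hab H).
  assert (Z : Cmod (f b - f a) = 0).
  { apply Rle_antisym; [|apply Cmod_ge_0].
    eapply Rle_trans; [apply E|lra].
    - intros; apply @is_derive_const.
    - intros; rewrite Cmod_0; lra. }
  apply Cmod_eq_0 in Z.
  replace (f b) with (f b - f a + f a)%C by ring. rewrite Z. ring.
Qed.

(** * Limits of complex sequences *)

Definition Clim (u : nat -> C) (l : C) : Prop :=
  is_lim_seq (fun n => Re (u n)) (Re l) /\ is_lim_seq (fun n => Im (u n)) (Im l).

Lemma Clim_Cmod (u : nat -> C) (l : C) :
  Clim u l <-> is_lim_seq (fun n => Cmod (u n - l)) 0.
Proof.
  split.
  - intros [H1 H2].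
    apply is_lim_seq_le_le with (u := fun _ => 0)
      (w := fun n => Rabs (Re (u n) - Re l) + Rabs (Im (u n) - Im l)).
    + intros n; split; [apply Cmod_ge_0|]. apply Cmod_le_abs.
    + apply is_lim_seq_const.
    + replace 0 with (Rabs (Re l - Re l) + Rabs (Im l - Im l)).
      * apply is_lim_seq_plus'; apply is_lim_seq_abs with (l := Finite _);
        apply is_lim_seq_minus'; auto; apply is_lim_seq_const.
      * rewrite !Rminus_diag, Rabs_R0. ring.
  - intros H.
    assert (K : forall v : nat -> R, (forall n, Rabs (v n) <= Cmod (u n - l)) -> is_lim_seq v 0).
    { intros v Hv. apply is_lim_seq_abs_0.
      apply is_lim_seq_le_le with (u := fun _ => 0) (w := fun n => Cmod (u n - l)); auto.
      - intros n; split; [apply Rabs_pos|auto].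
      - apply is_lim_seq_const. }
    split.
    + apply is_lim_seq_ext with (fun n => (Re (u n) - Re l) + Re l); [intros; ring|].
      replace (Finite (Re l)) with (Finite (0 + Re l)) by (f_equal; ring).
      apply is_lim_seq_plus'; [|apply is_lim_seq_const].
      apply K; intros n; exact (re_le_Cmod (u n - l)).
    + apply is_lim_seq_ext with (fun n => (Im (u n) - Im l) + Im l); [intros; ring|].
      replace (Finite (Im l)) with (Finite (0 + Im l)) by (f_equal; ring).
      apply is_lim_seq_plus'; [|apply is_lim_seq_const].
      apply K; intros n; exact (im_le_Cmod (u n - l)).
Qed.

Lemma Clim_unique (u : nat -> C) (l l' : C) : Clim u l -> Clim u l' -> l = l'.
Proof.
  intros [H1 H2] [H3 H4].
  apply is_lim_seq_unique in H1. apply is_lim_seq_unique in H2.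
  apply is_lim_seq_unique in H3. apply is_lim_seq_unique in H4.
  apply C_ext; congruence.
Qed.

Lemma Clim_ext (u v : nat -> C) (l : C) : (forall n, u n = v n) -> Clim u l -> Clim v l.
Proof.
  intros E [H1 H2]; split; [eapply is_lim_seq_ext; [|apply H1]|eapply is_lim_seq_ext; [|apply H2]];
  intros n; simpl; rewrite E; auto.
Qed.

Lemma Clim_const (c : C) : Clim (fun _ => c) c.
Proof. split; apply is_lim_seq_const. Qed.

Lemma Clim_RtoC (u : nat -> R) (l : R) : is_lim_seq u l -> Clim (fun n => RtoC (u n)) (RtoC l).
Proof. intros H; split; [exact H|apply is_lim_seq_const]. Qed.

Lemma Clim_plus (u v : nat -> C) (a b : C) :
  Clim u a -> Clim v b -> Clim (fun n => (u n + v n)%C) (a + b)%C.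
Proof. intros [H1 H2] [H3 H4]; split; apply is_lim_seq_plus'; auto. Qed.

Lemma Clim_opp (u : nat -> C) (a : C) : Clim u a -> Clim (fun n => (- u n)%C) (- a)%C.
Proof.
  intros [H1 H2]; split.
  - exact (proj1 (is_lim_seq_opp _ (Finite _)) H1).
  - exact (proj1 (is_lim_seq_opp _ (Finite _)) H2).
Qed.

Lemma Clim_minus (u v : nat -> C) (a b : C) :
  Clim u a -> Clim v b -> Clim (fun n => (u n - v n)%C) (a - b)%C.
Proof. intros H1 H2. apply Clim_plus; auto. apply Clim_opp; auto. Qed.

Lemma Clim_mult (u v : nat -> C) (a b : C) :
  Clim u a -> Clim v b -> Clim (fun n => (u n * v n)%C) (a * b)%C.
Proof.
  intros [H1 H2] [H3 H4]; split.
  - apply is_lim_seq_minus'; apply is_lim_seq_mult'; auto.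
  - apply is_lim_seq_plus'; apply is_lim_seq_mult'; auto.
Qed.

Lemma Clim_Cexp (u : nat -> C) (a : C) : Clim u a -> Clim (fun n => Cexp (u n)) (Cexp a).
Proof.
  intros [H1 H2].
  assert (E := is_lim_seq_continuous exp _ _ (derivable_continuous_pt _ _ (derivable_pt_exp (Re a))) H1).
  assert (Co := is_lim_seq_continuous cos _ _ (continuity_cos (Im a)) H2).
  assert (Si := is_lim_seq_continuous sin _ _ (continuity_sin (Im a)) H2).
  split; apply is_lim_seq_mult'; auto.
Qed.

Lemma Clim_le_0 (u : nat -> C) (v : nat -> R) (l : C) (N : nat) :
  (forall n, (N <= n)%nat -> Cmod (u n - l) <= v n) -> is_lim_seq v 0 -> Clim u l.
Proof.
  intros H Hv. apply Clim_Cmod.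
  apply is_lim_seq_le_le_loc with (u := fun _ => 0) (w := v); auto.
  - exists N; intros n Hn; split; [apply Cmod_ge_0|auto].
  - apply is_lim_seq_const.
Qed.

(** * Laplace transforms *)

Definition CInt (f : R -> C) (l : C) : Prop :=
  @is_RInt_gen C_R_NormedModule f (at_point 0) (Rbar_locally p_infty) l.

Definition Ccont (f : R -> C) (x : R) : Prop :=
  continuous (fun s => Re (f s)) x /\ continuous (fun s => Im (f s)) x.

Lemma Ccont_is_RInt (f : R -> C) (a b : R) : (forall x, Ccont f x) ->
  exists l : C, @is_RInt C_R_NormedModule f a b l.
Proof.
  intros H.
  destruct (ex_RInt_continuous (V := R_CompleteNormedModule) (fun s => Re (f s)) a b) as [p Hp].
  { intros; apply H. }
  destruct (ex_RInt_continuous (V := R_CompleteNormedModule) (fun s => Im (f s)) a b) as [q Hq].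
  { intros; apply H. }
  exists (p, q). apply (is_RInt_fct_extend_pair (U := R_NormedModule) (V := R_NormedModule)); auto.
Qed.

Lemma CInt_of_lim (f F : R -> C) (l : C) :
  (forall b, 0 <= b -> @is_RInt C_R_NormedModule f 0 b (F b)) ->
  (forall eps, 0 < eps -> exists B, forall b, B <= b -> Cmod (F b - l) < eps) ->
  CInt f l.
Proof.
  intros HF Hl P HP.
  apply (@locally_norm_le_locally _ C_R_NormedModule) in HP. destruct HP as [eps He].
  destruct (Hl eps (cond_pos eps)) as [B HB].
  apply (Filter_prod _ _ _ (fun a => a = 0) (fun b => Rmax 0 B < b)).
  - reflexivity.
  - exists (Rmax 0 B); auto.
  - intros a b -> Hb. exists (F b). split.
    + apply HF. apply Rle_trans with (2 := Rlt_le _ _ Hb). apply Rmax_l.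
    + apply He. unfold ball_norm. rewrite <- Cmod_norm. apply HB.
      apply Rle_trans with (2 := Rlt_le _ _ Hb). apply Rmax_r.
Qed.

Lemma proper_at_0 : ProperFilter' (at_point (0 : R)).
Proof. typeclasses eauto. Qed.

Lemma proper_p_infty : ProperFilter' (Rbar_locally p_infty).
Proof. typeclasses eauto. Qed.

Lemma filter_at_0 : Filter (at_point (0 : R)).
Proof. typeclasses eauto. Qed.

Lemma filter_p_infty : Filter (Rbar_locally p_infty).
Proof. typeclasses eauto. Qed.

Lemma CInt_RInt_gen (f : R -> C) (l : C) : CInt f l ->
  @RInt_gen C_R_CompleteNormedModule f (at_point 0) (Rbar_locally p_infty) = l.
Proof.
  intros H.
  pose proof (@is_RInt_gen_unique C_R_CompleteNormedModule (at_point 0) (Rbar_locally p_infty)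
    proper_at_0 proper_p_infty f l) as E.
  apply E. exact H.
Qed.

Lemma CInt_unique (f : R -> C) (l l' : C) : CInt f l -> CInt f l' -> l = l'.
Proof.
  intros H1 H2. rewrite <- (CInt_RInt_gen f l H1). apply CInt_RInt_gen, H2.
Qed.

Lemma CInt_ext (f g : R -> C) (l : C) :
  (forall x, 0 < x -> f x = g x) -> CInt f l -> CInt g l.
Proof.
  intros H.
  pose proof (@is_RInt_gen_ext C_R_NormedModule (at_point 0) (Rbar_locally p_infty)
    filter_at_0 filter_p_infty f g l) as E.
  apply E.
  apply (Filter_prod _ _ _ (fun a => a = 0) (fun b => 0 < b)).
  - reflexivity.
  - exists 0; auto.
  - intros a b -> Hb x [Hx _]; simpl in *. rewrite Rmin_left in Hx by lra. apply H; lra.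
Qed.

Lemma CInt_plus (f g : R -> C) (a b : C) :
  CInt f a -> CInt g b -> CInt (fun x => (f x + g x)%C) (a + b)%C.
Proof. intros H1 H2. exact (is_RInt_gen_plus (V := C_R_NormedModule) f g a b H1 H2). Qed.

Lemma CInt_scal (k : R) (f : R -> C) (a : C) :
  CInt f a -> CInt (fun x => (RtoC k * f x)%C) (RtoC k * a)%C.
Proof.
  intros H1.
  assert (H := is_RInt_gen_scal (V := C_R_NormedModule) f k a H1).
  rewrite <- scal_R_Cmult.
  apply (CInt_ext (fun y => scal k (f y))); auto. intros; apply scal_R_Cmult.
Qed.

Lemma CInt_opp (f : R -> C) (a : C) : CInt f a -> CInt (fun x => (- f x)%C) (- a)%C.
Proof. intros H1. exact (is_RInt_gen_opp (V := C_R_NormedModule) f a H1). Qed.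

Lemma CInt_minus (f g : R -> C) (a b : C) :
  CInt f a -> CInt g b -> CInt (fun x => (f x - g x)%C) (a - b)%C.
Proof. intros H1 H2. apply CInt_plus; auto. apply CInt_opp; auto. Qed.

Lemma is_RInt_exp_decay (M d a b : R) : 0 < d ->
  is_RInt (fun x => M * exp (- d * x)) a b (M / d * exp (- d * a) - M / d * exp (- d * b)).
Proof.
  intros Hd.
  replace (M / d * exp (- d * a) - M / d * exp (- d * b))
    with (minus ((fun x => - (M / d) * exp (- d * x)) b) ((fun x => - (M / d) * exp (- d * x)) a))
    by (unfold minus, plus, opp; simpl; ring).
  apply (is_RInt_derive (V := R_CompleteNormedModule) (fun x => - (M / d) * exp (- d * x))).
  - intros x _. auto_derive; auto. field. lra.
  - intros x _. apply (ex_derive_continuous (fun x => M * exp (- d * x))). auto_derive. auto.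
Qed.

Lemma exp_decay (d : R) (eps : R) : 0 < d -> 0 < eps ->
  exists B, 0 <= B /\ forall b, B <= b -> exp (- d * b) < eps.
Proof.
  intros Hd He. exists (Rmax 0 (1 - ln eps / d)). split; [apply Rmax_l|].
  intros b Hb.
  assert (1 - ln eps / d <= b) by (eapply Rle_trans; [apply Rmax_r|eauto]).
  rewrite <- (exp_ln eps) at 1 by auto. apply exp_increasing.
  assert (d * (1 - ln eps / d) <= d * b) by (apply Rmult_le_compat_l; lra).
  replace (d * (1 - ln eps / d)) with (d - ln eps) in H0 by (field; lra). lra.
Qed.

(** The integral over [a, b] is at most M / d * exp (- d a), so the partial integrals satisfy the
    Cauchy criterion, and a = 0 gives the bound on the limit. Convergence, continuity and
    differentiability of Laplace transforms all come from this lemma, applied to suitable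
    differences of integrands. *)
Lemma CInt_bounded (f : R -> C) (M d : R) :
  0 < d -> (forall x, Ccont f x) ->
  (forall x, 0 <= x -> Cmod (f x) <= M * exp (- d * x)) ->
  exists l, CInt f l /\ Cmod l <= M / d.
Proof.
  intros Hd Hc Hb.
  assert (HM : 0 <= M).
  { assert (H := Hb 0 (Rle_refl 0)). rewrite Rmult_0_r, exp_0 in H.
    assert (T := Cmod_ge_0 (f 0)). lra. }
  assert (Hex : forall a b, @ex_RInt C_R_NormedModule f a b)
    by (intros; apply Ccont_is_RInt; auto).
  set (F := fun b => @RInt C_R_CompleteNormedModule f 0 b).
  assert (HF : forall b, @is_RInt C_R_NormedModule f 0 b (F b)).
  { intros b. apply (@RInt_correct C_R_CompleteNormedModule). apply Hex. }
  assert (K : forall a b, 0 <= a -> a <= b -> Cmod (F b - F a) <= M / d * exp (- d * a)).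
  { intros a b Ha Hab. rewrite Cmod_norm.
    apply Rle_trans with (M / d * exp (- d * a) - M / d * exp (- d * b)).
    - apply (norm_RInt_le (V := C_R_NormedModule) f (fun x => M * exp (- d * x)) a b); auto.
      + intros x Hx. rewrite <- Cmod_norm. apply Hb; lra.
      + replace (F b - F a)%C with (@minus C_R_NormedModule (F b) (F a)) by reflexivity.
        replace (@minus C_R_NormedModule (F b) (F a)) with (@plus C_R_NormedModule (@opp C_R_NormedModule (F a)) (F b)).
        * apply (@is_RInt_Chasles C_R_NormedModule f a 0 b).
          -- apply (@is_RInt_swap C_R_NormedModule), HF.
          -- apply HF.
        * unfold minus. apply plus_comm.
      + apply is_RInt_exp_decay; auto.
    - assert (0 <= M / d * exp (- d * b)).
      { apply Rmult_le_pos; [|left; apply exp_pos]. apply Rdiv_le_0_compat; lra. }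
      lra. }
  destruct (proj1 (@filterlim_locally_cauchy R C_R_CompleteNormedModule (Rbar_locally p_infty) _ F)) as [l Hl].
  { intros eps.
    destruct (exp_decay d (eps / 2 / (M / d + 1)) Hd) as [B [HB0 HB]].
    { assert (0 <= M / d) by (apply Rdiv_le_0_compat; lra).
      apply Rdiv_lt_0_compat; [|lra]. assert (E := cond_pos eps). lra. }
    exists (fun b => B < b). split; [exists B; auto|].
    assert (G : forall u, B < u -> Cmod (F u - F B) < eps / 2).
    { intros u Hu. eapply Rle_lt_trans; [apply K; lra|].
      assert (H0 : 0 <= M / d) by (apply Rdiv_le_0_compat; lra).
      assert (H1 := HB B (Rle_refl B)).
      assert (H2 : (M / d + 1) * exp (- d * B) < (M / d + 1) * (eps / 2 / (M / d + 1)))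
        by (apply Rmult_lt_compat_l; lra).
      replace ((M / d + 1) * (eps / 2 / (M / d + 1))) with (eps / 2) in H2 by (field; lra).
      assert (H3 := exp_pos (- d * B)). lra. }
    intros u v Hu Hv. apply (@norm_compat1 _ C_R_NormedModule).
    rewrite <- Cmod_norm. change (Cmod (F v - F u) < eps).
    replace (F v - F u)%C with ((F v - F B) - (F u - F B))%C by ring.
    eapply Rle_lt_trans; [apply Cmod_triangle|]. rewrite Cmod_opp.
    assert (H1 := G u Hu). assert (H2 := G v Hv). lra. }
  assert (Hl' : forall eps, 0 < eps -> exists B, forall b, B <= b -> Cmod (F b - l) < eps).
  { intros eps He.
    assert (HP := Hl (fun y => ball_norm (V := C_R_NormedModule) l eps y)).
    destruct HP as [B HB].
    - apply (@locally_le_locally_norm _ C_R_NormedModule). exists (mkposreal _ He). auto.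
    - exists (B + 1). intros b Hb1. rewrite Cmod_norm. apply (HB b). lra. }
  exists l. split.
  - apply (CInt_of_lim f F); auto.
  - apply Rnot_lt_le. intros HH.
    destruct (Hl' (Cmod l - M / d)) as [B HB]; [lra|].
    assert (H1 := HB (Rmax 0 B) (Rmax_r _ _)).
    assert (H2 := K 0 (Rmax 0 B) (Rle_refl 0) (Rmax_l _ _)).
    rewrite Rmult_0_r, exp_0, Rmult_1_r in H2.
    assert (E0 : F 0 = RtoC 0).
    { unfold F. rewrite (@RInt_point C_R_CompleteNormedModule). reflexivity. }
    rewrite E0 in H2.
    assert (H3 := Cmod_triangle_inv l (l - F (Rmax 0 B))).
    replace (l - (l - F (Rmax 0 B)))%C with (F (Rmax 0 B) - 0)%C in H3 by ring.
    rewrite Cmod_minus_sym in H1. lra.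
Qed.

(** Subexponential growth makes the Laplace transform converge for every Re z > 0. The class is
    closed under products, in particular under multiplication by x, which is what differentiating a
    transform does to the function. *)
Definition tame (h : R -> R) : Prop :=
  (forall x, continuous h x) /\
  forall eps, 0 < eps -> exists K, 0 <= K /\ forall x, 0 <= x -> Rabs (h x) <= K * exp (eps * x).

Definition lap_fun (h : R -> R) (z : C) (x : R) : C :=
  (Cexp (- (z * RtoC x)) * RtoC (h x))%C.

Definition Lap (h : R -> R) (z : C) : C :=
  @RInt_gen C_R_CompleteNormedModule (lap_fun h z) (at_point 0) (Rbar_locally p_infty).

Lemma lap_fun_coords (h : R -> R) (z : C) (x : R) :
  lap_fun h z x = (exp (- (Re z * x)) * cos (- (Im z * x)) * h x,
                   exp (- (Re z * x)) * sin (- (Im z * x)) * h x).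
Proof.
  unfold lap_fun, Cexp. apply C_ext; rewrite ?Re_mult, ?Im_mult; rewrite ?Re_opp, ?Im_opp, ?Re_mult, ?Im_mult; unfold Re, Im; simpl;
  rewrite ?Rmult_0_r, ?Rminus_0_r, ?Rplus_0_r, ?Rplus_0_l; reflexivity.
Qed.

Lemma Cmod_lap_fun (h : R -> R) (z : C) (x : R) :
  Cmod (lap_fun h z x) = exp (- Re z * x) * Rabs (h x).
Proof.
  unfold lap_fun. rewrite Cmod_mult, Cmod_Cexp, Cmod_R. f_equal. f_equal.
  rewrite Re_opp, Re_mult. simpl. ring.
Qed.

Lemma lap_fun_cont (h : R -> R) (z : C) (x : R) : continuous h x -> Ccont (lap_fun h z) x.
Proof.
  intros Hh. split.
  - apply continuous_ext with (fun x => exp (- (Re z * x)) * cos (- (Im z * x)) * h x).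
    { intros y. rewrite lap_fun_coords. reflexivity. }
    apply (continuous_mult (fun x => exp (- (Re z * x)) * cos (- (Im z * x))) h); auto.
    apply (ex_derive_continuous (fun x => exp (- (Re z * x)) * cos (- (Im z * x)))). auto_derive. auto.
  - apply continuous_ext with (fun x => exp (- (Re z * x)) * sin (- (Im z * x)) * h x).
    { intros y. rewrite lap_fun_coords. reflexivity. }
    apply (continuous_mult (fun x => exp (- (Re z * x)) * sin (- (Im z * x))) h); auto.
    apply (ex_derive_continuous (fun x => exp (- (Re z * x)) * sin (- (Im z * x)))). auto_derive. auto.
Qed.

Lemma Lap_eq (h : R -> R) (z l : C) : CInt (lap_fun h z) l -> Lap h z = l.
Proof. apply CInt_RInt_gen. Qed.

Lemma CInt_lap_bounded (h : R -> R) (z : C) (K eps : R) :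
  (forall x, continuous h x) -> eps < Re z ->
  (forall x, 0 <= x -> Rabs (h x) <= K * exp (eps * x)) ->
  CInt (lap_fun h z) (Lap h z) /\ Cmod (Lap h z) <= K / (Re z - eps).
Proof.
  intros Hc He Hb.
  destruct (CInt_bounded (lap_fun h z) K (Re z - eps)) as [l [Hl Hm]].
  - lra.
  - intros x; apply lap_fun_cont, Hc.
  - intros x Hx. rewrite Cmod_lap_fun.
    replace (K * exp (- (Re z - eps) * x)) with (exp (- Re z * x) * (K * exp (eps * x))).
    + apply Rmult_le_compat_l; [left; apply exp_pos|auto].
    + rewrite (Rmult_comm K), <- Rmult_assoc, <- exp_plus, Rmult_comm. f_equal. f_equal. ring.
  - rewrite (Lap_eq h z l Hl). auto.
Qed.

Lemma CInt_lap (h : R -> R) (z : C) : tame h -> 0 < Re z -> CInt (lap_fun h z) (Lap h z).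
Proof.
  intros [Hc Hb] Hz. destruct (Hb (Re z / 2)) as [K [_ HK]]; [lra|].
  apply (CInt_lap_bounded h z K (Re z / 2)); auto. lra.
Qed.

Lemma Lap_ext (h g : R -> R) (z : C) : (forall x, 0 < x -> h x = g x) ->
  tame h -> 0 < Re z -> Lap g z = Lap h z.
Proof.
  intros E Hh Hz. apply Lap_eq. apply CInt_ext with (2 := CInt_lap h z Hh Hz).
  intros x Hx. unfold lap_fun. rewrite E; auto.
Qed.

Lemma tame_const (c : R) : tame (fun _ => c).
Proof.
  split; [intros; apply continuous_const|].
  intros eps He. exists (Rabs c). split; [apply Rabs_pos|].
  intros x Hx. assert (0 < Rabs c + 1) by (assert (T := Rabs_pos c); lra).
  assert (1 <= exp (eps * x)) by (assert (T := exp_ineq1_le (eps * x)); nra).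
  assert (T := Rabs_pos c). nra.
Qed.

Lemma tame_id : tame (fun x => x).
Proof.
  split; [intros; apply continuous_id|].
  intros eps He. exists (/ eps). split; [left; apply Rinv_0_lt_compat; auto|].
  intros x Hx. rewrite Rabs_right by lra.
  apply Rmult_le_reg_l with eps; auto. rewrite <- Rmult_assoc, Rinv_r, Rmult_1_l by lra.
  assert (T := exp_ineq1_le (eps * x)). lra.
Qed.

Lemma tame_ext (h g : R -> R) : (forall x, h x = g x) -> tame h -> tame g.
Proof.
  intros E [H1 H2]. split.
  - intros x. apply (continuous_ext h g); auto.
  - intros eps He. destruct (H2 eps He) as [K [P Q]]. exists K; split; auto.
    intros x Hx. rewrite <- E. auto.
Qed.

Lemma tame_plus (h g : R -> R) : tame h -> tame g -> tame (fun x => h x + g x).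
Proof.
  intros [H1 H2] [H3 H4]. split.
  - intros x; apply (continuous_plus h g); auto.
  - intros eps He. destruct (H2 eps He) as [K1 [P1 B1]]. destruct (H4 eps He) as [K2 [P2 B2]].
    exists (K1 + K2); split; [lra|]. intros x Hx.
    eapply Rle_trans; [apply Rabs_triang|]. specialize (B1 x Hx). specialize (B2 x Hx). lra.
Qed.

Lemma tame_mult (h g : R -> R) : tame h -> tame g -> tame (fun x => h x * g x).
Proof.
  intros [H1 H2] [H3 H4]. split.
  - intros x; apply (continuous_mult h g); auto.
  - intros eps He. destruct (H2 (eps/2)) as [K1 [P1 B1]]; [lra|].
    destruct (H4 (eps/2)) as [K2 [P2 B2]]; [lra|].
    exists (K1 * K2); split; [nra|]. intros x Hx.
    replace (eps * x) with (eps / 2 * x + eps / 2 * x) by field.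
    rewrite Rabs_mult, exp_plus. specialize (B1 x Hx). specialize (B2 x Hx).
    replace (K1 * K2 * (exp (eps / 2 * x) * exp (eps / 2 * x)))
      with ((K1 * exp (eps / 2 * x)) * (K2 * exp (eps / 2 * x))) by ring.
    apply Rmult_le_compat; auto using Rabs_pos.
Qed.

Lemma tame_x2 : tame (fun x => x ^ 2).
Proof. apply tame_ext with (2 := tame_mult _ _ tame_id tame_id). intros; simpl; ring. Qed.

Lemma Lap_plus (h g : R -> R) (z : C) : tame h -> tame g -> 0 < Re z ->
  Lap (fun x => h x + g x) z = (Lap h z + Lap g z)%C.
Proof.
  intros H1 H2 Hz. apply Lap_eq.
  apply CInt_ext with (2 := CInt_plus _ _ _ _ (CInt_lap h z H1 Hz) (CInt_lap g z H2 Hz)).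
  intros x _. unfold lap_fun. rewrite RtoC_plus. ring.
Qed.

Lemma Lap_scal (c : R) (h : R -> R) (z : C) : tame h -> 0 < Re z ->
  Lap (fun x => c * h x) z = (RtoC c * Lap h z)%C.
Proof.
  intros H1 Hz. apply Lap_eq.
  apply CInt_ext with (2 := CInt_scal c _ _ (CInt_lap h z H1 Hz)).
  intros x _. unfold lap_fun. rewrite RtoC_mult. ring.
Qed.

Lemma exp_le (x y : R) : x <= y -> exp x <= exp y.
Proof. intros [H|H]; [left; apply exp_increasing; auto|right; rewrite H; auto]. Qed.

Lemma Cmod_Cexp_sub_1 (w : C) : Cmod (Cexp w - 1) <= Cmod w * exp (Cmod w).
Proof.
  assert (H := Cder_le (fun s => Cexp (0 + RtoC s * w)%C) (fun s => (w * Cexp (0 + RtoC s * w))%C)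
    (fun s => s * (Cmod w * exp (Cmod w))) (fun _ => Cmod w * exp (Cmod w)) 0 1).
  cbv beta in H.
  replace (0 + 1 * w)%C with w in H by ring. replace (0 + 0 * w)%C with (RtoC 0) in H by ring.
  rewrite Cexp_0 in H. eapply Rle_trans; [apply H|lra].
  - lra.
  - intros t _. apply Cder_Cexp, Cder_line.
  - intros t _. auto_derive; auto. ring.
  - intros t Ht. rewrite Cmod_mult. apply Rmult_le_compat_l; [apply Cmod_ge_0|].
    rewrite Cmod_Cexp. apply exp_le.
    eapply Rle_trans; [apply Rle_abs|]. eapply Rle_trans; [apply re_le_Cmod|].
    replace (0 + RtoC t * w)%C with (RtoC t * w)%C by ring.
    rewrite Cmod_mult, Cmod_R, Rabs_right by lra.
    assert (T := Cmod_ge_0 w). nra.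
Qed.

Lemma exp_sub_1_sub_le (v : R) : Rabs (exp v - 1 - v) <= v ^ 2 * exp (Rabs v).
Proof.
  assert (H1 := exp_ineq1_le v). rewrite Rabs_right by lra.
  destruct (Rle_dec 0 v) as [H|H].
  - rewrite Rabs_right by lra.
    assert (H2 := exp_ineq1_le (- v)). assert (H3 := exp_pos v).
    assert (H4 : exp v * exp (- v) = 1) by (rewrite <- exp_plus, Rplus_opp_r; apply exp_0).
    assert (exp v - 1 <= v * exp v) by nra. nra.
  - rewrite Rabs_left by lra.
    assert (H2 := exp_ineq1_le (- v)). assert (H3 := exp_pos v).
    assert (H4 : exp v * exp (- v) = 1) by (rewrite <- exp_plus, Rplus_opp_r; apply exp_0).
    assert (exp v - 1 <= v * exp v) by nra. nra.
Qed.

Lemma Cder_of_quadratic (f : R -> C) (t : R) (l : C) (r K : R) : 0 < r ->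
  (forall u, Rabs u < r -> Cmod (f (t + u)%R - f t - RtoC u * l) <= K * u ^ 2) -> Cder f t l.
Proof.
  intros Hr H.
  assert (G : forall (g : R -> R) (m : R),
    (forall u, Rabs u < r -> Rabs (g (t + u) - g t - u * m) <= K * u ^ 2) -> is_derive g t m).
  { intros g m Hg. apply is_derive_Reals. intros eps He.
    assert (HK : 0 <= K).
    { assert (T := Hg (r / 2)). rewrite (Rabs_right (r/2)) in T by lra.
      assert (T2 : r / 2 < r) by lra. specialize (T T2).
      assert (T3 := Rabs_pos (g (t + r / 2) - g t - r / 2 * m)).
      assert (0 < (r/2)^2) by nra. nra. }
    assert (Hd : 0 < Rmin r (eps / (K + 1))).
    { apply Rmin_pos; auto. apply Rdiv_lt_0_compat; lra. }
    exists (mkposreal _ Hd). intros u Hu Hlt; simpl in Hlt.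
    assert (L1 : Rabs u < r) by (eapply Rlt_le_trans; [apply Hlt|apply Rmin_l]).
    assert (L2 : Rabs u < eps / (K + 1)) by (eapply Rlt_le_trans; [apply Hlt|apply Rmin_r]).
    replace ((g (t + u) - g t) / u - m) with ((g (t + u) - g t - u * m) / u) by (field; auto).
    rewrite Rabs_div by auto.
    assert (P : 0 < Rabs u) by (apply Rabs_pos_lt; auto).
    apply Rmult_lt_reg_r with (Rabs u); auto.
    unfold Rdiv. rewrite Rmult_assoc, Rinv_l, Rmult_1_r by lra.
    eapply Rle_lt_trans; [apply Hg; auto|].
    rewrite <- (pow2_abs u).
    assert (Rabs u * (K + 1) < eps).
    { apply Rmult_lt_compat_r with (r := K + 1) in L2; [|lra].
      replace (eps / (K + 1) * (K + 1)) with eps in L2 by (field; lra). auto. }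
    nra. }
  split; apply G; intros u Hu.
  - replace (Re (f (t + u)) - Re (f t) - u * Re l) with (Re (f (t + u)%R - f t - RtoC u * l)%C).
    + eapply Rle_trans; [apply re_le_Cmod|auto].
    + rewrite !Re_minus, Re_mult. simpl. ring.
  - replace (Im (f (t + u)) - Im (f t) - u * Im l) with (Im (f (t + u)%R - f t - RtoC u * l)%C).
    + eapply Rle_trans; [apply im_le_Cmod|auto].
    + rewrite !Im_minus, Im_mult. simpl. ring.
Qed.

(** The displacement [w] is complex here, unlike in [Cder_Lap]: continuity along vertical lines is
    what the comparison of logarithms off the real axis needs. The estimate is |exp (- w x) - 1| <=
    |w| x exp (|w| x). *)
Lemma Lap_lipschitz (h : R -> R) (z : C) : tame h -> 0 < Re z ->
  exists r K, 0 < r /\ r <= Re z / 2 /\ forall w, Cmod w <= r -> Cmod (Lap h (z + w)%C - Lap h z) <= K * Cmod w.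
Proof.
  intros Hh Hz.
  (* One rate [e] pays for the displacement and another for the growth of x h(x); at least half of
     the decay exp (- Re z x) is left. *)
  set (e := Re z / 8). assert (He : 0 < e) by (unfold e; lra).
  assert (Hxh := tame_mult _ _ tame_id Hh).
  destruct (proj2 Hxh e He) as [K [HK HB]].
  exists e, (K / (Re z / 2)). split; [auto|]. split; [unfold e; lra|]. intros w Hw.
  assert (Hzw : 0 < Re (z + w)%C).
  { rewrite Re_plus. assert (T := re_le_Cmod w).
    assert (Rabs (Re w) <= e) by lra. apply Rabs_le_between in H. unfold e in *; lra. }
  assert (I := CInt_minus _ _ _ _ (CInt_lap h _ Hh Hzw) (CInt_lap h _ Hh Hz)).
  destruct (CInt_bounded (fun x => (lap_fun h (z + w) x - lap_fun h z x)%C) (K * Cmod w) (Re z / 2))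
    as [l [Hl Hm]].
  - lra.
  - intros x.
    destruct (lap_fun_cont h (z + w)%C x (proj1 Hh x)) as [P1 P2].
    destruct (lap_fun_cont h z x (proj1 Hh x)) as [P3 P4].
    split; apply @continuous_minus; auto.
  - intros x Hx.
    replace (lap_fun h (z + w) x - lap_fun h z x)%C
      with (Cexp (- (z * RtoC x)) * (Cexp (- (w * RtoC x)) - 1) * RtoC (h x))%C.
    2: { unfold lap_fun.
         replace (- ((z + w) * x))%C with (- (z * x) + - (w * x))%C by ring.
         rewrite Cexp_plus. ring. }
    rewrite !Cmod_mult, Cmod_Cexp, Cmod_R.
    assert (B1 := Cmod_Cexp_sub_1 (- (w * RtoC x))%C).
    rewrite Cmod_opp, Cmod_mult, Cmod_R, Rabs_right in B1 by lra.
    assert (B2 := HB x Hx). rewrite Rabs_mult, (Rabs_right x) in B2 by lra.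
    assert (B3 : exp (Cmod w * x) <= exp (e * x)) by (apply exp_le; nra).
    rewrite Re_opp, Re_mult, Re_RtoC, Im_RtoC, Rmult_0_r, Rminus_0_r.
    assert (P1 := exp_pos (- (Re z * x))). assert (P2 := Cmod_ge_0 w).
    assert (P3 := Rabs_pos (h x)). assert (P4 := exp_pos (e * x)).
    apply Rle_trans with (exp (- (Re z * x)) * (Cmod w * x * exp (e * x)) * Rabs (h x)).
    + apply Rmult_le_compat_r; auto. apply Rmult_le_compat_l; [lra|].
      eapply Rle_trans; [apply B1|]. apply Rmult_le_compat_l; [nra|auto].
    + apply Rle_trans with (exp (- (Re z * x)) * (Cmod w * exp (e * x)) * (K * exp (e * x))).
      * replace (exp (- (Re z * x)) * (Cmod w * x * exp (e * x)) * Rabs (h x))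
          with (exp (- (Re z * x)) * (Cmod w * exp (e * x)) * (x * Rabs (h x))) by ring.
        apply Rmult_le_compat_l; auto. apply Rmult_le_pos; [lra|]. apply Rmult_le_pos; lra.
      * replace (exp (- (Re z * x)) * (Cmod w * exp (e * x)) * (K * exp (e * x)))
          with (K * Cmod w * (exp (- (Re z * x)) * exp (e * x) * exp (e * x))) by ring.
        rewrite <- !exp_plus. apply Rmult_le_compat_l; [nra|].
        apply exp_le. unfold e. nra.
  - rewrite (CInt_unique _ _ _ I Hl). unfold Rdiv in *. lra.
Qed.

(** Differentiation under the integral sign. For real u the factor exp (- u x) - 1 + u x is at most
    u^2 x^2 exp (|u| x), and x^2 h is tame, so the first-order expansion of the transform has an
    error of order u^2. *)
Lemma Cder_Lap (h : R -> R) (A : C) (t : R) : tame h -> 0 < Re (A + RtoC t * 1)%C ->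
  Cder (fun s => Lap h (A + RtoC s * 1)%C) t (- Lap (fun x => (x * h x)%R) (A + RtoC t * 1)%C)%C.
Proof.
  intros Hh Hz. set (z := (A + RtoC t * 1)%C) in *.
  set (e := Re z / 8). assert (He : 0 < e) by (unfold e; lra).
  assert (Hxh := tame_mult _ _ tame_id Hh). assert (Hxxh := tame_mult _ _ tame_id Hxh).
  destruct (proj2 Hxxh e He) as [K [HK HB]].
  apply (Cder_of_quadratic _ _ _ e (K / (Re z / 2))); auto.
  intros u Hu. fold z.
  replace (A + RtoC (t + u) * 1)%C with (z + RtoC u)%C by (unfold z; rewrite RtoC_plus; ring).
  assert (Hzw : 0 < Re (z + RtoC u)%C).
  { rewrite Re_plus, Re_RtoC. apply Rabs_lt_between in Hu. unfold e in *; lra. }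
  assert (I := CInt_plus _ _ _ _ (CInt_minus _ _ _ _ (CInt_lap h _ Hh Hzw) (CInt_lap h _ Hh Hz))
    (CInt_scal u _ _ (CInt_lap _ _ Hxh Hz))).
  cbv beta in I.
  destruct (CInt_bounded (fun x => (lap_fun h (z + u) x - lap_fun h z x
     + RtoC u * lap_fun (fun x => (x * h x)%R) z x)%C) (K * u ^ 2) (Re z / 2))
    as [l [Hl Hm]].
  - lra.
  - intros x.
    destruct (lap_fun_cont h (z + RtoC u)%C x (proj1 Hh x)) as [P1 P2].
    destruct (lap_fun_cont h z x (proj1 Hh x)) as [P3 P4].
    destruct (lap_fun_cont _ z x (proj1 Hxh x)) as [P5 P6].
    split.
    + apply continuous_ext with (fun x => Re (lap_fun h (z + RtoC u)%C x) - Re (lap_fun h z x)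
        + u * Re (lap_fun (fun x => x * h x) z x)).
      { intros y. rewrite Re_plus, Re_minus, Re_mult. simpl. ring. }
      apply @continuous_plus; [apply @continuous_minus; auto|].
      apply (continuous_scal_r u (fun x => Re (lap_fun (fun x => x * h x) z x))); auto.
    + apply continuous_ext with (fun x => Im (lap_fun h (z + RtoC u)%C x) - Im (lap_fun h z x)
        + u * Im (lap_fun (fun x => x * h x) z x)).
      { intros y. rewrite Im_plus, Im_minus, Im_mult. simpl. ring. }
      apply @continuous_plus; [apply @continuous_minus; auto|].
      apply (continuous_scal_r u (fun x => Im (lap_fun (fun x => x * h x) z x))); auto.
  - intros x Hx.
    replace (lap_fun h (z + u) x - lap_fun h z x + RtoC u * lap_fun (fun x => (x * h x)%R) z x)%C
      with (Cexp (- (z * RtoC x)) * RtoC ((exp (- (u * x)) - 1 - - (u * x)) * h x)%R)%C.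
    2: { unfold lap_fun.
         replace (- ((z + u) * x))%C with (- (z * x) + - (u * x))%C by ring.
         rewrite Cexp_plus. rewrite <- (RtoC_mult u x), <- (RtoC_opp (u * x)), Cexp_RtoC.
         rewrite ?RtoC_mult, ?RtoC_minus, ?RtoC_opp, ?RtoC_mult. ring. }
    rewrite !Cmod_mult, Cmod_Cexp, Cmod_R, Rabs_mult.
    assert (B1 := exp_sub_1_sub_le (- (u * x))).
    rewrite Rabs_Ropp, Rabs_mult, (Rabs_right x) in B1 by lra.
    assert (B2 := HB x Hx). rewrite !Rabs_mult, (Rabs_right x) in B2 by lra.
    assert (B3 : exp (Rabs u * x) <= exp (e * x)) by (apply exp_le; nra).
    rewrite Re_opp, Re_mult, Re_RtoC, Im_RtoC, Rmult_0_r, Rminus_0_r.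
    assert (P1 := exp_pos (- (Re z * x))).
    assert (P3 := Rabs_pos (h x)). assert (P4 := exp_pos (e * x)).
    apply Rle_trans with (exp (- (Re z * x)) * ((- (u * x)) ^ 2 * exp (e * x) * Rabs (h x))).
    + apply Rmult_le_compat_l; [lra|]. apply Rmult_le_compat_r; auto.
      eapply Rle_trans; [apply B1|]. apply Rmult_le_compat_l; [apply pow2_ge_0|auto].
    + replace (exp (- (Re z * x)) * ((- (u * x)) ^ 2 * exp (e * x) * Rabs (h x)))
          with (exp (- (Re z * x)) * (u ^ 2 * exp (e * x)) * (x * (x * Rabs (h x)))) by ring.
      apply Rle_trans with (exp (- (Re z * x)) * (u ^ 2 * exp (e * x)) * (K * exp (e * x))).
      * apply Rmult_le_compat_l; auto. apply Rmult_le_pos; [lra|].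
        apply Rmult_le_pos; [apply pow2_ge_0|lra].
      * replace (exp (- (Re z * x)) * (u ^ 2 * exp (e * x)) * (K * exp (e * x)))
          with (K * u ^ 2 * (exp (- (Re z * x)) * exp (e * x) * exp (e * x))) by ring.
        rewrite <- !exp_plus. apply Rmult_le_compat_l; [apply Rmult_le_pos; [auto|apply pow2_ge_0]|].
        apply exp_le. unfold e. nra.
  - replace (Lap h (z + u) - Lap h z - u * - Lap (fun x => (x * h x)%R) z)%C with l.
    + unfold Rdiv in *. lra.
    + rewrite <- (CInt_unique _ _ _ I Hl). ring.
Qed.

Lemma Lap_1 (z : C) : 0 < Re z -> Lap (fun _ => 1) z = (/ z)%C.
Proof.
  intros Hz. apply Lap_eq. assert (Nz := Re_pos_neq_0 z Hz).
  apply CInt_of_lim with (F := fun b => (/ z - / z * Cexp (0 + RtoC b * (- z)))%C).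
  - intros b Hb.
    assert (D : forall x, Cder (fun s => (- / z * Cexp (0 + RtoC s * (- z)))%C) x (lap_fun (fun _ => 1) z x)).
    { intros x. replace (lap_fun (fun _ => 1) z x) with (- / z * (- z * Cexp (0 + RtoC x * (- z))))%C.
      - apply Cder_scal, Cder_Cexp, Cder_line.
      - unfold lap_fun. replace (0 + x * - z)%C with (- (z * x))%C by ring. field. auto. }
    assert (Co : forall x, Ccont (lap_fun (fun _ => 1) z) x)
      by (intros; apply lap_fun_cont, continuous_const).
    replace (/ z - / z * Cexp (0 + b * - z))%C
      with ((fun s => (- / z * Cexp (0 + RtoC s * (- z)))%C) b - (fun s => (- / z * Cexp (0 + RtoC s * (- z)))%C) 0)%C.
    + set (g := fun s => (- / z * Cexp (0 + RtoC s * (- z)))%C) in *.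
      apply (is_RInt_fct_extend_pair (U := R_NormedModule) (V := R_NormedModule)).
      * exact (is_RInt_derive (V := R_CompleteNormedModule) (fun s => Re (g s)) (fun s => Re (lap_fun (fun _ => 1) z s)) 0 b
          (fun x _ => proj1 (D x)) (fun x _ => proj1 (Co x))).
      * exact (is_RInt_derive (V := R_CompleteNormedModule) (fun s => Im (g s)) (fun s => Im (lap_fun (fun _ => 1) z s)) 0 b
          (fun x _ => proj2 (D x)) (fun x _ => proj2 (Co x))).
    + cbv beta. replace (0 + 0 * - z)%C with (RtoC 0) by ring. rewrite Cexp_0. ring.
  - intros eps He.
    assert (Pz : 0 < Cmod z) by (apply Cmod_gt_0; auto).
    destruct (exp_decay (Re z) (eps * Cmod z) Hz) as [B [HB0 HB]]; [nra|].
    exists B. intros b Hb.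
    replace (/ z - / z * Cexp (0 + b * - z) - / z)%C with (- (Cexp (0 + b * - z) / z))%C by (field; auto).
    rewrite Cmod_opp, Cmod_div, Cmod_Cexp by auto.
    apply Rmult_lt_reg_r with (Cmod z); auto.
    unfold Rdiv. rewrite Rmult_assoc, Rinv_l, Rmult_1_r by lra.
    replace (Re (0 + RtoC b * - z)%C) with (- Re z * b); [apply HB; auto|].
    rewrite Re_plus, Re_mult, Re_opp, !Re_RtoC, Im_RtoC. ring.
Qed.

Lemma Cder_unique (f : R -> C) (t : R) (a b : C) : Cder f t a -> Cder f t b -> a = b.
Proof.
  intros [H1 H2] [H3 H4].
  apply is_derive_unique in H1. apply is_derive_unique in H2.
  apply is_derive_unique in H3. apply is_derive_unique in H4.
  apply C_ext; congruence.
Qed.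

Lemma Cder_ext_pos (f g : R -> C) (A l : C) (t : R) :
  (forall s, 0 < Re (A + RtoC s * 1)%C -> f s = g s) -> 0 < Re (A + RtoC t * 1)%C ->
  Cder f t l -> Cder g t l.
Proof.
  intros E P [H1 H2].
  assert (L : locally t (fun s => f s = g s)).
  { assert (Hp : 0 < Re A + t) by (rewrite Re_plus, Re_mult in P; simpl in P; lra).
    exists (mkposreal _ Hp). intros s Hs. apply E.
    rewrite Re_plus, Re_mult; simpl. unfold ball in Hs; simpl in Hs.
    unfold AbsRing_ball, abs, minus, plus, opp in Hs; simpl in Hs.
    apply Rabs_lt_between in Hs. unfold Re in *; simpl in *; lra. }
  split; [eapply is_derive_ext_loc; [|apply H1]|eapply is_derive_ext_loc; [|apply H2]];
  revert L; apply filter_imp; intros s Hs; simpl; rewrite Hs; reflexivity.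
Qed.

(** The derivative of a transform is known in two ways, under the integral and from the closed form
    [H]; their equality yields the transforms of x and x^2 from that of 1 without integration by
    parts. *)
Lemma Lap_mult_x (h : R -> R) (H H' : C -> C) :
  tame h -> (forall z, 0 < Re z -> Lap h z = H z) ->
  (forall z t, 0 < Re (z + RtoC t * 1)%C ->
     Cder (fun s => H (z + RtoC s * 1)%C) t (H' (z + RtoC t * 1)%C)) ->
  forall z, 0 < Re z -> Lap (fun x => x * h x) z = (- H' z)%C.
Proof.
  intros Hh E D z Hz.
  assert (Ez : z = (z + RtoC 0 * 1)%C) by ring.
  assert (Hz' : 0 < Re (z + RtoC 0 * 1)%C) by (rewrite <- Ez; auto).
  assert (D1 := Cder_Lap h z 0 Hh Hz').
  assert (D2 := D z 0 Hz').
  apply (Cder_ext_pos _ (fun s => H (z + RtoC s * 1)%C) z) in D1; auto.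
  assert (U := Cder_unique _ _ _ _ D1 D2). rewrite <- Ez in U.
  rewrite <- U. ring.
Qed.

Lemma Lap_x (z : C) : 0 < Re z -> Lap (fun x => x) z = (/ z ^ 2)%C.
Proof.
  intros Hz.
  rewrite (Lap_ext (fun x => x * 1) (fun x => x)); auto; [| intros; ring| apply tame_mult; [apply tame_id|apply tame_const]].
  rewrite (Lap_mult_x (fun _ => 1) (fun z => / z)%C (fun z => - (1 / (z * z)))%C); auto.
  - field. apply Re_pos_neq_0; auto.
  - apply tame_const.
  - apply Lap_1.
  - intros w t Hw. apply Cder_inv; [apply Cder_line|apply Re_pos_neq_0; auto].
Qed.

Lemma Lap_x2 (z : C) : 0 < Re z -> Lap (fun x => x ^ 2) z = (2 / z ^ 3)%C.
Proof.
  intros Hz.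
  rewrite (Lap_ext (fun x => x * x) (fun x => x ^ 2)); auto; [| intros; ring| apply tame_mult; apply tame_id].
  rewrite (Lap_mult_x (fun x => x) (fun z => / z ^ 2)%C (fun z => - (2 * z / (z ^ 2 * z ^ 2)))%C); auto.
  - field. apply Re_pos_neq_0; auto.
  - apply tame_id.
  - apply Lap_x.
  - intros w t Hw. apply Cder_inv.
    + apply Cder_ext with (fun s => ((w + RtoC s * 1) * (w + RtoC s * 1))%C); [intros; ring|].
      replace (2 * (w + t * 1))%C with (1 * (w + t * 1) + (w + t * 1) * 1)%C by ring.
      apply Cder_mult; apply Cder_line.
    + apply Cpow_nz, Re_pos_neq_0; auto.
Qed.

(** * The function f_3 near 0 *)

(** The Taylor coefficients of (1 - exp (- x)) / x. With this everywhere positive entire function, f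
    is [/ (tau * phi x * phi (tau * x))], which has no singularity at 0 and shows its limit and its
    first two derivatives there. *)
Definition phi_coef (n : nat) : R := (-1) ^ n / INR (fact (S n)).
Definition phi : R -> R := PSeries phi_coef.
Definition phi' : R -> R := PSeries (PS_derive phi_coef).

Lemma phi_coef_neq_0 (n : nat) : phi_coef n <> 0.
Proof.
  unfold phi_coef. apply Rmult_integral_contrapositive. split.
  - apply pow_nonzero. lra.
  - apply Rinv_neq_0_compat, INR_fact_neq_0.
Qed.

Lemma CV_radius_phi : CV_radius phi_coef = p_infty.
Proof.
  apply CV_radius_infinite_DAlembert; [apply phi_coef_neq_0|].
  apply is_lim_seq_ext with (fun n => / INR (S (S n))).
  - intros n. unfold phi_coef.
    replace ((-1) ^ S n / INR (fact (S (S n))) / ((-1) ^ n / INR (fact (S n)))) with (- / INR (S (S n))).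
    + rewrite Rabs_Ropp, Rabs_right; auto. apply Rle_ge; left. apply Rinv_0_lt_compat, lt_0_INR; lia.
    + rewrite (fact_simpl (S n)), mult_INR. simpl pow. field.
      repeat split; try apply INR_fact_neq_0; try apply pow_nonzero; try lra. apply not_0_INR; lia.
  - apply is_lim_seq_ext with (fun n => / INR (n + 2)); [intros n; do 2 f_equal; lia|].
    apply (is_lim_seq_incr_n (fun n => / INR n) 2).
    apply (is_lim_seq_inv _ p_infty); [apply is_lim_seq_INR|discriminate].
Qed.

Lemma Rabs_lt_CV_phi (x : R) : Rbar_lt (Rabs x) (CV_radius phi_coef).
Proof. rewrite CV_radius_phi. exact I. Qed.

Lemma phi_spec (x : R) : x * phi x = 1 - exp (- x).
Proof.
  set (e := fun n => (-1) ^ n / INR (fact n)).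
  assert (H : is_pseries e x (exp (- x))).
  { assert (H := is_exp_Reals (- x)). unfold is_pseries in *.
    apply is_series_ext with (2 := H). intros n. unfold e.
    unfold scal; simpl. rewrite !pow_n_pow. unfold mult; simpl.
    replace (- x) with ((-1) * x) by ring. rewrite Rpow_mult_distr.
    apply eq_trans with (x ^ n * ((-1) ^ n / INR (fact n))); [unfold Rdiv; ring|].
    apply f_equal2; [symmetry; apply pow_n_pow | reflexivity]. }
  assert (E : PSeries e x = exp (- x)) by (apply is_pseries_unique; auto).
  rewrite PSeries_decr_1 in E by (eexists; eauto).
  unfold e at 1 in E. simpl in E.
  assert (E2 : PSeries (PS_decr_1 e) x = - phi x).
  { unfold phi. rewrite <- PSeries_opp. apply PSeries_ext. intros n.
    unfold PS_decr_1, PS_opp, e, phi_coef. simpl pow. unfold opp; simpl. field.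
    apply (INR_fact_neq_0 (S n)). }
  rewrite E2 in E. rewrite <- E. field.
Qed.

Lemma phi_0 : phi 0 = 1.
Proof. unfold phi. rewrite PSeries_0. unfold phi_coef; simpl. field. Qed.

Lemma phi_pos (x : R) : 0 < phi x.
Proof.
  assert (H := phi_spec x).
  destruct (Rtotal_order x 0) as [L|[E|L]].
  - assert (1 < exp (- x)) by (rewrite <- exp_0; apply exp_increasing; lra). nra.
  - rewrite E, phi_0. lra.
  - assert (exp (- x) < 1) by (rewrite <- exp_0; apply exp_increasing; lra). nra.
Qed.

Lemma is_derive_phi (x : R) : is_derive phi x (phi' x).
Proof. apply is_derive_PSeries, Rabs_lt_CV_phi. Qed.

Lemma phi'_0 : phi' 0 = - / 2.
Proof. unfold phi'. rewrite PSeries_0. unfold PS_derive, phi_coef; simpl. field. Qed.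

Lemma is_derive_phi'_0 : is_derive phi' 0 (/ 3).
Proof.
  evar_last.
  - apply is_derive_PSeries. rewrite CV_radius_derive. apply Rabs_lt_CV_phi.
  - rewrite PSeries_0. unfold PS_derive, phi_coef; simpl. field.
Qed.

(** The third-order remainder of [phi] divided by x^3, kept as a power series so that it is
    continuous at 0. *)
Definition rho : R -> R := PSeries (fun n => phi_coef (n + 3)).

Lemma phi_rho (x : R) : phi x = 1 - x / 2 + x ^ 2 / 6 + x ^ 3 * rho x.
Proof.
  assert (N : forall a, CV_radius a = p_infty -> ex_pseries a x).
  { intros a Ha. apply CV_disk_correct, CV_disk_inside. rewrite Ha. exact I. }
  assert (R0 := CV_radius_phi).
  assert (R1 : CV_radius (PS_decr_1 phi_coef) = p_infty) by (rewrite CV_radius_decr_1; auto).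
  assert (R2 : CV_radius (PS_decr_1 (PS_decr_1 phi_coef)) = p_infty) by (rewrite CV_radius_decr_1; auto).
  unfold phi. rewrite PSeries_decr_1, (PSeries_decr_1 (PS_decr_1 phi_coef)),
    (PSeries_decr_1 (PS_decr_1 (PS_decr_1 phi_coef))) by auto.
  replace (PSeries (PS_decr_1 (PS_decr_1 (PS_decr_1 phi_coef))) x) with (rho x).
  - unfold PS_decr_1 , phi_coef; simpl. field.
  - apply PSeries_ext. intros n. unfold PS_decr_1. f_equal. lia.
Qed.

Lemma rho_cont (x : R) : continuous rho x.
Proof.
  assert (E : CV_radius (fun n => phi_coef (n + 3)) = p_infty).
  { rewrite <- CV_radius_phi, <- (CV_radius_decr_1 phi_coef), <- (CV_radius_decr_1 (PS_decr_1 phi_coef)),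
      <- (CV_radius_decr_1 (PS_decr_1 (PS_decr_1 phi_coef))).
    apply CV_radius_ext. intros n. unfold PS_decr_1. f_equal. lia. }
  apply @ex_derive_continuous. eexists. apply is_derive_PSeries. rewrite E. exact I.
Qed.

Lemma barnes_f_formula_phi (tau x : R) : 0 < tau -> x <> 0 ->
  barnes_f_formula tau x = / (tau * phi x * phi (tau * x)).
Proof.
  intros Ht Hx. unfold barnes_f_formula.
  rewrite <- phi_spec. replace (- tau * x) with (- (tau * x)) by ring. rewrite <- phi_spec.
  assert (P1 := phi_pos x). assert (P2 := phi_pos (tau * x)).
  field. repeat split; lra.
Qed.

Lemma is_derive_phi_tau (tau x : R) : is_derive (fun x => phi (tau * x)) x (tau * phi' (tau * x)).
Proof.
  evar_last.
  - apply (is_derive_comp phi (fun x => tau * x)); [apply is_derive_phi|].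
    apply (is_derive_scal (fun x => x) x tau 1). apply @is_derive_id.
  - unfold scal; simpl; unfold mult; simpl. ring.
Qed.

Lemma is_derive_inv_mult (c x a b : R) (p q : R -> R) : 0 < c -> 0 < p x -> 0 < q x ->
  is_derive p x a -> is_derive q x b ->
  is_derive (fun x => / (c * p x * q x)) x (- (a * q x + p x * b) / (c * (p x * q x) ^ 2)).
Proof.
  intros Hc P1 P2 D1 D2. derive_tac.
  - apply Rgt_not_eq. repeat apply Rmult_lt_0_compat; auto.
  - field. repeat split; lra.
Qed.

Lemma is_derive_f (tau x : R) : 0 < tau ->
  is_derive (fun x => / (tau * phi x * phi (tau * x))) x
    (- (phi' x * phi (tau * x) + phi x * (tau * phi' (tau * x))) / (tau * (phi x * phi (tau * x)) ^ 2)).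
Proof.
  intros Ht.
  exact (is_derive_inv_mult tau x _ _ phi (fun x => phi (tau * x)) Ht (phi_pos x) (phi_pos _)
    (is_derive_phi x) (is_derive_phi_tau tau x)).
Qed.

Lemma is_derive2_inv_mult (c : R) (p q p' q' : R -> R) (a b : R) : 0 < c -> p 0 = 1 -> q 0 = 1 ->
  is_derive p 0 (p' 0) -> is_derive q 0 (c * q' 0) ->
  is_derive p' 0 a -> is_derive q' 0 b ->
  is_derive (fun x => - (p' x * q x + p x * (c * q' x)) / (c * (p x * q x) ^ 2)) 0
    ((- (a + 2 * c * p' 0 * q' 0 + c * b) + 2 * (p' 0 + c * q' 0) ^ 2) / c).
Proof.
  intros Hc V1 V2 D1 D2 D3 D4.
  apply is_derive_unique in D1 as E1. apply is_derive_unique in D2 as E2.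
  derive_tac.
  - rewrite V1, V2. lra.
  - rewrite E1, E2, V1, V2. field. lra.
Qed.

Lemma barnes_f_phi (tau x : R) : 0 < tau -> barnes_f tau x = / (tau * phi x * phi (tau * x)).
Proof.
  intros Ht. unfold barnes_f. destruct (Req_EM_T x 0) as [E|E].
  - rewrite E.
    assert (L : is_lim (barnes_f_formula tau) 0 (/ (tau * phi 0 * phi (tau * 0)))).
    { apply is_lim_ext_loc with (fun x => / (tau * phi x * phi (tau * x))).
      - exists (mkposreal 1 Rlt_0_1). intros y _ Hy. rewrite barnes_f_formula_phi; auto.
      - apply (is_lim_continuity (fun x => / (tau * phi x * phi (tau * x))) 0).
        apply continuity_pt_filterlim.
        apply (ex_derive_continuous (fun x => / (tau * phi x * phi (tau * x))) 0).
        eexists. apply is_derive_f; auto. }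
    rewrite (is_lim_unique _ _ _ L). reflexivity.
  - apply barnes_f_formula_phi; auto.
Qed.

Lemma barnes_f_0 (tau : R) : 0 < tau -> barnes_f tau 0 = / tau.
Proof.
  intros Ht. rewrite barnes_f_phi by auto. rewrite Rmult_0_r, phi_0. f_equal. ring.
Qed.

Lemma is_derive_barnes_f (tau x : R) : 0 < tau ->
  is_derive (barnes_f tau) x
   (- (phi' x * phi (tau * x) + phi x * (tau * phi' (tau * x))) / (tau * (phi x * phi (tau * x)) ^ 2)).
Proof.
  intros Ht. eapply is_derive_ext; [|apply is_derive_f; auto].
  intros y; simpl. rewrite barnes_f_phi; auto.
Qed.

Lemma Derive_barnes_f_0 (tau : R) : 0 < tau -> Derive (barnes_f tau) 0 = (1 + tau) / (2 * tau).
Proof.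
  intros Ht. apply is_derive_unique. eapply is_derive_value; [apply is_derive_barnes_f; auto|].
  rewrite Rmult_0_r, phi_0, phi'_0. field. lra.
Qed.

Lemma Derive2_barnes_f_0 (tau : R) : 0 < tau ->
  1 / 2 * Derive_n (barnes_f tau) 2 0 = (1 + 3 * tau + tau ^ 2) / (12 * tau).
Proof.
  intros Ht.
  assert (D : is_derive (Derive (barnes_f tau)) 0 ((1 + 3 * tau + tau ^ 2) / (6 * tau))).
  { apply is_derive_ext with (fun x =>
      - (phi' x * phi (tau * x) + phi x * (tau * phi' (tau * x))) / (tau * (phi x * phi (tau * x)) ^ 2)).
    { intros y. symmetry. apply is_derive_unique, is_derive_barnes_f; auto. }
    assert (D2 := is_derive_phi_tau tau 0).
    assert (D3 := is_derive_phi'_0).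
    assert (D4 : is_derive (fun x => phi' (tau * x)) 0 (tau * / 3)).
    { evar_last.
      - apply (is_derive_comp phi' (fun x => tau * x)); [rewrite Rmult_0_r; apply is_derive_phi'_0|].
        apply (is_derive_scal (fun x => x) 0 tau 1). apply @is_derive_id.
      - unfold scal; simpl; unfold mult; simpl. ring. }
    eapply is_derive_value.
    - apply (is_derive2_inv_mult tau phi (fun x => phi (tau * x)) phi' (fun x => phi' (tau * x)) (/ 3) (tau * / 3) Ht phi_0);
        [rewrite Rmult_0_r; apply phi_0 | apply is_derive_phi | exact D2 | exact D3 | exact D4].
    - rewrite Rmult_0_r, phi'_0. field. lra. }
  change (Derive_n (barnes_f tau) 2 0) with (Derive (Derive (barnes_f tau)) 0).
  rewrite (is_derive_unique _ _ _ D). field. lra.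
Qed.

Definition taylor2 (tau x : R) : R :=
  / tau + (1 + tau) / (2 * tau) * x + (1 + 3 * tau + tau ^ 2) / (12 * tau) * x ^ 2.

Lemma barnes_f3_eq (tau x : R) : 0 < tau ->
  barnes_f3 tau x = (barnes_f tau x - taylor2 tau x) / x ^ 3.
Proof.
  intros Ht. unfold barnes_f3, taylor2.
  rewrite barnes_f_0, Derive_barnes_f_0, Derive2_barnes_f_0 by auto. f_equal. ring.
Qed.

(* Continuous extension of [barnes_f3] to [x = 0], where the division by [x ^ 3] gives a junk value. *)
Definition f3ext (tau x : R) : R :=
  let t u := 1 - u / 2 + u ^ 2 / 6 in
  let a := (1 + tau) / 2 in let b := (1 + 3 * tau + tau ^ 2) / 12 in
  let c2 := / 6 + tau ^ 2 / 6 + tau / 4 in let c3 := - (tau * (1 + tau) / 12) in let c4 := tau ^ 2 / 36 in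
  (- (c3 + a * c2 - a * b) - (c4 + a * c3 + b * c2) * x - (a * c4 + b * c3) * x ^ 2 - b * c4 * x ^ 3
   - taylor2 tau x * tau * (rho x * t (tau * x) + t x * (tau ^ 3 * rho (tau * x))
        + x ^ 3 * tau ^ 3 * rho x * rho (tau * x)))
  / (tau * phi x * phi (tau * x)).

(** The numerator of [f3ext] is (1 - taylor2 * tau * phi(x) * phi(tau x)) / x^3, multiplied out.
    With t the quadratic truncation of [phi], the coefficients of t(x) t(tau x) are 1, -a, c2, c3,
    c4, and those of tau * [taylor2] are 1, a, b. Their product has no term in x or x^2, since c2 -
    a^2 + b = 0, so division by x^3 leaves a polynomial and the terms with [rho]. *)
Lemma f3ext_spec (tau x : R) : 0 < tau -> x ^ 3 * f3ext tau x = barnes_f tau x - taylor2 tau x.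
Proof.
  intros Ht. rewrite barnes_f_phi by auto.
  assert (P1 := phi_pos x). assert (P2 := phi_pos (tau * x)).
  assert (E1 := phi_rho x). assert (E2 := phi_rho (tau * x)).
  unfold f3ext, taylor2.
  set (p := phi x) in *. set (q := phi (tau * x)) in *.
  set (r := rho x) in *. set (s := rho (tau * x)) in *. clearbody p q r s.
  apply Rmult_eq_reg_r with (tau * p * q).
  2: { apply Rgt_not_eq. repeat apply Rmult_lt_0_compat; auto. }
  match goal with |- x ^ 3 * (?n / ?d) * ?d = _ =>
    replace (x ^ 3 * (n / d) * d) with (x ^ 3 * n) by (field; lra) end.
  match goal with |- _ = (/ ?d - ?T) * ?d =>
    replace ((/ d - T) * d) with (1 - T * d) by (field; lra) end.
  rewrite E1, E2. field. lra.
Qed.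

Lemma f3ext_barnes_f3 (tau x : R) : 0 < tau -> 0 < x -> barnes_f3 tau x = f3ext tau x.
Proof.
  intros Ht Hx. rewrite barnes_f3_eq, <- f3ext_spec by auto. field. lra.
Qed.

Lemma continuous_f3ext (tau x : R) : 0 < tau -> continuous (f3ext tau) x.
Proof.
  intros Ht.
  assert (C1 := rho_cont x).
  assert (C2 : continuous (fun x => rho (tau * x)) x).
  { apply (continuous_comp (fun x => tau * x) rho); [|apply rho_cont].
    apply (ex_derive_continuous (fun x => tau * x)). auto_derive. auto. }
  assert (P1 := phi_pos x). assert (P2 := phi_pos (tau * x)).
  assert (C3 : continuous (fun x => / (tau * phi x * phi (tau * x))) x).
  { apply (ex_derive_continuous (fun x => / (tau * phi x * phi (tau * x)))).
    eexists; apply is_derive_f; auto. }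
  assert (Cp : forall p : R -> R, ex_derive p x -> continuous p x)
    by (intros p; apply (ex_derive_continuous p)).
  unfold f3ext. apply (continuous_mult _ (fun x => / (tau * phi x * phi (tau * x)))); auto.
  apply @continuous_minus.
  - apply Cp. auto_derive. auto.
  - apply (continuous_mult (fun x => taylor2 tau x * tau)).
    + apply Cp. unfold taylor2. auto_derive. auto.
    + apply @continuous_plus; [apply @continuous_plus|].
      * apply (continuous_mult rho); auto. apply Cp. auto_derive. auto.
      * apply (continuous_mult (fun x => 1 - x / 2 + x ^ 2 / 6)).
        -- apply Cp. auto_derive. auto.
        -- apply (continuous_mult (fun _ => tau ^ 3)); auto. apply continuous_const.
      * apply (continuous_mult (fun x => x ^ 3 * tau ^ 3 * rho x)); auto.
        apply (continuous_mult (fun x => x ^ 3 * tau ^ 3)); auto.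
        apply Cp. auto_derive. auto.
Qed.

Lemma one_minus_exp_ge (s x : R) : 0 < s -> 1 <= x -> 0 < 1 - exp (- s) <= 1 - exp (- s * x).
Proof.
  intros Hs Hx. split.
  - assert (exp (- s) < 1) by (rewrite <- exp_0; apply exp_increasing; lra). lra.
  - assert (exp (- s * x) <= exp (- s)) by (apply exp_le; nra). lra.
Qed.

(** Continuity settles [0, 1]. Beyond 1 both f and its Taylor polynomial are O(x^2), so the quotient
    by x^3 stays bounded. Boundedness, rather than tameness alone, makes the transform O(1 / Re
    z). *)
Lemma f3ext_bounded (tau : R) : 0 < tau ->
  exists K, 0 <= K /\ forall x, 0 <= x -> Rabs (f3ext tau x) <= K.
Proof.
  intros Ht.
  destruct (continuity_ab_maj (fun x => Rabs (f3ext tau x)) 0 1) as [m [Hm _]]; [lra| |].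
  { intros c _. apply continuity_pt_filterlim.
    apply (continuous_comp (f3ext tau) Rabs); [apply continuous_f3ext; auto|apply continuous_Rabs]. }
  set (A := / ((1 - exp (- (1))) * (1 - exp (- tau)))).
  set (T := / tau + (1 + tau) / (2 * tau) + (1 + 3 * tau + tau ^ 2) / (12 * tau)).
  assert (HA : 0 < A).
  { apply Rinv_0_lt_compat, Rmult_lt_0_compat; apply (one_minus_exp_ge _ 1); lra. }
  assert (p0 : 0 < / tau) by (apply Rinv_0_lt_compat; auto).
  assert (p1 : 0 < (1 + tau) / (2 * tau)) by (apply Rdiv_lt_0_compat; lra).
  assert (p2 : 0 < (1 + 3 * tau + tau ^ 2) / (12 * tau)) by (apply Rdiv_lt_0_compat; nra).
  assert (M0 : 0 <= Rabs (f3ext tau m)) by apply Rabs_pos.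
  exists (Rabs (f3ext tau m) + A + T). split; [unfold T; lra|].
  intros x Hx. destruct (Rle_dec x 1) as [L|L].
  - specialize (Hm x (conj Hx L)). unfold T. lra.
  - assert (Hx1 : 1 <= x) by lra.
    assert (E := f3ext_spec tau x Ht).
    assert (X3 : 1 <= x ^ 3) by (apply pow_R1_Rle; auto).
    assert (X2 : 1 <= x ^ 2) by (apply pow_R1_Rle; auto).
    assert (F : 0 <= barnes_f tau x <= A * x ^ 2).
    { unfold barnes_f. destruct (Req_EM_T x 0); [lra|]. unfold barnes_f_formula.
      destruct (one_minus_exp_ge 1 x) as [q1 q2]; try lra.
      destruct (one_minus_exp_ge tau x) as [q3 q4]; try lra.
      replace (- (1) * x) with (- x) in * by ring.
      assert (q5 : 0 < (1 - exp (- x)) * (1 - exp (- tau * x))) by (apply Rmult_lt_0_compat; lra).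
      split; [apply Rdiv_le_0_compat; lra|].
      unfold Rdiv. rewrite Rmult_comm. apply Rmult_le_compat_r; [lra|].
      apply Rinv_le_contravar; [apply Rmult_lt_0_compat; lra|].
      apply Rmult_le_compat; lra. }
    assert (G : 0 <= taylor2 tau x <= T * x ^ 2).
    { unfold taylor2, T. assert (x <= x ^ 2) by nra. split; nra. }
    assert (H : x ^ 3 * Rabs (f3ext tau x) <= (A + T) * x ^ 2).
    { rewrite <- (Rabs_right (x ^ 3)) at 1 by lra. rewrite <- Rabs_mult, E.
      apply Rabs_le. nra. }
    assert (X23 : x ^ 2 <= x ^ 3) by (simpl; nra).
    assert (H2 : (A + T) * x ^ 2 <= (A + T) * x ^ 3) by (apply Rmult_le_compat_l; unfold T; lra).
    assert (H3 : Rabs (f3ext tau x) <= A + T).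
    { apply Rmult_le_reg_l with (x ^ 3); lra. }
    lra.
Qed.

Lemma tame_f3ext (tau : R) : 0 < tau -> tame (f3ext tau).
Proof.
  intros Ht. split; [intros; apply continuous_f3ext; auto|].
  intros eps He. destruct (f3ext_bounded tau Ht) as [K [HK B]]. exists K. split; auto.
  intros x Hx. eapply Rle_trans; [apply B; auto|].
  assert (T := exp_ineq1_le (eps * x)). assert (0 <= eps * x) by nra.
  rewrite <- (Rmult_1_r K) at 1. apply Rmult_le_compat_l; lra.
Qed.

(** * The double difference of F *)

(** Differentiation in the right half-plane, in the real direction only. This suffices to recover a
    function along a horizontal ray from its third derivative. *)
Definition hder (f g : C -> C) : Prop :=
  forall (A : C) (t : R), 0 < Re (A + RtoC t * 1)%C ->
    Cder (fun s => f (A + RtoC s * 1)%C) t (g (A + RtoC t * 1)%C).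

Lemma Cder_value (f : R -> C) (t : R) (a b : C) : Cder f t a -> a = b -> Cder f t b.
Proof. intros H E; rewrite <- E; exact H. Qed.

Lemma hder_value (f g h : C -> C) : hder f g -> (forall z, 0 < Re z -> g z = h z) -> hder f h.
Proof. intros H E A t Ht. rewrite <- E by auto. apply H; auto. Qed.

Lemma hder_const (c : C) : hder (fun _ => c) (fun _ => RtoC 0).
Proof. intros A t _. apply Cder_const. Qed.

Lemma hder_id : hder (fun z => z) (fun _ => RtoC 1).
Proof. intros A t _. apply Cder_line. Qed.

Lemma hder_plus (f g f' g' : C -> C) :
  hder f f' -> hder g g' -> hder (fun z => f z + g z)%C (fun z => f' z + g' z)%C.
Proof. intros H1 H2 A t Ht. apply Cder_plus; [apply H1|apply H2]; auto. Qed.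

Lemma hder_minus (f g f' g' : C -> C) :
  hder f f' -> hder g g' -> hder (fun z => f z - g z)%C (fun z => f' z - g' z)%C.
Proof. intros H1 H2 A t Ht. apply Cder_minus; [apply H1|apply H2]; auto. Qed.

Lemma hder_mult (f g f' g' : C -> C) :
  hder f f' -> hder g g' -> hder (fun z => f z * g z)%C (fun z => f' z * g z + f z * g' z)%C.
Proof.
  intros H1 H2 A t Ht.
  apply (Cder_mult (fun s => f (A + RtoC s * 1)%C) (fun s => g (A + RtoC s * 1)%C)); auto.
Qed.

Lemma hder_inv : hder (fun z => / z)%C (fun z => - (/ (z * z)))%C.
Proof.
  intros A t Ht. eapply Cder_value; [apply Cder_inv; [apply Cder_line|apply Re_pos_neq_0; auto]|].
  unfold Cdiv. ring.
Qed.

Lemma hder_opp_inv_sq : hder (fun z => - (/ (z * z)))%C (fun z => 2 / z ^ 3)%C.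
Proof.
  intros A t HA. assert (NA := Re_pos_neq_0 _ HA).
  eapply Cder_value.
  - apply Cder_opp, Cder_inv; [apply Cder_mult; apply Cder_line|]. apply Cmult_neq_0; auto.
  - cbv beta. set (z := (A + RtoC t * 1)%C) in *. field. auto.
Qed.

Lemma hder_Cln : hder Cln (fun z => / z)%C.
Proof.
  intros A t Ht. eapply Cder_value; [apply Cder_Cln; [apply Cder_line|auto]|].
  unfold Cdiv. ring.
Qed.

Lemma hder_Lap (h : R -> R) : tame h -> hder (Lap h) (fun z => - Lap (fun x => (x * h x)%R) z)%C.
Proof. intros Hh A t Ht. apply Cder_Lap; auto. Qed.

Lemma hder_shift (f f' : C -> C) (s : R) : 0 <= s ->
  hder f f' -> hder (fun z => f (z + RtoC s)%C) (fun z => f' (z + RtoC s)%C).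
Proof.
  intros Hs H A t Ht.
  replace (A + RtoC t * 1 + RtoC s)%C with ((A + RtoC s) + RtoC t * 1)%C by ring.
  apply Cder_ext with (fun u => f ((A + RtoC s) + RtoC u * 1)%C); [intros; f_equal; ring|].
  apply H. rewrite Re_plus, Re_mult in *. rewrite Re_plus. simpl in *. lra.
Qed.

Lemma hder_zero_const (f : C -> C) (A : C) (t : R) :
  hder f (fun _ => RtoC 0) -> 0 < Re A -> 0 <= t -> f (A + RtoC t)%C = f A.
Proof.
  intros H HA Ht.
  assert (E := Cder_zero_const (fun s => f (A + RtoC s * 1)%C) 0 t Ht).
  cbv beta in E.
  replace (A + RtoC 0 * 1)%C with A in E by ring.
  replace (A + RtoC t * 1)%C with (A + RtoC t)%C in E by ring.
  apply E. intros s Hs. apply H. rewrite Re_plus, Re_mult. simpl. lra.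
Qed.

Lemma hder3_zero (f f1 f2 : C -> C) (A : C) (t : R) :
  hder f f1 -> hder f1 f2 -> hder f2 (fun _ => RtoC 0) -> 0 < Re A -> 0 <= t ->
  f (A + RtoC t)%C = (f A + RtoC t * f1 A + RtoC (t ^ 2 / 2) * f2 A)%C.
Proof.
  intros H0 H1 H2 HA Ht.
  assert (P : forall s, 0 <= s -> 0 < Re (A + RtoC s * 1)%C).
  { intros s Hs. rewrite Re_plus, Re_mult. simpl. lra. }
  assert (E2 : forall s, 0 <= s -> f2 (A + RtoC s * 1)%C = f2 A).
  { intros s Hs. rewrite Cmult_1_r. apply hder_zero_const; auto. }
  assert (E1 : forall s, 0 <= s -> f1 (A + RtoC s * 1)%C = (f1 A + RtoC s * f2 A)%C).
  { intros s Hs.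
    assert (E := Cder_zero_const (fun u => f1 (A + RtoC u * 1) - (0 + RtoC u * f2 A))%C 0 s Hs).
    cbv beta in E. replace (A + RtoC 0 * 1)%C with A in E by ring.
    replace (f1 (A + RtoC s * 1)%C) with (f1 (A + RtoC s * 1) - (0 + RtoC s * f2 A) + RtoC s * f2 A)%C by ring.
    rewrite E; [ring|]. intros u Hu. eapply Cder_value.
    - apply Cder_minus; [apply H1, P; lra|apply Cder_line].
    - rewrite E2 by lra. ring. }
  assert (E := Cder_zero_const (fun u => f (A + RtoC u * 1) -
      ((0 + RtoC u * f1 A) + RtoC (u ^ 2 / 2) * f2 A))%C 0 t Ht).
  cbv beta in E. replace (A + RtoC 0 * 1)%C with A in E by ring.
  replace (f (A + RtoC t)%C) with (f (A + RtoC t * 1) - (0 + RtoC t * f1 A + RtoC (t ^ 2 / 2) * f2 A)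
     + (RtoC t * f1 A + RtoC (t ^ 2 / 2) * f2 A))%C by (rewrite Cmult_1_r; ring).
  rewrite E.
  - replace (0 ^ 2 / 2) with 0 by field. ring.
  - intros u Hu. eapply Cder_value.
    + apply Cder_minus; [apply H0, P; lra|]. apply Cder_plus; [apply Cder_line|].
      apply (Cder_mult (fun u => RtoC (u ^ 2 / 2)) (fun _ => f2 A)); [|apply Cder_const].
      apply Cder_RtoC with (l := u). auto_derive; auto. field.
    + rewrite E1 by lra. ring.
Qed.

(** A polynomial in n with a limit is constant: second differences isolate [c], first differences
    then isolate [b]. *)
Lemma quadratic_limit (a b c l : C) :
  Clim (fun n => a + RtoC (INR n) * b + RtoC (INR n ^ 2 / 2) * c)%C l -> a = l.
Proof.
  intros H.
  set (u := fun n => (a + RtoC (INR n) * b + RtoC (INR n ^ 2 / 2) * c)%C) in H.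
  assert (H1 : Clim (fun n => u (S n)) l).
  { destruct H as [P Q]; split; [apply (is_lim_seq_incr_1 (fun n => Re (u n)))|apply (is_lim_seq_incr_1 (fun n => Im (u n)))]; auto. }
  assert (H2 : Clim (fun n => u (S (S n))) l).
  { destruct H1 as [P Q]; split; [apply (is_lim_seq_incr_1 (fun n => Re (u (S n))))|apply (is_lim_seq_incr_1 (fun n => Im (u (S n))))]; auto. }
  assert (Ec : c = RtoC 0).
  { apply (Clim_unique (fun _ => c)); [apply Clim_const|].
    replace (RtoC 0) with (l - l - (l - l))%C by ring.
    apply Clim_ext with (fun n => u (S (S n)) - u (S n) - (u (S n) - u n))%C.
    - intros n. unfold u. rewrite !S_INR. unfold Rdiv.
      rewrite ?RtoC_mult, ?RtoC_pow, ?RtoC_plus, RtoC_inv by lra. field.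
    - apply Clim_minus; apply Clim_minus; auto. }
  assert (Eb : b = RtoC 0).
  { apply (Clim_unique (fun _ => b)); [apply Clim_const|].
    replace (RtoC 0) with (l - l)%C by ring.
    apply Clim_ext with (fun n => u (S n) - u n)%C.
    - intros n. unfold u. rewrite !S_INR, Ec, RtoC_plus. ring.
    - apply Clim_minus; auto. }
  apply (Clim_unique (fun _ => a)); [apply Clim_const|].
  apply Clim_ext with (2 := H). intros n. unfold u. rewrite Eb, Ec. ring.
Qed.

Lemma RtoC_2_neq_0 : RtoC 2 <> 0%C.
Proof. intros E; apply (f_equal Re) in E; simpl in E; lra. Qed.

(** An error of third order is what the degree of P requires: multiplied by P(A + B), which is
    O(|A|^2), it still tends to 0. The factor 2 comes from |A + s B| >= |A| / 2. *)
Lemma Cln_expand (A B : C) : 0 < Re A -> 0 < Re (A + B)%C -> 2 * Cmod B <= Cmod A ->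
  Cmod (Cln (A + B) - (Cln A + B / A - B ^ 2 / (2 * A ^ 2))) <= 2 * (Cmod B ^ 3 / Cmod A ^ 3).
Proof.
  intros HA HAB HB.
  assert (NA := Re_pos_neq_0 A HA). assert (PA : 0 < Cmod A) by (apply Cmod_gt_0; auto).
  assert (N2 := RtoC_2_neq_0).
  assert (P : forall s, 0 <= s <= 1 -> 0 < Re (A + RtoC s * B)%C).
  { intros s Hs. rewrite Re_plus, Re_mult, Re_RtoC, Im_RtoC. rewrite Re_plus in HAB.
    destruct (Rle_dec 0 (Re B)); nra. }
  set (f := fun s => (Cln (A + RtoC s * B) - (0 + RtoC s * (B / A)) + RtoC (s ^ 2) * (B ^ 2 / (2 * A ^ 2)))%C).
  set (f' := fun s => (B / (A + RtoC s * B) - B / A + RtoC (2 * s) * (B ^ 2 / (2 * A ^ 2)))%C).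
  set (k := 2 * (Cmod B ^ 3 / Cmod A ^ 3)).
  assert (H := Cder_le f f' (fun s => k * s) (fun _ => k) 0 1).
  replace (f 1 - f 0)%C with (Cln (A + B) - (Cln A + B / A - B ^ 2 / (2 * A ^ 2)))%C in H.
  2: { unfold f. replace (A + RtoC 1 * B)%C with (A + B)%C by ring.
       replace (A + RtoC 0 * B)%C with A by ring.
       replace (1 ^ 2) with 1 by ring. replace (0 ^ 2) with 0 by ring. ring. }
  eapply Rle_trans; [apply H|lra]; clear H.
  - lra.
  - intros t Ht. unfold f, f'. apply Cder_plus.
    + apply Cder_minus; [|apply Cder_line]. apply Cder_Cln; [apply Cder_line|apply P; auto].
    + eapply Cder_value.
      * apply (Cder_mult (fun u => RtoC (u ^ 2)) (fun _ => (B ^ 2 / (2 * A ^ 2))%C)); [|apply Cder_const].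
        apply Cder_RtoC with (l := 2 * t). auto_derive; auto. ring.
      * ring.
  - intros t Ht. auto_derive; auto. ring.
  - intros s Hs.
    assert (NS := Re_pos_neq_0 _ (P s Hs)).
    (* The quadratic approximation of the logarithm makes the derivative of the remainder collapse
       to a single fraction. *)
    replace (f' s) with (RtoC (s ^ 2) * B ^ 3 / (A ^ 2 * (A + RtoC s * B)))%C.
    2: { unfold f'. rewrite RtoC_mult, RtoC_pow. field. auto. }
    rewrite Cmod_div by (apply Cmult_neq_0; [apply Cpow_nz|]; auto).
    rewrite !Cmod_mult, !Cmod_pow, Cmod_R, Rabs_right by (assert (T := pow2_ge_0 s); lra).
    assert (L : Cmod A / 2 <= Cmod (A + RtoC s * B)%C).
    { assert (T := Cmod_triangle_inv A (- (RtoC s * B))%C).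
      rewrite Cmod_opp, Cmod_mult, Cmod_R, Rabs_right in T by lra.
      replace (A - - (RtoC s * B))%C with (A + RtoC s * B)%C in T by ring.
      assert (T2 := Cmod_ge_0 B). nra. }
    unfold k, Rdiv.
    assert (B3 : 0 <= Cmod B ^ 3) by (apply pow_le, Cmod_ge_0).
    assert (A2 : 0 < Cmod A ^ 2) by (apply pow_lt; auto).
    assert (A3 : 0 < Cmod A ^ 3) by (apply pow_lt; auto).
    replace (2 * (Cmod B ^ 3 * / Cmod A ^ 3)) with (1 * Cmod B ^ 3 * / (Cmod A ^ 2 * (Cmod A / 2))) by (field; lra).
    apply Rmult_le_compat.
    + apply Rmult_le_pos; auto. apply pow2_ge_0.
    + left. apply Rinv_0_lt_compat. apply Rmult_lt_0_compat; lra.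
    + apply Rmult_le_compat_r; auto. nra.
    + apply Rinv_le_contravar; [apply Rmult_lt_0_compat; lra|]. apply Rmult_le_compat_l; lra.
Qed.

Definition Sf (tau : R) (z : C) : C := (barnes_P tau z * Cln z + barnes_Q tau 0 z)%C.

Definition Sf_expand (tau : R) (A B : C) : C :=
  (barnes_P tau (A + B) * (Cln A + B / A - B ^ 2 / (2 * A ^ 2)) + barnes_Q tau 0 (A + B))%C.

Lemma Clim_inv_Cmod (A : nat -> C) :
  (forall n, 0 < Re (A n)) -> Clim (fun n => / A n)%C 0%C ->
  forall M, exists N, forall n, (N <= n)%nat -> M <= Cmod (A n).
Proof.
  intros HA H M. apply Clim_Cmod in H.
  destruct (H (fun y => y < / (Rabs M + 1))) as [N HN].
  { apply (open_lt (/ (Rabs M + 1))). apply Rinv_0_lt_compat. assert (T := Rabs_pos M). lra. }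
  exists N. intros n Hn. specialize (HN n Hn). cbv beta in HN.
  assert (NA := Re_pos_neq_0 _ (HA n)). assert (PA : 0 < Cmod (A n)) by (apply Cmod_gt_0; auto).
  replace (/ A n - 0)%C with (/ A n)%C in HN by ring. rewrite Cmod_inv in HN by auto.
  assert (T := Rabs_pos M).
  apply Rinv_lt_cancel in HN; [|auto].
  assert (T2 := Rle_abs M). lra.
Qed.

Lemma Sf_asymptotic (tau : R) (A : nat -> C) (B : C) :
  (forall n, 0 < Re (A n)) -> (forall n, 0 < Re (A n + B)%C) -> Clim (fun n => / A n)%C 0%C ->
  Clim (fun n => Sf tau (A n + B) - Sf_expand tau (A n) B)%C 0%C.
Proof.
  intros HA HB HL.
  destruct (Clim_inv_Cmod A HA HL (2 * Cmod B)) as [N HN].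
  set (r := fun n => (/ A n)%C) in *.
  set (a2 := RtoC (/ (2 * tau))). set (a1 := RtoC ((1 + tau) / (2 * tau))).
  set (a0 := RtoC ((1 + 3 * tau + tau ^ 2) / (12 * tau))).
  assert (NA : forall n, A n <> 0%C) by (intros n; apply Re_pos_neq_0, HA).
  assert (L1 : Clim (fun n => barnes_P tau (A n + B) * (r n * r n * r n))%C 0%C).
  { unfold barnes_P.
    apply Clim_ext with (fun n => (r n * (1 + B * r n) * (1 + B * r n)) / RtoC (2 * tau)
       - a1 * (r n * r n * (1 + B * r n)) + a0 * (r n * r n * r n))%C.
    { intros n. unfold r, Cdiv. fold a1 a0.
      replace (1 + B * / A n)%C with ((A n + B) * / A n)%C by (field; auto).
      replace (/ A n * / A n * ((A n + B) * / A n))%C with ((A n + B) * (/ A n * / A n * / A n))%C by ring.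
      replace (/ A n * ((A n + B) * / A n) * ((A n + B) * / A n))%C with ((A n + B) * (A n + B) * (/ A n * / A n * / A n))%C by ring.
      ring. }
    assert (L1 : Clim (fun n => 1 + B * r n)%C (1 + B * 0)%C)
      by (apply Clim_plus; [apply Clim_const|apply Clim_mult; [apply Clim_const|auto]]).
    replace (RtoC 0) with ((0 * (1 + B * 0) * (1 + B * 0)) / RtoC (2 * tau)
       - a1 * (0 * 0 * (1 + B * 0)) + a0 * (0 * 0 * 0))%C by (unfold Cdiv; ring).
    apply Clim_plus; [apply Clim_minus|].
    - apply Clim_mult; [|apply Clim_const]. apply Clim_mult; [apply Clim_mult|]; assumption.
    - apply Clim_mult; [apply Clim_const|]. apply Clim_mult; [apply Clim_mult|]; assumption.
    - apply Clim_mult; [apply Clim_const|]. apply Clim_mult; [apply Clim_mult|]; assumption. }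
  apply Clim_Cmod in L1.
  apply Clim_le_0 with (N := N) (v := fun n => Cmod (barnes_P tau (A n + B) * (r n * r n * r n) - 0) * (2 * Cmod B ^ 3)).
  - intros n Hn.
    assert (PA : 0 < Cmod (A n)) by (apply Cmod_gt_0; auto).
    assert (E := Cln_expand (A n) B (HA n) (HB n) (HN n Hn)).
    replace (Sf tau (A n + B) - Sf_expand tau (A n) B - 0)%C
      with (barnes_P tau (A n + B) * (Cln (A n + B) - (Cln (A n) + B / A n - B ^ 2 / (2 * A n ^ 2))))%C
      by (unfold Sf, Sf_expand; ring).
    replace (barnes_P tau (A n + B) * (r n * r n * r n) - 0)%C
      with (barnes_P tau (A n + B) * (r n * r n * r n))%C by ring.
    rewrite !Cmod_mult, Rmult_assoc. apply Rmult_le_compat_l; [apply Cmod_ge_0|].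
    eapply Rle_trans; [apply E|]. unfold r. rewrite Cmod_inv by auto. right. field. lra.
  - assert (K := is_lim_seq_mult' _ _ _ _ L1 (is_lim_seq_const (2 * Cmod B ^ 3))).
    rewrite Rmult_0_l in K. exact K.
Qed.

Section DoubleDifference.
Variable tau : R.
Hypothesis Ht : 0 < tau.

Definition Ff (tau : R) (z : C) : C := (Sf tau z - Lap (f3ext tau) z)%C.

Let xf := fun x => x * f3ext tau x.
Let xxf := fun x => x * xf x.
Let xxxf := fun x => x * xxf x.
Let a2 := RtoC (/ (2 * tau)).
Let a1 := RtoC (- ((1 + tau) / (2 * tau))).
Let a0 := RtoC ((1 + 3 * tau + tau ^ 2) / (12 * tau)).
Let q2 := RtoC (- ((3 / 2 + ln tau) / (2 * tau))).
Let q1 := RtoC (ln (2 * PI * tau) / 2 + (1 + tau + ln tau) / (2 * tau)).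

Lemma barnes_P_eq (z : C) : barnes_P tau z = (a2 * (z * z) + a1 * z + a0)%C.
Proof.
  unfold barnes_P, a2, a1, a0. rewrite RtoC_opp, RtoC_inv by lra. unfold Cdiv. ring.
Qed.

Lemma barnes_Q_eq (z : C) : barnes_Q tau 0 z = (q2 * (z * z) + q1 * z)%C.
Proof. unfold barnes_Q, q2, q1. rewrite RtoC_opp. ring. Qed.

Let F1 (z : C) : C := ((a2 * (z + z) + a1) * Cln z + (a2 * (z * z) + a1 * z + a0) * / z
   + (q2 * (z + z) + q1) + Lap xf z)%C.
Let F2 (z : C) : C := ((a2 * 2) * Cln z + 2 * ((a2 * (z + z) + a1) * / z)
   - (a2 * (z * z) + a1 * z + a0) * (/ z * / z) + q2 * 2 - Lap xxf z)%C.
Let F3 (z : C) : C := Lap (barnes_f tau) z.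

Let tf := tame_f3ext tau Ht.
Let txf : tame xf := tame_mult _ _ tame_id tf.
Let txxf : tame xxf := tame_mult _ _ tame_id txf.
Let txxxf : tame xxxf := tame_mult _ _ tame_id txxf.

Lemma hder_Ff : hder (Ff tau) F1.
Proof.
  assert (D : hder (fun z => (a2 * (z * z) + a1 * z + a0) * Cln z + (q2 * (z * z) + q1 * z) - Lap (f3ext tau) z)%C F1).
  { eapply hder_value.
    - apply hder_minus; [apply hder_plus|apply hder_Lap, tf].
      + apply hder_mult; [|apply hder_Cln].
        apply hder_plus; [|apply hder_const]. apply hder_plus.
        * apply hder_mult; [apply hder_const|apply hder_mult; apply hder_id].
        * apply hder_mult; [apply hder_const|apply hder_id].
      + apply hder_plus.
        * apply hder_mult; [apply hder_const|apply hder_mult; apply hder_id].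
        * apply hder_mult; [apply hder_const|apply hder_id].
    - intros z Hz. unfold F1, xf. ring. }
  intros A t HA. apply Cder_ext with (2 := D A t HA).
  intros s. unfold Ff, Sf. rewrite barnes_P_eq, barnes_Q_eq. reflexivity.
Qed.

Lemma hder_F1 : hder F1 F2.
Proof.
  eapply hder_value.
  - unfold F1. apply hder_plus; [apply hder_plus; [apply hder_plus|]|apply hder_Lap, txf].
    + apply hder_mult; [|apply hder_Cln].
      apply hder_plus; [|apply hder_const]. apply hder_mult; [apply hder_const|apply hder_plus; apply hder_id].
    + apply hder_mult; [|apply hder_inv].
      apply hder_plus; [|apply hder_const]. apply hder_plus.
      * apply hder_mult; [apply hder_const|apply hder_mult; apply hder_id].
      * apply hder_mult; [apply hder_const|apply hder_id].
    + apply hder_plus; [|apply hder_const].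
      apply hder_mult; [apply hder_const|apply hder_plus; apply hder_id].
  - intros z Hz. unfold F2, xxf, xf. field. apply Re_pos_neq_0; auto.
Qed.

Lemma Lap_taylor2 (z : C) : 0 < Re z ->
  Lap (taylor2 tau) z = (RtoC (/ tau) / z + RtoC ((1 + tau) / (2 * tau)) / z ^ 2 + 2 * a0 / z ^ 3)%C.
Proof.
  intros Hz. assert (Nz := Re_pos_neq_0 z Hz).
  assert (t1 := tame_const 1). assert (tx := tame_id).
  assert (tx2 := tame_x2).
  assert (S1 := tame_mult _ _ (tame_const (/ tau)) t1).
  assert (S2 := tame_mult _ _ (tame_const ((1 + tau) / (2 * tau))) tx).
  assert (S3 := tame_mult _ _ (tame_const ((1 + 3 * tau + tau ^ 2) / (12 * tau))) tx2).
  rewrite (Lap_ext (fun x => (/ tau * 1 + (1 + tau) / (2 * tau) * x)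
     + (1 + 3 * tau + tau ^ 2) / (12 * tau) * x ^ 2) (taylor2 tau)); auto.
  - rewrite (Lap_plus (fun x => (/ tau * 1 + (1 + tau) / (2 * tau) * x))
       (fun x => (1 + 3 * tau + tau ^ 2) / (12 * tau) * x ^ 2)); auto; [|apply tame_plus; auto].
    rewrite (Lap_plus (fun x => / tau * 1) (fun x => (1 + tau) / (2 * tau) * x)); auto.
    rewrite (Lap_scal _ (fun _ => 1)), (Lap_scal _ (fun x => x)), (Lap_scal _ (fun x => x ^ 2)) by auto.
    rewrite Lap_1, Lap_x, Lap_x2 by auto. fold a0. unfold Cdiv. ring.
  - intros x Hx. unfold taylor2. ring.
  - apply tame_plus; auto. apply tame_plus; auto.
Qed.

Lemma tame_taylor2 : tame (taylor2 tau).
Proof.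
  apply tame_ext with (fun x => (/ tau + (1 + tau) / (2 * tau) * x)
    + (1 + 3 * tau + tau ^ 2) / (12 * tau) * (x * x)).
  - intros x. unfold taylor2. simpl. ring.
  - apply tame_plus; [apply tame_plus|]; [apply tame_const| |];
      (apply tame_mult; [apply tame_const|]); [apply tame_id|apply tame_mult; apply tame_id].
Qed.

Lemma barnes_f_split (x : R) : barnes_f tau x = xxxf x + taylor2 tau x.
Proof.
  assert (E := f3ext_spec tau x Ht). unfold xxxf, xxf, xf.
  replace (x * (x * (x * f3ext tau x))) with (x ^ 3 * f3ext tau x) by ring. lra.
Qed.

Lemma tame_barnes_f : tame (barnes_f tau).
Proof.
  apply tame_ext with (2 := tame_plus xxxf (taylor2 tau) txxxf tame_taylor2).
  intros x. symmetry. apply barnes_f_split.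
Qed.

(** After three derivatives P ln z leaves 2 a2 / z - a1 / z^2 + 2 a0 / z^3, which is the transform
    of [taylor2], while the transform of f_3 has become that of x^3 f_3 = f - [taylor2]. The
    coefficients of P are the ones that make these add up to the transform of f. *)
Lemma hder_F2 : hder F2 F3.
Proof.
  eapply hder_value.
  - unfold F2. apply hder_minus; [apply hder_plus; [apply hder_minus; [apply hder_plus|]|]|apply hder_Lap, txxf].
    + apply hder_mult; [apply hder_const|apply hder_Cln].
    + apply hder_mult; [apply hder_const|]. apply hder_mult; [|apply hder_inv].
      apply hder_plus; [|apply hder_const]. apply hder_mult; [apply hder_const|apply hder_plus; apply hder_id].
    + apply hder_mult; [|apply hder_mult; apply hder_inv].
      apply hder_plus; [|apply hder_const]. apply hder_plus.
      * apply hder_mult; [apply hder_const|apply hder_mult; apply hder_id].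
      * apply hder_mult; [apply hder_const|apply hder_id].
    + apply hder_const.
  - intros z Hz. unfold F3.
    rewrite (Lap_ext (fun x => xxxf x + taylor2 tau x) (barnes_f tau)); auto.
    2: { intros x _. symmetry. apply barnes_f_split. }
    2: { exact (tame_plus _ _ txxxf tame_taylor2). }
    rewrite (Lap_plus xxxf (taylor2 tau) z txxxf tame_taylor2 Hz).
    rewrite Lap_taylor2 by auto. unfold xxxf.
    replace (RtoC ((1 + tau) / (2 * tau))) with (- a1)%C by (unfold a1; rewrite RtoC_opp; ring).
    replace (RtoC (/ tau)) with (2 * a2)%C.
    + field. apply Re_pos_neq_0; auto.
    + unfold a2. rewrite <- RtoC_mult. f_equal. field. lra.
Qed.

Lemma Lap_f_double_difference (z : C) : 0 < Re z ->
  (F3 (z + RtoC (1 + tau)) - F3 (z + RtoC 1) - F3 (z + RtoC tau) + F3 z = 2 / z ^ 3)%C.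
Proof.
  intros Hz. unfold F3.
  assert (P : forall s, 0 <= s -> 0 < Re (z + RtoC s)%C) by (intros; rewrite Re_plus; simpl; lra).
  assert (T := tame_barnes_f).
  rewrite <- Lap_x2 by auto.
  apply (CInt_unique (fun x => lap_fun (barnes_f tau) (z + RtoC (1 + tau)) x
    - lap_fun (barnes_f tau) (z + RtoC 1) x - lap_fun (barnes_f tau) (z + RtoC tau) x
    + lap_fun (barnes_f tau) z x)%C).
  - apply CInt_plus; [apply CInt_minus; [apply CInt_minus|]|]; apply CInt_lap; auto; apply P; lra.
  - apply CInt_ext with (lap_fun (fun x => x ^ 2) z).
    + intros x Hx. unfold lap_fun.
      replace (- ((z + RtoC (1 + tau)) * RtoC x))%C with (- (z * RtoC x) + RtoC (- x) + RtoC (- tau * x))%C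
        by (rewrite RtoC_plus, RtoC_mult, !RtoC_opp; ring).
      replace (- ((z + RtoC 1) * RtoC x))%C with (- (z * RtoC x) + RtoC (- x))%C by (rewrite RtoC_opp; ring).
      replace (- ((z + RtoC tau) * RtoC x))%C with (- (z * RtoC x) + RtoC (- tau * x))%C
        by (rewrite RtoC_mult, RtoC_opp; ring).
      rewrite !Cexp_plus, !Cexp_RtoC.
      replace (x ^ 2) with ((1 - exp (- x)) * (1 - exp (- tau * x)) * barnes_f tau x).
      * rewrite !RtoC_mult, !RtoC_minus. ring.
      * unfold barnes_f. destruct (Req_EM_T x 0); [lra|]. unfold barnes_f_formula.
        assert (exp (- x) < 1) by (rewrite <- exp_0; apply exp_increasing; lra).
        assert (exp (- tau * x) < 1) by (rewrite <- exp_0; apply exp_increasing; nra).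
        field. lra.
    + apply CInt_lap; auto. apply tame_x2.
Qed.

Let DD (f : C -> C) (z : C) : C :=
  (f (z + RtoC (1 + tau)) - f (z + RtoC 1) - f (z + RtoC tau) + f z)%C.

Lemma hder_DD (f f' : C -> C) : hder f f' -> hder (DD f) (DD f').
Proof.
  intros H. unfold DD.
  apply hder_plus; auto. apply hder_minus; [apply hder_minus|]; apply hder_shift; auto; lra.
Qed.

Lemma Lap_f3_lim (A : nat -> C) : (forall n, 0 < Re (A n)) -> is_lim_seq (fun n => Re (A n)) p_infty ->
  Clim (fun n => Lap (f3ext tau) (A n)) 0%C.
Proof.
  intros HA HL. destruct (f3ext_bounded tau Ht) as [K [HK HB]].
  apply Clim_le_0 with (N := 0%nat) (v := fun n => K * / Re (A n)).
  - intros n _. replace (Lap (f3ext tau) (A n) - 0)%C with (Lap (f3ext tau) (A n)) by ring.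
    destruct (CInt_lap_bounded (f3ext tau) (A n) K 0) as [_ H].
    + intros; apply continuous_f3ext; auto.
    + auto.
    + intros x Hx. rewrite Rmult_0_l, exp_0, Rmult_1_r. auto.
    + rewrite Rminus_0_r in H. exact H.
  - replace (Finite 0) with (Rbar_mult K 0) by (simpl; f_equal; ring).
    apply is_lim_seq_scal_l. apply (is_lim_seq_inv _ p_infty); [auto|discriminate].
Qed.

Lemma Clim_inv_shift (z : C) : 0 < Re z -> Clim (fun n => / (z + RtoC (INR n)))%C 0%C.
Proof.
  intros Hz.
  assert (P : forall n, 0 < Re (z + RtoC (INR n))%C).
  { intros n. rewrite Re_plus, Re_RtoC. assert (T := pos_INR n). lra. }
  apply Clim_le_0 with (N := 1%nat) (v := fun n => / INR n).
  - intros n Hn. replace (/ (z + RtoC (INR n)) - 0)%C with (/ (z + RtoC (INR n)))%C by ring.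
    rewrite Cmod_inv by (apply Re_pos_neq_0, P).
    apply Rinv_le_contravar; [apply lt_0_INR; lia|].
    eapply Rle_trans; [|apply re_le_Cmod]. rewrite Rabs_right by (apply Rle_ge; left; apply P).
    rewrite Re_plus, Re_RtoC. lra.
  - apply (is_lim_seq_inv _ p_infty); [apply is_lim_seq_INR|discriminate].
Qed.

(* The third derivative vanishes because [x ^ 2 = (1 - exp (- x)) (1 - exp (- tau x)) f x]; the
   remaining quadratic polynomial is determined by its limit at infinity. *)
Lemma Ff_double_difference (z : C) : 0 < Re z ->
  (Ff tau (z + RtoC (1 + tau)) - Ff tau (z + RtoC 1) - Ff tau (z + RtoC tau) + Ff tau z
   = Cln z - RtoC (ln tau))%C.
Proof.
  intros Hz.
  set (f0 := fun z => (DD (Ff tau) z - Cln z)%C).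
  set (f1 := fun z => (DD F1 z - / z)%C).
  set (f2 := fun z => (DD F2 z - (- (/ (z * z))))%C).
  assert (H0 : hder f0 f1) by (apply hder_minus; [apply hder_DD, hder_Ff|apply hder_Cln]).
  assert (H1 : hder f1 f2) by (apply hder_minus; [apply hder_DD, hder_F1|apply hder_inv]).
  assert (H2 : hder f2 (fun _ => RtoC 0)).
  { eapply hder_value.
    - apply hder_minus; [apply hder_DD, hder_F2|apply hder_opp_inv_sq].
    - intros w Hw. unfold DD. rewrite Lap_f_double_difference by auto. field. apply Re_pos_neq_0; auto. }
  assert (E : f0 z = RtoC (- ln tau)).
  { apply (quadratic_limit _ (f1 z) (f2 z)).
    set (A := fun n => (z + RtoC (INR n))%C).
    apply Clim_ext with (fun n => f0 (A n)).
    { intros n. apply hder3_zero; auto. apply pos_INR. }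
    assert (PA : forall s, 0 <= s -> forall n, 0 < Re (A n + RtoC s)%C).
    { intros s Hs n. unfold A. rewrite !Re_plus, !Re_RtoC. assert (T := pos_INR n). lra. }
    assert (PA0 : forall n, 0 < Re (A n)).
    { intros n. unfold A. rewrite !Re_plus, !Re_RtoC. assert (T := pos_INR n). lra. }
    assert (LA : Clim (fun n => / A n)%C 0%C) by (apply Clim_inv_shift; auto).
    assert (LL : forall s, 0 <= s -> Clim (fun n => Lap (f3ext tau) (A n + RtoC s)) 0%C).
    { intros s Hs. apply Lap_f3_lim; [apply PA; auto|].
      apply is_lim_seq_le_p_loc with INR; [|apply is_lim_seq_INR].
      exists 0%nat; intros n _. unfold A. rewrite !Re_plus, !Re_RtoC. lra. }
    assert (LS : forall s, 0 <= s -> Clim (fun n => Sf tau (A n + RtoC s) - Sf_expand tau (A n) (RtoC s))%C 0%C).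
    { intros s Hs. apply Sf_asymptotic; auto. }
    assert (LF : forall s, 0 <= s -> Clim (fun n => Ff tau (A n + RtoC s) - Sf_expand tau (A n) (RtoC s))%C 0%C).
    { intros s Hs. replace (RtoC 0) with (0 - 0)%C by ring.
      apply Clim_ext with (2 := Clim_minus _ _ _ _ (LS s Hs) (LL s Hs)).
      intros n. unfold Ff. ring. }
    set (T := RtoC tau).
    set (d := (T * a0 + a1 * ((1 + T) ^ 3 - 1 - T ^ 3) / 2 + a2 * ((1 + T) ^ 4 - 1 - T ^ 4) / 2)%C).
    set (X := fun n => (Sf_expand tau (A n) (RtoC (1 + tau)) - Sf_expand tau (A n) (RtoC 1)
        - Sf_expand tau (A n) T + Sf_expand tau (A n) (RtoC 0) - Cln (A n))%C).
    assert (LX : Clim X (RtoC (- ln tau))).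
    { assert (Ea : (2 * T * a2 = 1)%C).
      { unfold T, a2. rewrite <- !RtoC_mult. f_equal. field. lra. }
      (* This accounts for the leading coefficient of Q: its 3/2 cancels the constant that the
         expansion of P ln z leaves behind, and - ln tau remains. *)
      assert (Eq : (3 * T * a2 + 2 * T * q2 = RtoC (- ln tau))%C).
      { unfold T, a2, q2. rewrite <- !RtoC_mult, <- RtoC_plus. f_equal. field. lra. }
      apply Clim_ext with (fun n => RtoC (- ln tau) + T * a1 * / A n - d * (/ A n * / A n))%C.
      - intros n. unfold X, Sf_expand. rewrite !barnes_P_eq, !barnes_Q_eq, RtoC_plus. fold T.
        assert (NA := Re_pos_neq_0 _ (PA0 n)).
        rewrite <- Eq.
        (* The coefficient of ln A in the double difference is 2 T a2 = 1. The fifth occurrence is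
           the [Cln (A n)] that is subtracted from it. *)
        replace (Cln (A n)) with ((2 * T * a2) * Cln (A n))%C at 5 by (rewrite Ea; ring).
        unfold d. field. auto.
      - replace (RtoC (- ln tau)) with (RtoC (- ln tau) + T * a1 * 0 - d * (0 * 0))%C at 1 by ring.
        apply Clim_minus; [apply Clim_plus; [apply Clim_const|]|];
          (apply Clim_mult; [apply Clim_const|]); [assumption|]. apply Clim_mult; assumption. }
    assert (E0 := LF 0 (Rle_refl 0)).
    assert (Es := Clim_plus _ _ _ _ (Clim_plus _ _ _ _ (Clim_minus _ _ _ _ (Clim_minus _ _ _ _
      (LF (1 + tau) ltac:(lra)) (LF 1 ltac:(lra))) (LF tau ltac:(lra))) E0) LX).
    replace (0 - 0 - 0 + 0 + RtoC (- ln tau))%C with (RtoC (- ln tau)) in Es by ring.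
    apply Clim_ext with (2 := Es).
    intros n. unfold f0, DD, X. fold T.
    replace (A n + RtoC 0)%C with (A n) by ring. ring. }
  unfold f0, DD in E. replace (Cln z - RtoC (ln tau))%C with (Cln z + RtoC (- ln tau))%C by (rewrite RtoC_opp; ring).
  rewrite <- E. ring.
Qed.
End DoubleDifference.

(** * Complex power series *)

(** The sum over indices below [n], whereas [sum_n] includes index [n]; hence the appeals to
    [Clim_incr_1]. *)
Fixpoint psum (a : nat -> C) (w : C) (n : nat) : C :=
  match n with
  | O => 0%C
  | S n => (psum a w n + a n * w ^ n)%C
  end.

Lemma C_pow_n (w : C) (n : nat) : @pow_n C_AbsRing w n = (w ^ n)%C.
Proof. induction n as [|n IH]; simpl; [reflexivity|]. rewrite IH. reflexivity. Qed.

Lemma Clim_incr_1 (u : nat -> C) (l : C) : Clim (fun n => u (S n)) l <-> Clim u l.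
Proof.
  split; intros [H1 H2]; split.
  - apply (is_lim_seq_incr_1 (fun n => Re (u n))); auto.
  - apply (is_lim_seq_incr_1 (fun n => Im (u n))); auto.
  - apply (is_lim_seq_incr_1 (fun n => Re (u n))) in H1; auto.
  - apply (is_lim_seq_incr_1 (fun n => Im (u n))) in H2; auto.
Qed.

Lemma Clim_filterlim (u : nat -> C) (l : C) :
  filterlim u eventually (@locally C_UniformSpace l) -> Clim u l.
Proof.
  intros H. split.
  - intros P [e He]. apply (H (fun y => P (Re y))). exists e. intros y Hy. apply He, Hy.
  - intros P [e He]. apply (H (fun y => P (Im y))). exists e. intros y Hy. apply He, Hy.
Qed.

Lemma is_pseries_Clim (a : nat -> C) (w l : C) :
  @is_pseries C_AbsRing C_NormedModule a w l -> Clim (psum a w) l.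
Proof.
  intros H. apply Clim_incr_1.
  apply Clim_ext with (fun n => @sum_n C_AbelianMonoid (fun k => scal (@pow_n C_AbsRing w k) (a k)) n).
  - intros n. induction n as [|n IH].
    + rewrite sum_O. rewrite C_pow_n. simpl. unfold scal; simpl. unfold mult; simpl. ring.
    + rewrite sum_Sn, IH, C_pow_n. simpl psum. unfold scal; simpl. unfold mult, plus; simpl. ring.
  - apply Clim_filterlim. exact H.
Qed.

Lemma is_series_Clim (u : nat -> C) (l : C) :
  @is_series C_AbsRing C_NormedModule u l -> Clim (psum u 1) l.
Proof.
  intros H. apply Clim_incr_1.
  apply Clim_ext with (fun n => @sum_n C_AbelianMonoid u n).
  - intros n. induction n as [|n IH].
    + rewrite sum_O. simpl. ring.
    + rewrite sum_Sn, IH. simpl psum. rewrite Cpow_1_l. unfold plus; simpl. ring.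
  - apply Clim_filterlim. exact H.
Qed.

Lemma Clim_bounded (u : nat -> C) (l : C) : Clim u l -> exists M, 0 < M /\ forall n, Cmod (u n) <= M.
Proof.
  intros H. apply Clim_Cmod in H.
  destruct (maj_by_pos (fun n => Cmod (u n - l))) as [M [HM B]].
  { exists 0. apply is_lim_seq_Reals. exact H. }
  exists (M + Cmod l). split; [assert (T := Cmod_ge_0 l); lra|].
  intros n. replace (u n) with (u n - l + l)%C by ring.
  eapply Rle_trans; [apply Cmod_triangle|]. specialize (B n).
  rewrite Rabs_right in B by apply Rle_ge, Cmod_ge_0. lra.
Qed.

Lemma psum_terms_bounded (a : nat -> C) (w l : C) :
  Clim (psum a w) l -> exists M, 0 < M /\ forall n, Cmod (a n) * Cmod w ^ n <= M.
Proof.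
  intros H. destruct (Clim_bounded (fun n => a n * w ^ n)%C 0%C) as [M [HM B]].
  - replace (RtoC 0) with (l - l)%C by ring.
    apply Clim_ext with (fun n => psum a w (S n) - psum a w n)%C; [intros; simpl; ring|].
    apply Clim_minus; [apply (Clim_incr_1 (psum a w))|]; auto.
  - exists M. split; auto. intros n. specialize (B n). rewrite Cmod_mult, Cmod_pow in B. auto.
Qed.

Lemma psum_diff_le (a : nat -> C) (w : C) (M rr th : R) (n m : nat) :
  0 <= th < 1 -> 0 <= rr -> Cmod w <= th * rr ->
  (forall n, Cmod (a n) * rr ^ n <= M) -> (n <= m)%nat ->
  Cmod (psum a w m - psum a w n) <= M * th ^ n / (1 - th).
Proof.
  intros Hth Hr Hw Ha Hnm.
  assert (HM : 0 <= M) by (eapply Rle_trans; [|apply (Ha 0%nat)]; simpl; assert (T := Cmod_ge_0 (a 0%nat)); lra).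
  assert (K : Cmod (psum a w m - psum a w n) <= M * (th ^ n - th ^ m) / (1 - th)).
  { induction Hnm as [|m Hnm IH].
    - replace (psum a w n - psum a w n)%C with (RtoC 0) by ring. rewrite Cmod_0.
      right. field. lra.
    - simpl psum. replace (psum a w m + a m * w ^ m - psum a w n)%C
        with ((psum a w m - psum a w n) + a m * w ^ m)%C by ring.
      eapply Rle_trans; [apply Cmod_triangle|].
      rewrite Cmod_mult, Cmod_pow.
      assert (T : Cmod (a m) * Cmod w ^ m <= M * th ^ m).
      { apply Rle_trans with (Cmod (a m) * (th * rr) ^ m).
        - apply Rmult_le_compat_l; [apply Cmod_ge_0|]. apply pow_incr. split; [apply Cmod_ge_0|auto].
        - rewrite Rpow_mult_distr.
          replace (Cmod (a m) * (th ^ m * rr ^ m)) with ((Cmod (a m) * rr ^ m) * th ^ m) by ring.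
          apply Rmult_le_compat_r; [apply pow_le; lra|apply Ha]. }
      replace (M * (th ^ n - th ^ S m) / (1 - th)) with (M * (th ^ n - th ^ m) / (1 - th) + M * th ^ m) by (simpl; field; lra).
      lra. }
  eapply Rle_trans; [apply K|]. unfold Rdiv. apply Rmult_le_compat_r; [left; apply Rinv_0_lt_compat; lra|].
  apply Rmult_le_compat_l; auto. assert (0 <= th ^ m) by (apply pow_le; lra). lra.
Qed.

Lemma Clim_Cmod_le (u : nat -> C) (l c : C) (K : R) (N : nat) :
  Clim u l -> (forall n, (N <= n)%nat -> Cmod (u n - c) <= K) -> Cmod (l - c) <= K.
Proof.
  intros H B. apply Clim_Cmod in H.
  assert (R : Rbar_le (Cmod (l - c)) (0 + K)).
  { apply (is_lim_seq_le_loc (fun _ => Cmod (l - c)) (fun n => Cmod (u n - l) + K)).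
    - exists N. intros n Hn. specialize (B n Hn).
      replace (l - c)%C with ((l - u n) + (u n - c))%C by ring.
      eapply Rle_trans; [apply Cmod_triangle|]. rewrite (Cmod_minus_sym l). lra.
    - apply is_lim_seq_const.
    - apply is_lim_seq_plus'; [exact H|apply is_lim_seq_const]. }
  simpl in R. lra.
Qed.

Lemma psum_tail_le (a : nat -> C) (w l : C) (M rr th : R) (n : nat) :
  0 <= th < 1 -> 0 <= rr -> Cmod w <= th * rr ->
  (forall n, Cmod (a n) * rr ^ n <= M) -> Clim (psum a w) l ->
  Cmod (l - psum a w n) <= M * th ^ n / (1 - th).
Proof.
  intros Hth Hr Hw Ha Hl.
  apply (Clim_Cmod_le (psum a w) l _ _ n Hl). intros m Hm.
  apply psum_diff_le with rr; auto.
Qed.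

Definition has_ps (f : C -> C) (c : C) (r : R) (a : nat -> C) : Prop :=
  forall w, Cmod w < r -> Clim (psum a w) (f (c + w)%C).

Lemma analytic_has_ps (f : C -> C) (c : C) : analytic_at f c ->
  exists a r, 0 < r /\ has_ps f c r a.
Proof.
  intros [a [r [Hr H]]]. exists a, r. split; auto.
  intros w Hw. apply is_pseries_Clim.
  assert (E := H (c + w)%C). replace (c + w - c)%C with w in E by ring. auto.
Qed.

Lemma has_ps_bounded (f : C -> C) (c : C) (r rr : R) (a : nat -> C) :
  has_ps f c r a -> 0 <= rr < r -> exists M, 0 < M /\ forall n, Cmod (a n) * rr ^ n <= M.
Proof.
  intros H Hr. destruct (psum_terms_bounded a (RtoC rr) (f (c + RtoC rr)%C)) as [M [HM B]].
  - apply H. rewrite Cmod_R, Rabs_right; lra.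
  - exists M. split; auto. rewrite Cmod_R, Rabs_right in B by lra. auto.
Qed.

Lemma has_ps_0 (f : C -> C) (c : C) (r : R) (a : nat -> C) : 0 < r -> has_ps f c r a -> f c = a 0%nat.
Proof.
  intros Hr H. apply (Clim_unique (psum a 0)).
  - replace (f c) with (f (c + 0)%C) by (f_equal; ring). apply H. rewrite Cmod_0. auto.
  - apply Clim_incr_1. apply Clim_ext with (fun _ => a 0%nat); [|apply Clim_const].
    intros n. induction n as [|n IH]; simpl; [ring|]. simpl in IH. rewrite <- IH. ring.
Qed.

Lemma has_ps_taylor1 (f : C -> C) (c : C) (r : R) (a : nat -> C) : 0 < r -> has_ps f c r a ->
  exists d K, 0 < d /\ 0 <= K /\ forall w, Cmod w < d ->
    Cmod (f (c + w)%C - f c - a 1%nat * w) <= K * Cmod w ^ 2.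
Proof.
  intros Hr H. destruct (has_ps_bounded f c r (r / 2) a H) as [M [HM B]]; [lra|].
  exists (r / 4), (M * (2 / r) ^ 2 * 2). split; [lra|]. split.
  { apply Rmult_le_pos; [|lra]. apply Rmult_le_pos; [lra|]. apply pow2_ge_0. }
  intros w Hw. set (th := Cmod w * (2 / r)).
  assert (T := Cmod_ge_0 w).
  assert (R2 : 0 < 2 / r) by (apply Rdiv_lt_0_compat; lra).
  assert (Hth : 0 <= th <= / 2).
  { unfold th. split; [nra|].
    replace (/ 2) with (r / 4 * (2 / r)) by (field; lra). apply Rmult_le_compat_r; lra. }
  assert (E := psum_tail_le a w (f (c + w)%C) M (r / 2) th 2).
  replace (f (c + w)%C - f c - a 1%nat * w)%C with (f (c + w)%C - psum a w 2)%C.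
  - eapply Rle_trans; [apply E; auto; try lra|].
    + unfold th. right. field. lra.
    + apply H. lra.
    + unfold Rdiv at 1. replace (M * (2 / r) ^ 2 * 2 * Cmod w ^ 2) with (M * th ^ 2 * 2) by (unfold th; ring).
      apply Rmult_le_compat_l; [apply Rmult_le_pos; [lra|apply pow2_ge_0]|].
      rewrite <- (Rinv_inv 2). apply Rinv_le_contravar; lra.
  - rewrite (has_ps_0 f c r a) by auto. simpl. ring.
Qed.

Lemma has_ps_continuous (f : C -> C) (c : C) (r : R) (a : nat -> C) : 0 < r -> has_ps f c r a ->
  forall eps, 0 < eps -> exists d, 0 < d /\ forall w, Cmod w < d -> Cmod (f (c + w)%C - f c) < eps.
Proof.
  intros Hr H eps He.
  destruct (has_ps_taylor1 f c r a Hr H) as [d [K [Hd [HK B]]]].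
  set (A := Cmod (a 1%nat)). assert (HA : 0 <= A) by apply Cmod_ge_0.
  set (e := eps / (K + A + 1)).
  assert (Pe : 0 < e) by (apply Rdiv_lt_0_compat; lra).
  exists (Rmin d (Rmin 1 e)). split; [repeat apply Rmin_pos; lra|].
  intros w Hw.
  assert (W1 : Cmod w < d) by (eapply Rlt_le_trans; [apply Hw|apply Rmin_l]).
  assert (W2 : Cmod w < 1) by (eapply Rlt_le_trans; [apply Hw|eapply Rle_trans; [apply Rmin_r|apply Rmin_l]]).
  assert (W3 : Cmod w < e) by (eapply Rlt_le_trans; [apply Hw|eapply Rle_trans; [apply Rmin_r|apply Rmin_r]]).
  specialize (B w W1). assert (T := Cmod_ge_0 w).
  replace (f (c + w)%C - f c)%C with ((f (c + w)%C - f c - a 1%nat * w) + a 1%nat * w)%C by ring.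
  eapply Rle_lt_trans; [apply Cmod_triangle|]. rewrite Cmod_mult. fold A.
  assert (E : e * (K + A + 1) = eps) by (unfold e; field; lra).
  assert (E1 : K * Cmod w ^ 2 <= K * Cmod w) by (apply Rmult_le_compat_l; simpl; nra).
  assert (E2 : (K + A) * Cmod w <= (K + A) * e) by (apply Rmult_le_compat_l; lra). lra.
Qed.

(** * Comparison with the product over squares *)

Definition Csum {I : Type} (f : I -> C) (s : list I) : C := fold_right Cplus (RtoC 0) (map f s).

Lemma Csum_cons {I : Type} (f : I -> C) (x : I) (s : list I) : Csum f (x :: s) = (f x + Csum f s)%C.
Proof. reflexivity. Qed.

Lemma Csum_app {I : Type} (f : I -> C) (s t : list I) : Csum f (s ++ t) = (Csum f s + Csum f t)%C.
Proof. unfold Csum. induction s as [|x s IH]; simpl; [ring|]. rewrite IH. ring. Qed.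

Lemma Csum_plus {I : Type} (f g : I -> C) (s : list I) :
  Csum (fun i => f i + g i)%C s = (Csum f s + Csum g s)%C.
Proof. unfold Csum. induction s as [|x s IH]; simpl; [ring|]. rewrite IH. ring. Qed.

Lemma Csum_ext {I : Type} (f g : I -> C) (s : list I) :
  (forall i, In i s -> f i = g i) -> Csum f s = Csum g s.
Proof.
  unfold Csum. induction s as [|x s IH]; simpl; intros H; [reflexivity|].
  rewrite H, IH; auto.
Qed.

Lemma Csum_map {I J : Type} (g : I -> J) (f : J -> C) (s : list I) :
  Csum f (map g s) = Csum (fun i => f (g i)) s.
Proof. unfold Csum. rewrite map_map. reflexivity. Qed.

Lemma Cprod_Cexp {I : Type} (f g : I -> C) (s : list I) :
  (forall i, In i s -> f i = Cexp (g i)) -> Cprod f s = Cexp (Csum g s).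
Proof.
  unfold Cprod, Csum. induction s as [|x s IH]; simpl; intros H.
  - symmetry. apply Cexp_0.
  - rewrite H, IH, Cexp_plus; auto.
Qed.

Lemma Csum_seq_telescope (u : nat -> C) (N : nat) :
  Csum (fun l => u (S l) - u l)%C (seq 0 N) = (u N - u 0%nat)%C.
Proof.
  induction N as [|N IH]; [unfold Csum; simpl; ring|].
  rewrite seq_S, Csum_app, IH. unfold Csum; simpl. ring.
Qed.

Lemma Csum_list_prod (f : nat * nat -> C) (s t : list nat) :
  Csum f (list_prod s t) = Csum (fun k => Csum (fun l => f (k, l)) t) s.
Proof.
  induction s as [|k s IH]; [reflexivity|].
  simpl list_prod. rewrite Csum_app, IH, Csum_map. reflexivity.
Qed.

Lemma Csum_square_telescope (u : nat -> nat -> C) (N : nat) :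
  Csum (fun kl => u (S (fst kl)) (S (snd kl)) - u (fst kl) (S (snd kl))
                  - u (S (fst kl)) (snd kl) + u (fst kl) (snd kl))%C
    (list_prod (seq 0 N) (seq 0 N))
  = (u N N - u N 0%nat - u 0%nat N + u 0%nat 0%nat)%C.
Proof.
  rewrite Csum_list_prod; simpl.
  rewrite (Csum_ext _ (fun k => (u (S k) N - u (S k) 0%nat) - (u k N - u k 0%nat))%C).
  - rewrite (Csum_seq_telescope (fun k => u k N - u k 0%nat)%C). ring.
  - intros k _.
    rewrite (Csum_ext _ (fun l => (u (S k) (S l) - u k (S l)) - (u (S k) l - u k l))%C).
    + rewrite (Csum_seq_telescope (fun l => u (S k) l - u k l)%C). ring.
    + intros l _. ring.
Qed.

(** Any exhausting family of finite sets computes the unordered product; squares make the double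
    difference telescope. The head of the list is (0, 0), so [tl] removes exactly the index that the
    product omits. *)
Definition square (N : nat) : list (nat * nat) := list_prod (seq 0 (S N)) (seq 0 (S N)).

Lemma square_cons (N : nat) : square N = (0%nat, 0%nat) :: tl (square N).
Proof. reflexivity. Qed.

Lemma NoDup_square (N : nat) : NoDup (square N).
Proof.
  assert (H : forall s t : list nat, NoDup s -> NoDup t -> NoDup (list_prod s t)).
  { intros s t Hs Ht. induction Hs as [|x s Hx Hs IH]; simpl; [constructor|].
    apply NoDup_app; auto.
    - apply FinFun.Injective_map_NoDup; auto. intros a b E; congruence.
    - intros [a b] H1 H2. apply in_map_iff in H1. destruct H1 as [y [E _]].
      inversion E; subst. apply in_prod_iff in H2. tauto. }
  apply H; apply seq_NoDup.
Qed.

Lemma in_square (N k l : nat) : (k <= N)%nat -> (l <= N)%nat -> (k, l) <> (0%nat, 0%nat) ->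
  In (k, l) (tl (square N)).
Proof.
  intros Hk Hl Hn.
  assert (H : In (k, l) (square N)) by (apply in_prod; apply in_seq; lia).
  rewrite square_cons in H. destruct H as [E|H]; auto. congruence.
Qed.

Lemma square_not_0 (N : nat) (kl : nat * nat) : In kl (tl (square N)) -> kl <> (0%nat, 0%nat).
Proof.
  intros H E. assert (D := NoDup_square N). rewrite square_cons in D.
  inversion D; subst; contradiction.
Qed.

Lemma unordered_prod_squares (a : nat * nat -> C) (p : C) :
  is_unordered_prod (fun kl => kl <> (0%nat, 0%nat)) a p ->
  Clim (fun N => Cprod a (tl (square N))) p.
Proof.
  intros H. apply Clim_Cmod. apply is_lim_seq_Reals. intros eps He.
  destruct (H eps He) as [s0 [F0 H0]].
  assert (B : exists N0, forall k l, In (k, l) s0 -> (k <= N0)%nat /\ (l <= N0)%nat).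
  { clear. induction s0 as [|[a b] s IH]; [exists 0%nat; intros k l []|].
    destruct IH as [N HN]. exists (Nat.max N (Nat.max a b)).
    intros k l [E|Hin]; [inversion E; subst; lia|]. specialize (HN k l Hin). lia. }
  destruct B as [N0 B]. exists N0. intros N HN. unfold R_dist.
  rewrite Rminus_0_r, Rabs_right by apply Rle_ge, Cmod_ge_0.
  apply H0.
  - assert (D := NoDup_square N). rewrite square_cons in D. inversion D; auto.
  - apply Forall_forall. intros kl. apply square_not_0.
  - intros [k l] Hin. destruct (B k l Hin). apply in_square; try lia.
    rewrite Forall_forall in F0. apply F0, Hin.
Qed.

(** Reality of the coefficients matters: on the positive half-line the exponential of such a
    polynomial determines it. *)
Definition real_quadratic (q : C -> C) : Prop :=
  exists a b c : R, forall z, q z = (RtoC a + RtoC b * z + RtoC c * z ^ 2)%C.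

Lemma real_quadratic_plus (p q : C -> C) :
  real_quadratic p -> real_quadratic q -> real_quadratic (fun z => p z + q z)%C.
Proof.
  intros [a [b [c H]]] [a' [b' [c' H']]]. exists (a + a'), (b + b'), (c + c').
  intros z. rewrite H, H', !RtoC_plus. ring.
Qed.

Lemma real_quadratic_opp (p : C -> C) : real_quadratic p -> real_quadratic (fun z => - p z)%C.
Proof.
  intros [a [b [c H]]]. exists (- a), (- b), (- c). intros z. rewrite H, !RtoC_opp. ring.
Qed.

Lemma real_quadratic_minus (p q : C -> C) :
  real_quadratic p -> real_quadratic q -> real_quadratic (fun z => p z - q z)%C.
Proof. intros H1 H2. apply real_quadratic_plus; auto. apply real_quadratic_opp; auto. Qed.

Lemma real_quadratic_Csum {I : Type} (f : I -> C -> C) (s : list I) :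
  (forall i, In i s -> real_quadratic (f i)) -> real_quadratic (fun z => Csum (fun i => f i z) s).
Proof.
  induction s as [|x s IH]; intros H.
  - exists 0, 0, 0. intros z. unfold Csum; simpl. ring.
  - apply (real_quadratic_plus (f x) (fun z => Csum (fun i => f i z) s)).
    + apply H; simpl; auto.
    + apply IH. intros; apply H; simpl; auto.
Qed.

(** Lagrange interpolation at 1, 2, 3: convergence at three real points forces convergence of the
    polynomials at every complex z. *)
Lemma real_quadratic_interpolation (q : C -> C) (z : C) : real_quadratic q ->
  q z = (q (RtoC 1) * ((z - 2) * (z - 3) / 2) - q (RtoC 2) * ((z - 1) * (z - 3))
         + q (RtoC 3) * ((z - 1) * (z - 2) / 2))%C.
Proof.
  intros [a [b [c H]]]. rewrite !H.
  replace (RtoC 3) with (1 + 2)%C by (rewrite <- RtoC_plus; f_equal; ring).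
  replace (RtoC 2) with (1 + 1)%C by (rewrite <- RtoC_plus; f_equal; ring).
  field.
Qed.

Lemma real_quadratic_Im (q : C -> C) (x : R) : real_quadratic q -> Im (q (RtoC x)) = 0.
Proof.
  intros [a [b [c H]]]. rewrite H. rewrite <- RtoC_pow, <- !RtoC_mult, <- !RtoC_plus. apply Im_RtoC.
Qed.

(** * Logarithms of the partial products *)

Definition lattice (tau : R) (kl : nat * nat) : R := INR (fst kl) * tau + INR (snd kl).

Lemma lattice_pos (tau : R) (kl : nat * nat) : 0 < tau -> kl <> (0%nat, 0%nat) -> 0 < lattice tau kl.
Proof.
  intros Ht H. destruct kl as [k l]. unfold lattice; simpl.
  assert (T1 := pos_INR k). assert (T2 := pos_INR l).
  destruct k as [|k].
  - destruct l as [|l]; [congruence|]. assert (0 < INR (S l)) by (apply lt_0_INR; lia).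
    simpl (INR 0). lra.
  - assert (0 < INR (S k)) by (apply lt_0_INR; lia). nra.
Qed.

Lemma lattice_nonneg (tau : R) (kl : nat * nat) : 0 < tau -> 0 <= lattice tau kl.
Proof.
  intros Ht. destruct kl as [k l]. unfold lattice; simpl.
  assert (T1 := pos_INR k). assert (T2 := pos_INR l). nra.
Qed.

Definition factor_quadratic (tau : R) (kl : nat * nat) (z : C) : C :=
  let w := RtoC (lattice tau kl) in (- RtoC (ln (lattice tau kl)) - z / w + z ^ 2 / (2 * w ^ 2))%C.

Lemma RtoC_neq_0 (x : R) : x <> 0 -> RtoC x <> 0%C.
Proof. intros H E. apply H. apply (f_equal Re) in E. exact E. Qed.

Lemma barnes_factor_Cexp (tau : R) (z : C) (kl : nat * nat) :
  0 < tau -> 0 < Re z -> kl <> (0%nat, 0%nat) ->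
  barnes_factor tau z kl = Cexp (Cln (z + RtoC (lattice tau kl)) + factor_quadratic tau kl z).
Proof.
  intros Ht Hz Hn. assert (Pw := lattice_pos tau kl Ht Hn).
  unfold barnes_factor, factor_quadratic. fold (lattice tau kl).
  set (w := lattice tau kl) in *.
  assert (Nw : RtoC w <> 0%C) by (apply RtoC_neq_0; lra).
  replace (Cln (z + RtoC w) + (- RtoC (ln w) - z / RtoC w + z ^ 2 / (2 * RtoC w ^ 2)))%C
    with (Cln (z + RtoC w) + - RtoC (ln w) + (- (z / RtoC w) + z ^ 2 / (2 * RtoC w ^ 2)))%C by ring.
  rewrite !Cexp_plus. rewrite Cexp_Cln by (rewrite Re_plus, Re_RtoC; lra).
  rewrite (Cexp_opp (RtoC (ln w))), Cexp_RtoC, exp_ln by auto.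
  f_equal. field. auto.
Qed.

Lemma factor_quadratic_real (tau : R) (kl : nat * nat) : 0 < tau -> kl <> (0%nat, 0%nat) ->
  real_quadratic (factor_quadratic tau kl).
Proof.
  intros Ht Hn. assert (Pw := lattice_pos tau kl Ht Hn).
  set (w := lattice tau kl) in *.
  exists (- ln w), (- / w), (/ (2 * w ^ 2)). intros z. unfold factor_quadratic. fold w.
  assert (Nw : RtoC w <> 0%C) by (apply RtoC_neq_0; lra).
  rewrite !RtoC_opp, !RtoC_inv, RtoC_mult, RtoC_pow; [field; auto| |lra].
  apply Rgt_not_eq. apply Rmult_lt_0_compat; [lra|]. apply pow_lt; auto.
Qed.

(** [Ff_double_difference] at each lattice point turns the sum of logarithms into a telescoping one.
    The corner at the origin contributes F(z); the other three lie far away and are treated by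
    [Ff_far]. *)
Lemma Csum_Cln_square (tau : R) (z : C) (N : nat) : 0 < tau -> 0 < Re z ->
  Csum (fun kl => Cln (z + RtoC (lattice tau kl)))%C (square N)
  = (Ff tau (RtoC ((1 + tau) * INR (S N)) + z) - Ff tau (RtoC (tau * INR (S N)) + z)
     - Ff tau (RtoC (1 * INR (S N)) + z) + Ff tau z + Csum (fun _ => RtoC (ln tau)) (square N))%C.
Proof.
  intros Ht Hz.
  set (u := fun k l => Ff tau (z + RtoC (lattice tau (k, l)))%C).
  rewrite (Csum_ext _ (fun kl => (u (S (fst kl)) (S (snd kl)) - u (fst kl) (S (snd kl))
                  - u (S (fst kl)) (snd kl) + u (fst kl) (snd kl)) + RtoC (ln tau))%C).
  - rewrite Csum_plus. unfold square at 1. rewrite Csum_square_telescope.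
    assert (Eu : forall k l r, r = INR k * tau + INR l -> u k l = Ff tau (RtoC r + z)%C).
    { intros k l r ->. unfold u, lattice; simpl fst; simpl snd. rewrite Cplus_comm. reflexivity. }
    rewrite (Eu (S N) (S N) ((1 + tau) * INR (S N))) by ring.
    rewrite (Eu (S N) 0%nat (tau * INR (S N))) by (simpl (INR 0); ring).
    rewrite (Eu 0%nat (S N) (1 * INR (S N))) by (simpl (INR 0); ring).
    rewrite (Eu 0%nat 0%nat 0) by (simpl (INR 0); ring).
    replace (RtoC 0 + z)%C with z by ring. reflexivity.
  - intros [k l] _; simpl fst; simpl snd.
    assert (Hw : 0 < Re (z + RtoC (lattice tau (k, l)))%C).
    { rewrite Re_plus, Re_RtoC. assert (T := lattice_nonneg tau (k, l) Ht). lra. }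
    assert (E := Ff_double_difference tau Ht _ Hw).
    replace (Cln (z + RtoC (lattice tau (k, l))))%C with
      (Cln (z + RtoC (lattice tau (k, l))) - RtoC (ln tau) + RtoC (ln tau))%C by ring.
    rewrite <- E. apply (f_equal (fun c => c + RtoC (ln tau))%C). unfold u.
    replace (lattice tau (S k, S l)) with (lattice tau (k, l) + (1 + tau)) by (unfold lattice; simpl fst; simpl snd; rewrite !S_INR; ring).
    replace (lattice tau (k, S l)) with (lattice tau (k, l) + 1) by (unfold lattice; simpl fst; simpl snd; rewrite !S_INR; ring).
    replace (lattice tau (S k, l)) with (lattice tau (k, l) + tau) by (unfold lattice; simpl fst; simpl snd; rewrite !S_INR; ring).
    rewrite !(RtoC_plus (lattice tau (k, l))), !Cplus_assoc. reflexivity.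
Qed.

(* The part of [Sf tau (A + z)] that survives as [A] tends to infinity. *)
Definition expand_quadratic (tau A : R) (z : C) : C :=
  let a2 := / (2 * tau) in let a1 := - ((1 + tau) / (2 * tau)) in
  let a0 := (1 + 3 * tau + tau ^ 2) / (12 * tau) in
  let p := a2 * A ^ 2 + a1 * A + a0 in let p' := 2 * a2 * A + a1 in
  ((RtoC p + RtoC p' * z + RtoC a2 * z ^ 2) * RtoC (ln A)
   + (RtoC (p / A) * z + RtoC (p' / A - p / (2 * A ^ 2)) * z ^ 2) + barnes_Q tau 0 (RtoC A + z))%C.

Lemma expand_quadratic_real (tau A : R) : real_quadratic (expand_quadratic tau A).
Proof.
  unfold expand_quadratic. cbv zeta.
  set (a2 := / (2 * tau)). set (a1 := - ((1 + tau) / (2 * tau))).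
  set (a0 := (1 + 3 * tau + tau ^ 2) / (12 * tau)).
  set (p := a2 * A ^ 2 + a1 * A + a0). set (p' := 2 * a2 * A + a1).
  apply real_quadratic_plus; [apply real_quadratic_plus|].
  - exists (p * ln A), (p' * ln A), (a2 * ln A). intros z. rewrite !RtoC_mult. ring.
  - exists 0, (p / A), (p' / A - p / (2 * A ^ 2)). intros z. ring.
  - set (q2 := (3 / 2 + ln tau) / (2 * tau)).
    set (q1 := ln (2 * PI * tau) / 2 + (1 + tau + ln tau) / (2 * tau)).
    exists (- q2 * A ^ 2 + q1 * A), (- (2 * q2 * A) + q1), (- q2). intros z.
    unfold barnes_Q. fold q2 q1.
    rewrite !RtoC_plus, !RtoC_opp, !RtoC_mult, RtoC_opp, RtoC_pow. ring.
Qed.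

Lemma Ff_far (tau d : R) (z : C) : 0 < tau -> 0 < d -> 0 < Re z ->
  Clim (fun N => Ff tau (RtoC (d * INR (S N)) + z) - expand_quadratic tau (d * INR (S N)) z)%C 0%C.
Proof.
  intros Ht Hd Hz.
  set (A := fun N => RtoC (d * INR (S N))).
  assert (PA : forall N, 0 < d * INR (S N)).
  { intros N. apply Rmult_lt_0_compat; auto. apply lt_0_INR; lia. }
  assert (HA : forall N, 0 < Re (A N)) by (intros N; apply PA).
  assert (HAz : forall N, 0 < Re (A N + z)%C).
  { intros N. rewrite Re_plus. specialize (HA N). lra. }
  assert (LI : is_lim_seq (fun N => d * INR (S N)) p_infty).
  { apply (is_lim_seq_incr_1 (fun N => d * INR N)).
    replace p_infty with (Rbar_mult d p_infty).
    - apply is_lim_seq_scal_l, is_lim_seq_INR.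
    - simpl. destruct (Rle_dec 0 d); [|lra]. destruct (Rle_lt_or_eq_dec 0 d r); [reflexivity|lra]. }
  assert (LR : is_lim_seq (fun N => / (d * INR (S N))) 0).
  { apply (is_lim_seq_inv _ p_infty); [auto|discriminate]. }
  assert (LA : Clim (fun N => / A N)%C 0%C).
  { apply Clim_ext with (fun N => RtoC (/ (d * INR (S N)))).
    - intros N. unfold A. apply RtoC_inv. apply Rgt_not_eq, PA.
    - apply Clim_RtoC; auto. }
  assert (L1 := Sf_asymptotic tau A z HA HAz LA).
  assert (L2 : Clim (fun N => Lap (f3ext tau) (A N + z))%C 0%C).
  { apply Lap_f3_lim; auto.
    apply is_lim_seq_le_p_loc with (fun N => d * INR (S N)); auto.
    exists 0%nat; intros N _. rewrite Re_plus. unfold A. rewrite Re_RtoC. lra. }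
  set (a2 := / (2 * tau)). set (a1 := - ((1 + tau) / (2 * tau))).
  (* The cubic and quartic terms in z of [Sf_expand] add up to - k / A^2, because the contributions
     of order 1 / A to z^3 cancel. The remaining terms are quadratic in z. *)
  set (k := ((RtoC a1 * z ^ 3 + RtoC a2 * z ^ 4) / 2)%C).
  assert (L3 : Clim (fun N => k * (/ A N * / A N))%C (k * (0 * 0))%C).
  { apply Clim_mult; [apply Clim_const|]. apply Clim_mult; assumption. }
  assert (L := Clim_minus _ _ _ _ (Clim_minus _ _ _ _ L1 L2) L3).
  replace (0 - 0 - k * (0 * 0))%C with (RtoC 0) in L by ring.
  apply Clim_ext with (2 := L). intros N.
  unfold Ff, Sf_expand, expand_quadratic. cbv zeta. fold a2 a1. fold (A N).
  replace (Cln (A N)) with (RtoC (ln (d * INR (S N)))) by (unfold A; rewrite Cln_RtoC; auto).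
  assert (NA := Re_pos_neq_0 _ (HA N)). specialize (PA N).
  rewrite !(barnes_P_eq tau Ht). fold a2 a1.
  set (a0 := (1 + 3 * tau + tau ^ 2) / (12 * tau)).
  set (x := d * INR (S N)) in *.
  set (p := a2 * x ^ 2 + a1 * x + a0). set (p' := 2 * a2 * x + a1).
  assert (Ex : RtoC x = A N) by reflexivity.
  assert (Ep : RtoC p = (RtoC a2 * A N ^ 2 + RtoC a1 * A N + RtoC a0)%C)
    by (unfold p; rewrite !RtoC_plus, !RtoC_mult, RtoC_pow, Ex; reflexivity).
  assert (Ep' : RtoC p' = (2 * RtoC a2 * A N + RtoC a1)%C)
    by (unfold p'; rewrite !RtoC_plus, !RtoC_mult, Ex; reflexivity).
  rewrite RtoC_minus, !RtoC_div, RtoC_mult, RtoC_pow by nra.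
  rewrite Ep, Ep', Ex. unfold k. clearbody A p p' x. field. auto.
Qed.

(** The N-th partial product with its prefactor is exp (F(z) + q_N(z) + o(1)), where q_N collects
    everything that is a real quadratic polynomial: the exponent with c1 and c2, the convergence
    factors, the constants ln tau and the expansions at the far corners. *)
Lemma barnes_quadratic_limit (tau : R) (G : C -> C) : 0 < tau -> is_barnes_double_gamma tau G ->
  exists q : nat -> C -> C, (forall N, real_quadratic (q N)) /\
    forall z, 0 < Re z -> Clim (fun N => Cexp (q N z)) (G z * Cexp (- Ff tau z))%C.
Proof.
  intros Ht [_ [c1 [c2 [HP _]]]].
  set (T := RtoC tau). assert (NT : T <> 0%C) by (apply RtoC_neq_0; lra).
  set (e := fun d N => expand_quadratic tau (d * INR (S N))).
  exists (fun N z => (RtoC c1 * z / T + RtoC c2 * z ^ 2 / (2 * T ^ 2))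
     + Csum (fun kl => factor_quadratic tau kl z) (tl (square N))
     (* Each lattice point contributes a [ln tau] through the double difference; the one subtracted
        comes from the prefactor z / tau. *)
     + (Csum (fun _ => RtoC (ln tau)) (square N) - RtoC (ln tau))
     + (e (1 + tau)%R N z - e tau N z - e 1%R N z))%C.
  split.
  - intros N. apply real_quadratic_plus; [apply real_quadratic_plus; [apply real_quadratic_plus|]|].
    + exists 0, (c1 / tau), (c2 / (2 * tau ^ 2)). intros z.
      rewrite !RtoC_div, RtoC_mult, RtoC_pow by nra. fold T. field. auto.
    + apply real_quadratic_Csum. intros kl Hkl. apply factor_quadratic_real; auto.
      apply square_not_0 in Hkl; auto.
    + apply real_quadratic_minus.
      * apply (real_quadratic_Csum (fun _ _ => RtoC (ln tau))). intros _ _.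
        exists (ln tau), 0, 0. intros; ring.
      * exists (ln tau), 0, 0. intros; ring.
    + apply real_quadratic_minus; [apply real_quadratic_minus|]; apply expand_quadratic_real.
  - intros z Hz. destruct (HP z) as [p [Hp EG]].
    apply unordered_prod_squares in Hp.
    set (g := (RtoC c1 * z / T + RtoC c2 * z ^ 2 / (2 * T ^ 2))%C).
    set (eps := fun N => ((Ff tau (RtoC ((1 + tau) * INR (S N)) + z) - e (1 + tau)%R N z)
       - (Ff tau (RtoC (tau * INR (S N)) + z) - e tau N z)
       - (Ff tau (RtoC (1 * INR (S N)) + z) - e 1%R N z))%C).
    assert (Le : Clim eps 0%C).
    { replace (RtoC 0) with (0 - 0 - 0)%C by ring.
      apply Clim_minus; [apply Clim_minus|]; apply Ff_far; auto; lra. }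
    assert (L1 := Clim_mult _ _ _ _ (Clim_const (z / T * Cexp g)%C) Hp).
    fold T in EG. fold g in EG. rewrite <- EG in L1.
    assert (L2 := Clim_mult _ _ _ _ L1 (Clim_Cexp _ _ (Clim_minus _ _ _ _ (Clim_const (- Ff tau z)%C) Le))).
    replace (- Ff tau z - 0)%C with (- Ff tau z)%C in L2 by ring.
    apply Clim_ext with (2 := L2). intros N.
    rewrite (Cprod_Cexp _ (fun kl => Cln (z + RtoC (lattice tau kl)) + factor_quadratic tau kl z)%C).
    2: { intros kl Hkl. apply barnes_factor_Cexp; auto. apply square_not_0 in Hkl; auto. }
    rewrite Csum_plus.
    assert (EC := Csum_Cln_square tau z N Ht Hz).
    assert (ES := f_equal (Csum (fun kl => Cln (z + RtoC (lattice tau kl))%C)) (square_cons N)).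
    rewrite Csum_cons in ES.
    cbv beta in ES. rewrite ES in EC. clear ES.
    replace (lattice tau (0%nat, 0%nat)) with 0 in EC by (unfold lattice; simpl; ring).
    replace (z + RtoC 0)%C with z in EC by ring.
    set (X := Csum (fun kl => Cln (z + RtoC (lattice tau kl)))%C (tl (square N))) in *.
    set (Y := Csum (fun kl => factor_quadratic tau kl z) (tl (square N))).
    replace (z / T)%C with (Cexp (Cln z - RtoC (ln tau))).
    2: { rewrite Cexp_minus, Cexp_Cln, Cexp_RtoC, exp_ln; auto. }
    rewrite <- !Cexp_plus. f_equal. unfold eps.
    replace X with (Cln z + X - Cln z)%C by ring. rewrite EC. fold g. ring.
Qed.

(** The condition Im <> 0 is open, so a limit satisfying it would force some integral over a finite
    interval to satisfy it too; but those integrals are real. *)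
Lemma Lap_Im (h : R -> R) (x : R) : tame h -> 0 < x -> Im (Lap h (RtoC x)) = 0.
Proof.
  intros Hh Hx. assert (I := CInt_lap h (RtoC x) Hh Hx).
  set (l := Lap h (RtoC x)) in *.
  destruct (Req_dec (Im l) 0) as [E|N]; auto. exfalso.
  assert (HP : @locally C_R_NormedModule l (fun y => Im y <> 0)).
  { assert (P : 0 < Rabs (Im l)) by (apply Rabs_pos_lt; auto).
    exists (mkposreal _ P). intros y [_ Hy] E. unfold ball in Hy; simpl in Hy.
    unfold AbsRing_ball, abs, minus, plus, opp in Hy; simpl in Hy.
    unfold Im in *. rewrite E, Rplus_0_l, Rabs_Ropp in Hy. lra. }
  destruct (I _ HP) as [Q Q' HQ [M HR] H].
  destruct (H 0 (M + 1) HQ (HR (M + 1) ltac:(lra))) as [y [Hy Ny]]. simpl in Hy.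
  apply Ny.
  assert (Hs := is_RInt_fct_extend_snd (U := R_NormedModule) (V := R_NormedModule) _ _ _ _ Hy).
  assert (H0 : is_RInt (fun _ : R => 0) 0 (M + 1) (snd y)).
  { apply is_RInt_ext with (2 := Hs). intros t _. rewrite lap_fun_coords. simpl.
    replace (- (0 * t)) with 0 by ring. rewrite sin_0. ring. }
  assert (E := is_RInt_unique (V := R_CompleteNormedModule) _ _ _ _ H0).
  rewrite RInt_const in E. unfold scal in E; simpl in E. unfold mult in E; simpl in E.
  unfold Im. rewrite <- E. ring.
Qed.

Lemma Ff_Im (tau x : R) : 0 < tau -> 0 < x -> Im (Ff tau (RtoC x)) = 0.
Proof.
  intros Ht Hx. unfold Ff, Sf. rewrite Im_minus, Lap_Im; auto; [|apply tame_f3ext; auto].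
  rewrite Cln_RtoC by auto.
  unfold barnes_P, barnes_Q. rewrite <- !RtoC_pow, <- RtoC_div by lra.
  rewrite <- ?RtoC_mult, <- ?RtoC_minus, <- ?RtoC_opp, <- ?RtoC_plus, <- ?RtoC_mult, <- ?RtoC_plus, Im_RtoC. ring.
Qed.

(** Real exponents are recovered from their exponentials by the continuous [ln]; complex ones would
    be determined only up to multiples of 2 pi i. *)
Lemma real_exp_limit (u : nat -> C) (l : R) : (forall n, Im (u n) = 0) ->
  Clim (fun n => Cexp (u n)) (Cexp (RtoC l)) -> Clim u (RtoC l).
Proof.
  intros Hu [H _].
  apply Clim_ext with (fun n => RtoC (Re (u n))); [intros n; symmetry; apply Im_0_RtoC; auto|].
  apply Clim_RtoC.
  apply is_lim_seq_ext with (fun n => ln (Re (Cexp (u n)))).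
  - intros n. rewrite (Im_0_RtoC (u n)) at 1 by auto. rewrite Cexp_RtoC, Re_RtoC. apply ln_exp.
  - rewrite Cexp_RtoC, Re_RtoC in H. rewrite <- (ln_exp l).
    apply (is_lim_seq_continuous ln); auto.
    apply derivable_continuous_pt. exists (/ exp l). apply derivable_pt_lim_ln, exp_pos.
Qed.

(** Runs from the real point x at s = 0 to x + i y at s = 1. Its real part is constant, so it never
    leaves the half-plane. *)
Definition vline (x y s : R) : C := (RtoC x + RtoC s * (Ci * RtoC y))%C.

Lemma continuous_of_eps (f : R -> C) (s : R) :
  (forall eps, 0 < eps -> exists d, 0 < d /\ forall t, Rabs (t - s) < d -> Cmod (f t - f s) < eps) ->
  continuous (fun t => Im (f t)) s.
Proof.
  intros H P [e He]. destruct (H e (cond_pos e)) as [d [Hd B]].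
  exists (mkposreal d Hd). intros t Ht. apply He.
  unfold ball in *; simpl in *. unfold AbsRing_ball, abs, minus, plus, opp in *; simpl in *.
  eapply Rle_lt_trans; [|apply (B t Ht)]. exact (im_le_Cmod (f t - f s)).
Qed.

Lemma vline_diff (x y s t : R) : vline x y t = (vline x y s + RtoC (t - s) * (Ci * RtoC y))%C.
Proof. unfold vline. rewrite RtoC_minus. ring. Qed.

Lemma Cmod_vline_diff (y u : R) : Cmod (RtoC u * (Ci * RtoC y))%C = Rabs u * Rabs y.
Proof. rewrite !Cmod_mult, Cmod_Ci, !Cmod_R. ring. Qed.

Lemma vline_continuous_Im (f : C -> C) (x y s : R) :
  (forall eps, 0 < eps -> exists d, 0 < d /\ forall w, Cmod w < d ->
     Cmod (f (vline x y s + w)%C - f (vline x y s)) < eps) ->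
  continuous (fun t => Im (f (vline x y t))) s.
Proof.
  intros H. apply (continuous_of_eps (fun t => f (vline x y t))). intros eps He.
  destruct (H eps He) as [d [Hd B]].
  assert (Py := Rabs_pos y).
  exists (d / (Rabs y + 1)). split; [apply Rdiv_lt_0_compat; lra|].
  intros t Ht. rewrite (vline_diff x y s t). apply B. rewrite Cmod_vline_diff.
  assert (Rabs (t - s) * (Rabs y + 1) < d).
  { apply Rmult_lt_compat_r with (r := Rabs y + 1) in Ht; [|lra].
    replace (d / (Rabs y + 1) * (Rabs y + 1)) with d in Ht by (field; lra). auto. }
  assert (P := Rabs_pos (t - s)). nra.
Qed.

Lemma Lap_continuous (h : R -> R) (z : C) : tame h -> 0 < Re z ->
  forall eps, 0 < eps -> exists d, 0 < d /\ forall w, Cmod w < d -> Cmod (Lap h (z + w)%C - Lap h z) < eps.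
Proof.
  intros Hh Hz eps He. destruct (Lap_lipschitz h z Hh Hz) as [r [K [Hr [_ B]]]].
  exists (Rmin r (eps / (Rabs K + 1))).
  assert (PK := Rabs_pos K).
  split; [apply Rmin_pos; auto; apply Rdiv_lt_0_compat; lra|].
  intros w Hw.
  assert (W1 : Cmod w <= r) by (left; eapply Rlt_le_trans; [apply Hw|apply Rmin_l]).
  assert (W2 : Cmod w < eps / (Rabs K + 1)) by (eapply Rlt_le_trans; [apply Hw|apply Rmin_r]).
  eapply Rle_lt_trans; [apply B; auto|].
  apply Rmult_lt_compat_r with (r := Rabs K + 1) in W2; [|lra].
  replace (eps / (Rabs K + 1) * (Rabs K + 1)) with eps in W2 by (field; lra).
  assert (T := Cmod_ge_0 w). assert (T2 := Rle_abs K). nra.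
Qed.

Lemma Cexp_eq_1_Re (w : C) : Cexp w = 1%C -> Re w = 0 /\ cos (Im w) = 1.
Proof.
  intros H. assert (E := Cmod_Cexp w). rewrite H, Cmod_1 in E.
  assert (R0 : Re w = 0) by (rewrite <- (ln_exp (Re w)), <- E; apply ln_1).
  split; auto. apply (f_equal Re) in H. unfold Cexp in H; simpl in H.
  rewrite R0, exp_0 in H. unfold Im in *; lra.
Qed.

(* A logarithm of 1 that is continuous and vanishes at 0 is 0, by the intermediate value theorem. *)
Lemma log_branch_unique (m : R -> R) : (forall s, continuous m s) -> m 0 = 0 ->
  (forall s, cos (m s) = 1) -> m 1 = 0.
Proof.
  intros Hc H0 H1. destruct (Req_dec (m 1) 0) as [E|N]; auto. exfalso.
  assert (P := PI_RGT_0). assert (A := Rabs_pos_lt _ N).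
  set (c := Rmin (Rabs (m 1) / 2) (PI / 2)).
  assert (Hcp : 0 < c) by (apply Rmin_pos; lra).
  assert (C1 : c <= Rabs (m 1) / 2) by apply Rmin_l.
  assert (C2 : c <= PI / 2) by apply Rmin_r.
  assert (Hcos : cos c < 1) by (rewrite <- cos_0; apply cos_decreasing_1; lra).
  assert (Cm : continuity m) by (intros s; apply continuity_pt_filterlim, Hc).
  destruct (Rle_dec 0 (m 1)) as [L|L].
  - rewrite Rabs_right in C1 by lra.
    destruct (IVT_gen m 0 1 c Cm) as [s [_ E]].
    + rewrite H0, Rmin_left, Rmax_right by lra. lra.
    + specialize (H1 s). rewrite E in H1. lra.
  - rewrite Rabs_left in C1 by lra.
    destruct (IVT_gen m 0 1 (- c) Cm) as [s [_ E]].
    + rewrite H0, Rmin_right, Rmax_left by lra. lra.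
    + specialize (H1 s). rewrite E, cos_neg in H1. lra.
Qed.

(** At positive reals ln G - F is the limit of q_N itself, and three such values fix the limiting
    polynomial [d]. Elsewhere only the exponentials of ln G and F + d are known to agree; their
    difference is followed along a vertical line from the real axis, where it vanishes. *)
Lemma log_barnes_quadratic (tau : R) (G L : C -> C) :
  0 < tau -> is_barnes_double_gamma tau G -> is_real_log_branch G L ->
  exists a b c : R, forall z, 0 < Re z ->
    L z = (Ff tau z + (RtoC a + RtoC b * z + RtoC c * z ^ 2))%C.
Proof.
  intros Ht HG [HL HR].
  destruct (barnes_quadratic_limit tau G Ht HG) as [q [Hq Hlim]].
  set (D := fun x => Re (L (RtoC x)) - Re (Ff tau (RtoC x))).
  assert (Lq : forall x, 0 < x -> Clim (fun N => q N (RtoC x)) (RtoC (D x))).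
  { intros x Hx. apply real_exp_limit; [intros; apply real_quadratic_Im; auto|].
    replace (Cexp (RtoC (D x))) with (G (RtoC x) * Cexp (- Ff tau (RtoC x)))%C; [apply Hlim; auto|].
    rewrite <- (proj2 (HL (RtoC x) Hx)), <- Cexp_plus. f_equal.
    apply C_ext.
    - rewrite Re_plus, Re_opp. reflexivity.
    - rewrite Im_plus, Im_opp, HR, Ff_Im, Im_RtoC by auto. ring. }
  set (d := fun z : C => (RtoC (D 1) * ((z - 2) * (z - 3) / 2) - RtoC (D 2) * ((z - 1) * (z - 3))
         + RtoC (D 3) * ((z - 1) * (z - 2) / 2))%C).
  assert (Ld : forall z, Clim (fun N => q N z) (d z)).
  { intros z. apply Clim_ext with (fun N => q N (RtoC 1) * ((z - 2) * (z - 3) / 2)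
      - q N (RtoC 2) * ((z - 1) * (z - 3)) + q N (RtoC 3) * ((z - 1) * (z - 2) / 2))%C.
    - intros N. symmetry. apply real_quadratic_interpolation; auto.
    - apply Clim_plus; [apply Clim_minus|]; (apply Clim_mult; [apply Lq; lra|apply Clim_const]). }
  assert (EG : forall z, 0 < Re z -> Cexp (L z) = Cexp (Ff tau z + d z)).
  { intros z Hz. rewrite (proj2 (HL z Hz)), Cexp_plus.
    rewrite <- (Clim_unique _ _ _ (Hlim z Hz) (Clim_Cexp _ _ (Ld z))).
    rewrite Cexp_opp. field. apply Cexp_neq_0. }
  (* The coefficients of the interpolating polynomial [d], expanded in powers of z. *)
  set (a := D 1 * 3 - D 2 * 3 + D 3). set (b := - D 1 * (5 / 2) + D 2 * 4 - D 3 * (3 / 2)).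
  set (c := D 1 / 2 - D 2 + D 3 / 2).
  assert (Ed : forall z, d z = (RtoC a + RtoC b * z + RtoC c * z ^ 2)%C).
  { intros z. unfold d, a, b, c. unfold Rdiv.
    rewrite !RtoC_plus, !RtoC_minus, !RtoC_plus, !RtoC_mult, !RtoC_opp, RtoC_inv by lra.
    replace (RtoC 5) with (2 + 2 + 1)%C by (rewrite <- !RtoC_plus; f_equal; ring).
    replace (RtoC 4) with (2 + 2)%C by (rewrite <- !RtoC_plus; f_equal; ring).
    replace (RtoC 3) with (2 + 1)%C by (rewrite <- !RtoC_plus; f_equal; ring).
    field. }
  exists a, b, c. intros z Hz. rewrite <- Ed.
  set (W := fun z => (L z - (Ff tau z + d z))%C).
  assert (HW : forall z, 0 < Re z -> Cexp (W z) = 1%C).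
  { intros w Hw. unfold W. rewrite Cexp_minus, EG by auto. field. apply Cexp_neq_0. }
  set (x := Re z). set (y := Im z).
  assert (Pv : forall s, 0 < Re (vline x y s)).
  { intros s. unfold vline, x. rewrite Re_plus, !Re_mult, Im_mult. simpl. unfold Re in *. lra. }
  assert (M1 : Im (W (vline x y 1)) = 0).
  { apply (log_branch_unique (fun s => Im (W (vline x y s)))).
    - intros s. unfold W.
      (* Three sources of continuity: the power series of [L], the derivative along the line for the
         elementary part, and [Lap_lipschitz] for the transform. *)
      apply continuous_ext with (fun s => Im (L (vline x y s)) - (Im (Sf tau (vline x y s) + d (vline x y s))
          - Im (Lap (f3ext tau) (vline x y s)))).
      { intros t. unfold Ff. rewrite Im_minus, !Im_plus, Im_minus.
        match goal with |- @eq _ ?p ?q => change (@eq R p q) end. ring. }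
      apply @continuous_minus; [|apply @continuous_minus].
      + apply vline_continuous_Im.
        destruct (analytic_has_ps L (vline x y s) (proj1 (HL _ (Pv s)))) as [p [r [Hr Hp]]].
        apply (has_ps_continuous _ _ r p Hr Hp).
      + assert (Hex : exists l, Cder (fun s => Sf tau (vline x y s) + d (vline x y s))%C s l).
        { eexists. apply Cder_ext with (fun s => (barnes_P tau (vline x y s) * Cln (vline x y s)
            + barnes_Q tau 0 (vline x y s)) + (RtoC a + RtoC b * vline x y s + RtoC c * vline x y s ^ 2))%C.
          { intros t. rewrite Ed. reflexivity. }
          assert (Dv := Cder_line (RtoC x) (Ci * RtoC y)%C s).
          change (fun s => (RtoC x + RtoC s * (Ci * RtoC y))%C) with (vline x y) in Dv.
          assert (D2 : Cder (fun s => (vline x y s ^ 2)%C) s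
             ((Ci * RtoC y) * vline x y s + vline x y s * (Ci * RtoC y))%C).
          { apply Cder_ext with (fun s => vline x y s * vline x y s)%C; [intros; simpl; ring|].
            apply (Cder_mult (vline x y) (vline x y)); auto. }
          unfold barnes_P, barnes_Q, Cdiv.
          apply Cder_plus; [apply Cder_plus|].
          - apply Cder_mult; [|apply (Cder_Cln (vline x y)); [exact Dv|apply Pv]].
            apply Cder_plus; [|apply Cder_const]. apply Cder_minus.
            + apply (Cder_mult (fun s => (vline x y s ^ 2)%C)); [exact D2|apply Cder_const].
            + apply Cder_scal, Dv.
          - apply Cder_plus; [|apply Cder_const].
            apply Cder_plus; [apply Cder_opp|]; apply Cder_scal; [exact D2|exact Dv].
          - apply Cder_plus; [apply Cder_plus; [apply Cder_const|]|]; apply Cder_scal; [exact Dv|exact D2]. }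
        destruct Hex as [l [_ Hl]]. apply (ex_derive_continuous (fun s => Im (Sf tau (vline x y s) + d (vline x y s))%C)).
        eexists; exact Hl.
      + apply vline_continuous_Im. apply Lap_continuous; [apply tame_f3ext; auto|apply Pv].
    - replace (vline x y 0) with (RtoC x) by (unfold vline; ring).
      assert (Hx : 0 < x) by exact Hz.
      unfold W. rewrite Im_minus, Im_plus, HR, Ff_Im, Ed by auto.
      rewrite (real_quadratic_Im (fun z => RtoC a + RtoC b * z + RtoC c * z ^ 2)%C); [ring|].
      exists a, b, c. reflexivity.
    - intros s. apply Cexp_eq_1_Re, HW, Pv. }
  replace (vline x y 1) with z in M1.
  2: { unfold vline, x, y. apply C_ext; rewrite ?Re_plus, ?Im_plus, ?Re_mult, ?Im_mult; simpl; unfold Re, Im; simpl; ring. }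
  destruct (Cexp_eq_1_Re _ (HW z Hz)) as [R0 _].
  replace (L z) with (W z + (Ff tau z + d z))%C by (unfold W; ring).
  replace (W z) with (RtoC 0) by (apply C_ext; auto). ring.
Qed.

(** * Stirling's constant and the constant of integration *)

Definition Rf (tau x : R) : R := Re (Ff tau (RtoC x)).
(** Turns out to be ln Gamma(x / tau), see [Gamma_dF], once Stirling's constant is known. *)
Definition dF (tau x : R) : R := Rf tau (x + 1) - Rf tau x.

Lemma Ff_RtoC (tau x : R) : 0 < tau -> 0 < x -> Ff tau (RtoC x) = RtoC (Rf tau x).
Proof. intros Ht Hx. apply Im_0_RtoC, Ff_Im; auto. Qed.

Lemma dF_step (tau x : R) : 0 < tau -> 0 < x -> dF tau (x + tau) - dF tau x = ln x - ln tau.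
Proof.
  intros Ht Hx. assert (E := Ff_double_difference tau Ht (RtoC x) Hx).
  rewrite <- !RtoC_plus, Cln_RtoC in E by auto.
  apply (f_equal Re) in E. rewrite Re_plus, !Re_minus, !Re_RtoC in E.
  unfold dF, Rf.
  replace (x + tau + 1) with (x + (1 + tau)) by ring.
  lra.
Qed.

Definition log_sum (y : R) (n : nat) : R := sum_f_R0 (fun k => ln (y + INR k)) n.

(** At the point tau (y + k) the recursion [dF_step] has right-hand side ln (y + k), so the sum
    telescopes, whatever tau is. *)
Lemma log_sum_dF (tau y : R) (n : nat) : 0 < tau -> 0 < y ->
  log_sum y n = dF tau (tau * (y + INR n + 1)) - dF tau (tau * y).
Proof.
  intros Ht Hy. unfold log_sum. induction n as [|n IH].
  - simpl. rewrite !Rplus_0_r.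
    replace (tau * (y + 1)) with (tau * y + tau) by ring.
    assert (P : 0 < tau * y) by nra.
    rewrite dF_step by auto. rewrite ln_mult by auto. ring.
  - change (sum_f_R0 (fun k => ln (y + INR k)) (S n))
      with (sum_f_R0 (fun k => ln (y + INR k)) n + ln (y + INR (S n))). rewrite IH, S_INR.
    assert (P0 := pos_INR n).
    replace (tau * (y + (INR n + 1) + 1)) with (tau * (y + INR n + 1) + tau) by ring.
    assert (P : 0 < tau * (y + INR n + 1)) by nra.
    assert (E := dF_step tau _ Ht P). rewrite ln_mult in E by lra.
    replace (y + (INR n + 1)) with (y + INR n + 1) by ring. lra.
Qed.

Definition log_Gamma_seq (y : R) (n : nat) : R :=
  ln (INR (fact n)) + y * ln (INR n) - log_sum y n.

Lemma Gamma_seq_real (y : R) (n : nat) : 0 < y ->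
  Gamma_seq (RtoC y) n = RtoC (exp (log_Gamma_seq y n)).
Proof.
  intros Hy. unfold Gamma_seq, log_Gamma_seq, Rcpow.
  assert (Ep : Cprod (fun k => RtoC y + RtoC (INR k))%C (seq 0 (S n)) = RtoC (exp (log_sum y n))).
  { unfold log_sum. induction n as [|n IH].
    - unfold Cprod; simpl. rewrite Rplus_0_r, exp_ln by auto. ring.
    - rewrite seq_S. unfold Cprod in *. rewrite map_app, fold_right_app.
      assert (G : forall (l : list C) (c : C), fold_right Cmult c l = (fold_right Cmult (RtoC 1) l * c)%C).
      { induction l as [|x l IHl]; intros c; simpl; [ring|]. rewrite IHl. ring. }
      rewrite G, IH. assert (P0 := pos_INR n).
      cbn [map fold_right Nat.add]. change (sum_f_R0 (fun k => ln (y + INR k)) (S n))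
        with (sum_f_R0 (fun k => ln (y + INR k)) n + ln (y + INR (S n))).
      assert (P1 := pos_INR (S n)).
      rewrite exp_plus, exp_ln, RtoC_mult, RtoC_plus by lra. ring. }
  rewrite Ep. rewrite <- RtoC_mult, Cexp_RtoC.
  unfold Rminus. rewrite !exp_plus, exp_Ropp, exp_ln by apply INR_fact_lt_0.
  rewrite <- RtoC_mult, <- RtoC_div; [reflexivity|]. apply Rgt_not_eq, exp_pos.
Qed.

Lemma Gamma_of_limit (y l : R) : 0 < y -> is_lim_seq (log_Gamma_seq y) l ->
  Gamma (RtoC y) = RtoC (exp l).
Proof.
  intros Hy H. unfold Gamma.
  assert (L1 : is_lim_seq (fun n => Re (Gamma_seq (RtoC y) n)) (exp l)).
  { apply is_lim_seq_ext with (fun n => exp (log_Gamma_seq y n)).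
    - intros n. rewrite Gamma_seq_real; auto.
    - apply (is_lim_seq_continuous exp); auto. apply derivable_continuous_pt, derivable_pt_exp. }
  assert (L2 : is_lim_seq (fun n => Im (Gamma_seq (RtoC y) n)) 0).
  { apply is_lim_seq_ext with (fun n => 0).
    - intros n. rewrite Gamma_seq_real; auto.
    - apply is_lim_seq_const. }
  rewrite (is_lim_seq_unique _ _ L1), (is_lim_seq_unique _ _ L2). reflexivity.
Qed.

Lemma ln_1p_bounds (u : R) : 0 <= u -> u / (1 + u) <= ln (1 + u) <= u.
Proof.
  intros Hu. split.
  - assert (H := exp_ineq1_le (- ln (1 + u))).
    rewrite exp_Ropp, exp_ln in H by lra.
    replace (u / (1 + u)) with (1 - / (1 + u)) by (field; lra). lra.
  - assert (H := exp_ineq1_le (ln (1 + u))). rewrite exp_ln in H by lra. lra.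
Qed.

Lemma is_lim_seq_inv_INR : is_lim_seq (fun n => / INR n) 0.
Proof. apply (is_lim_seq_inv _ p_infty); [apply is_lim_seq_INR|discriminate]. Qed.

Lemma lim_n_ln_1p (a : R) : 0 <= a -> is_lim_seq (fun n => INR n * (ln (INR n + a) - ln (INR n))) a.
Proof.
  intros Ha.
  apply is_lim_seq_le_le_loc with (u := fun n => a / (1 + a * / INR n)) (w := fun _ => a).
  - exists 1%nat. intros n Hn. assert (Pn : 0 < INR n) by (apply lt_0_INR; lia).
    replace (INR n + a) with (INR n * (1 + a / INR n)) by (field; lra).
    assert (Pa : 0 <= a / INR n) by (apply Rdiv_le_0_compat; lra).
    rewrite ln_mult by lra.
    destruct (ln_1p_bounds (a / INR n) Pa) as [B1 B2].
    replace (ln (INR n) + ln (1 + a / INR n) - ln (INR n)) with (ln (1 + a / INR n)) by ring.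
    split.
    + apply Rle_trans with (INR n * (a / INR n / (1 + a / INR n))).
      * right. field. split; [lra|]. unfold Rdiv in *. nra.
      * apply Rmult_le_compat_l; lra.
    + apply Rle_trans with (INR n * (a / INR n)); [apply Rmult_le_compat_l; lra|].
      right. field. lra.
  - replace (Finite a) with (Finite (a / (1 + a * 0))) by (f_equal; field).
    apply is_lim_seq_div'; [apply is_lim_seq_const| |lra].
    apply is_lim_seq_plus'; [apply is_lim_seq_const|].
    apply is_lim_seq_mult'; [apply is_lim_seq_const|apply is_lim_seq_inv_INR].
  - apply is_lim_seq_const.
Qed.

Lemma lim_ln_1p (a : R) : 0 <= a -> is_lim_seq (fun n => ln (INR n + a) - ln (INR n)) 0.
Proof.
  intros Ha. assert (H := is_lim_seq_mult' _ _ _ _ is_lim_seq_inv_INR (lim_n_ln_1p a Ha)).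
  rewrite Rmult_0_l in H. apply is_lim_seq_incr_1. apply is_lim_seq_incr_1 in H.
  apply is_lim_seq_ext with (2 := H). intros n. field. apply not_0_INR; lia.
Qed.

(** Stirling's expansion read off from F itself. The constant ln (2 PI) / 2 comes from the linear
    coefficient of Q; that it is also the constant in the expansion of ln n! is not known at this
    point. *)
Lemma dF_asymptotic (tau y : R) : 0 < tau -> 0 < y ->
  is_lim_seq (fun n => dF tau (tau * (y + INR n + 1))
    - ((y + INR n + / 2) * ln (y + INR n + 1) - (y + INR n + 1) + ln (2 * PI) / 2)) 0.
Proof.
  intros Ht Hy.
  set (X := fun n => tau * (y + INR n + 1)).
  assert (PX : forall n, 0 < X n).
  { intros n. unfold X. assert (T := pos_INR n). nra. }
  set (A := fun n => RtoC (X n)).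
  assert (HA : forall n, 0 < Re (A n)) by apply PX.
  assert (HA1 : forall n, 0 < Re (A n + RtoC 1)%C).
  { intros n. rewrite Re_plus, Re_RtoC. specialize (HA n). lra. }
  assert (LX : is_lim_seq X p_infty).
  { apply is_lim_seq_le_p_loc with (fun n => tau * INR n).
    - exists 0%nat. intros n _. unfold X. nra.
    - replace p_infty with (Rbar_mult tau p_infty).
      + apply is_lim_seq_scal_l, is_lim_seq_INR.
      + simpl. destruct (Rle_dec 0 tau); [|lra]. destruct (Rle_lt_or_eq_dec 0 tau r); [reflexivity|lra]. }
  assert (LR : is_lim_seq (fun n => / X n) 0) by (apply (is_lim_seq_inv _ p_infty); [auto|discriminate]).
  assert (LA : Clim (fun n => / A n)%C 0%C).
  { apply Clim_ext with (fun n => RtoC (/ X n)).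
    - intros n. unfold A. apply RtoC_inv. apply Rgt_not_eq, PX.
    - apply Clim_RtoC; auto. }
  assert (L1 := Sf_asymptotic tau A (RtoC 1) HA HA1 LA).
  assert (L2 : Clim (fun n => Lap (f3ext tau) (A n)) 0%C) by (apply Lap_f3_lim; auto).
  assert (L3 : Clim (fun n => Lap (f3ext tau) (A n + RtoC 1)%C) 0%C).
  { apply Lap_f3_lim; auto. apply is_lim_seq_le_p_loc with X; auto.
    exists 0%nat. intros n _. rewrite Re_plus. unfold A. rewrite !Re_RtoC. lra. }
  set (a2 := / (2 * tau)). set (a1 := - ((1 + tau) / (2 * tau))).
  set (a0 := (1 + 3 * tau + tau ^ 2) / (12 * tau)).
  set (s := a2 + a1 + a0).
  (* Here [s] is P(1), and these are the terms of P(X + 1) (1 / X - 1 / (2 X^2)) that vanish at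
     infinity. *)
  assert (L4 : Clim (fun n => RtoC ((s - a2 - a1 / 2) * / X n - s / 2 * (/ X n * / X n))) (RtoC ((s - a2 - a1 / 2) * 0 - s / 2 * (0 * 0)))).
  { apply Clim_RtoC. apply is_lim_seq_minus'; (apply is_lim_seq_mult'; [apply is_lim_seq_const|]); auto.
    apply is_lim_seq_mult'; auto. }
  assert (L := Clim_plus _ _ _ _ (Clim_plus _ _ _ _ (Clim_minus _ _ _ _ L1 L3) L2) L4).
  destruct L as [L _]. rewrite !Re_plus, Re_minus, !Re_RtoC in L.
  replace (0 - 0 + 0 + ((s - a2 - a1 / 2) * 0 - s / 2 * (0 * 0))) with 0 in L by ring.
  apply is_lim_seq_ext with (2 := L). intros n.
  fold (X n). unfold dF, Rf. rewrite <- Re_minus.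
  assert (EX : X n = tau * (y + INR n + 1)) by reflexivity.
  assert (PY : 0 < y + INR n + 1) by (assert (T := pos_INR n); lra).
  replace (y + INR n + / 2) with (X n / tau - / 2) by (rewrite EX; field; lra).
  replace (ln (y + INR n + 1)) with (ln (X n) - ln tau) by (rewrite EX, ln_mult by lra; ring).
  replace (y + INR n + 1) with (X n / tau) by (rewrite EX; field; lra).
  rewrite <- (Re_RtoC ((X n / tau - / 2) * _ - _ + _)), <- Re_minus.
  f_equal. specialize (PX n). clear EX.
  rewrite RtoC_plus. fold (A n).
  unfold Ff, Sf, Sf_expand. rewrite !(barnes_P_eq tau Ht), !barnes_Q_eq.
  replace (Cln (A n)) with (RtoC (ln (X n))) by (unfold A; rewrite Cln_RtoC; auto).
  fold a2 a1 a0.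
  replace (RtoC ((s - a2 - a1 / 2) * / X n - s / 2 * (/ X n * / X n)))
    with ((RtoC (s - a2 - a1 / 2) / A n - RtoC s / 2 / (A n * A n)))%C.
  2: { assert (NA := Re_pos_neq_0 _ (HA n)).
       set (k1 := s - a2 - a1 / 2). unfold Rdiv.
       rewrite RtoC_minus, !RtoC_mult, !RtoC_inv by lra. fold (A n). field. auto. }
  unfold s.
  rewrite ln_mult by (assert (T := PI_RGT_0); lra).
  replace (RtoC ((X n / tau - / 2) * (ln (X n) - ln tau) - X n / tau + ln (2 * PI) / 2))
   with ((2 * RtoC a2 * A n + RtoC a2 + RtoC a1) * RtoC (ln (X n)) + RtoC a2 * A n + 3 / 2 * RtoC a2 + RtoC a1
     + RtoC (- ((3 / 2 + ln tau) / (2 * tau))) * (2 * A n + 1)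
     + RtoC ((ln (2 * PI) + ln tau) / 2 + (1 + tau + ln tau) / (2 * tau)))%C.
  - rewrite !RtoC_plus, !RtoC_minus, !RtoC_plus .
    assert (NA := Re_pos_neq_0 _ (HA n)). clearbody A X a2 a1 a0. rewrite !RtoC_div by lra. field. split; [|auto]. apply (RtoC_neq_0 (2 * tau)); lra.
  - unfold A. rewrite <- RtoC_div by lra.
    rewrite <- ?RtoC_mult, <- ?RtoC_plus, <- ?RtoC_mult, <- ?RtoC_plus, <- ?RtoC_mult, <- ?RtoC_plus.
    f_equal. unfold a2, a1. field. lra.
Qed.

(** The sequence whose limit is Stirling's constant. Its convergence is proved in [stirling_limit]
    and its value in [stirling_constant]. *)
Definition stirling (n : nat) : R := ln (INR (fact n)) - ((INR n + / 2) * ln (INR n) - INR n).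

(** Euler's sequence for ln Gamma(y) splits into [stirling], which does not depend on y, and a part
    with a known limit. Hence one universal constant separates [dF] from ln Gamma. *)
Lemma log_Gamma_seq_stirling (tau y : R) : 0 < tau -> 0 < y ->
  is_lim_seq (fun n => log_Gamma_seq y n - stirling n) (dF tau (tau * y) - ln (2 * PI) / 2).
Proof.
  intros Ht Hy.
  assert (L1 := dF_asymptotic tau y Ht Hy).
  assert (H1 : 0 <= 1 + y) by lra.
  assert (L2 := lim_n_ln_1p (1 + y) H1).
  assert (L3 := is_lim_seq_mult' _ _ _ _ (is_lim_seq_const (y + / 2)) (lim_ln_1p (1 + y) H1)).
  assert (L := is_lim_seq_minus' _ _ _ _ (is_lim_seq_const (dF tau (tau * y) - ln (2 * PI) / 2 + (1 + y)))
    (is_lim_seq_plus' _ _ _ _ L1 (is_lim_seq_plus' _ _ _ _ L2 L3))).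
  replace (dF tau (tau * y) - ln (2 * PI) / 2 + (1 + y) - (0 + (1 + y + (y + / 2) * 0)))
    with (dF tau (tau * y) - ln (2 * PI) / 2) in L by ring.
  apply is_lim_seq_ext with (2 := L). intros n.
  unfold log_Gamma_seq, stirling. rewrite (log_sum_dF tau) by auto.
  replace (INR n + (1 + y)) with (y + INR n + 1) by ring. ring.
Qed.

Lemma log_sum_1 (n : nat) : log_sum 1 n = ln (INR (fact (S n))).
Proof.
  unfold log_sum. induction n as [|n IH].
  - simpl. f_equal. ring.
  - change (sum_f_R0 (fun k => ln (1 + INR k)) (S n))
      with (sum_f_R0 (fun k => ln (1 + INR k)) n + ln (1 + INR (S n))). rewrite IH, (fact_simpl (S n)), mult_INR.
    rewrite ln_mult; [|apply lt_0_INR; lia|apply INR_fact_lt_0].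
    rewrite (S_INR (S n)). rewrite (Rplus_comm 1). ring.
Qed.

Lemma log_Gamma_seq_1 : is_lim_seq (log_Gamma_seq 1) 0.
Proof.
  assert (L := proj1 (is_lim_seq_opp _ _) (lim_ln_1p 1 Rle_0_1)).
  simpl in L. rewrite Ropp_0 in L. apply is_lim_seq_incr_1. apply is_lim_seq_incr_1 in L.
  apply is_lim_seq_ext with (2 := L). intros n.
  unfold log_Gamma_seq. rewrite log_sum_1, (fact_simpl (S n)), mult_INR.
  rewrite ln_mult; [|apply lt_0_INR; lia|apply INR_fact_lt_0]. rewrite (S_INR (S n)). ring.
Qed.

Lemma Gamma_1 : Gamma (RtoC 1) = 1%C.
Proof. rewrite (Gamma_of_limit 1 0 Rlt_0_1 log_Gamma_seq_1), exp_0. reflexivity. Qed.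

(** Gamma(1) = 1 turns the case y = 1 into convergence of [stirling]. The limit still contains
    dF(tau), which [dF_tau] later shows to be 0. *)
Lemma stirling_limit (tau : R) : 0 < tau -> is_lim_seq stirling (ln (2 * PI) / 2 - dF tau tau).
Proof.
  intros Ht. assert (L := log_Gamma_seq_stirling tau 1 Ht Rlt_0_1).
  rewrite Rmult_1_r in L.
  assert (L2 := is_lim_seq_minus' _ _ _ _ log_Gamma_seq_1 L).
  replace (0 - (dF tau tau - ln (2 * PI) / 2)) with (ln (2 * PI) / 2 - dF tau tau) in L2 by ring.
  apply is_lim_seq_ext with (2 := L2). intros n. ring.
Qed.

(** The logarithm of (1/2) (3/2) ... (n + 1/2) = (2n + 1)! / (n! 2^(2n + 1)). *)
Lemma log_sum_half (n : nat) :
  log_sum (/ 2) n = ln (INR (fact (2 * n + 1))) - ln (INR (fact n)) - (2 * INR n + 1) * ln 2.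
Proof.
  unfold log_sum. induction n as [|n IH].
  - simpl. rewrite !Rplus_0_r, ln_1, ln_Rinv by lra. ring.
  - change (sum_f_R0 (fun k => ln (/ 2 + INR k)) (S n))
      with (sum_f_R0 (fun k => ln (/ 2 + INR k)) n + ln (/ 2 + INR (S n))). rewrite IH.
    replace (2 * S n + 1)%nat with (S (S (2 * n + 1))) by lia.
    rewrite (fact_simpl (S (2 * n + 1))), (fact_simpl (2 * n + 1)), (fact_simpl n), !mult_INR.
    assert (P0 := pos_INR n).
    assert (Pf := INR_fact_lt_0 (2 * n + 1)). assert (Pf2 := INR_fact_lt_0 n).
    assert (E1 : INR (S (S (2 * n + 1))) = 2 * (INR n + / 2 + 1)).
    { rewrite !S_INR, plus_INR, mult_INR. simpl. field. }
    assert (E2 : INR (S (2 * n + 1)) = 2 * INR (S n)).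
    { rewrite !S_INR, plus_INR, mult_INR. simpl. ring. }
    assert (PS : 0 < INR (S n)) by (apply lt_0_INR; lia).
    rewrite E1, E2. rewrite !ln_mult by (try apply Rmult_lt_0_compat; lra).
    replace (/ 2 + INR (S n)) with (INR n + / 2 + 1) by (rewrite S_INR; ring).
    rewrite S_INR. ring.
Qed.

(** The factorials combine to 2 stirling(n) - stirling(2n + 1), and both sequences tend to [sigma].
    This expresses ln Gamma(1/2) through the unknown constant. *)
Lemma log_Gamma_seq_half (sigma : R) : is_lim_seq stirling sigma ->
  is_lim_seq (log_Gamma_seq (/ 2)) (sigma - ln 2 / 2).
Proof.
  intros Hs.
  assert (Sub : filterlim (fun n => (2 * n + 1)%nat) eventually eventually).
  { intros P [N HN]. exists N. intros n Hn. apply HN. lia. }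
  assert (L1 := is_lim_seq_subseq stirling sigma _ Sub Hs).
  assert (H1 : 0 <= / 2) by lra.
  assert (L2 := is_lim_seq_mult' _ _ _ _ (is_lim_seq_const 2) (lim_n_ln_1p (/ 2) H1)).
  assert (L3 := is_lim_seq_mult' _ _ _ _ (is_lim_seq_const (3 / 2)) (lim_ln_1p (/ 2) H1)).
  assert (L := is_lim_seq_minus' _ _ _ _
    (is_lim_seq_minus' _ _ _ _ (is_lim_seq_mult' _ _ _ _ (is_lim_seq_const 2) Hs) L1)
    (is_lim_seq_minus' _ _ _ _ (is_lim_seq_plus' _ _ _ _ L2 L3) (is_lim_seq_const (1 - ln 2 / 2)))).
  replace (2 * sigma - sigma - (2 * / 2 + 3 / 2 * 0 - (1 - ln 2 / 2))) with (sigma - ln 2 / 2) in L by field.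
  apply is_lim_seq_ext with (2 := L). intros n.
  unfold log_Gamma_seq, stirling. rewrite log_sum_half.
  assert (P0 := pos_INR n).
  replace (INR (2 * n + 1)) with (2 * (INR n + / 2)) by (rewrite plus_INR, mult_INR; simpl; field).
  rewrite (ln_mult 2) by lra. field.
Qed.

Lemma Rcpow_real (x s : R) : Rcpow x (RtoC s) = RtoC (exp (s * ln x)).
Proof. unfold Rcpow. rewrite <- RtoC_mult. apply Cexp_RtoC. Qed.

Lemma not_Gamma_pole (x : R) : 0 < x -> ~ Gamma_pole (RtoC x).
Proof.
  intros Hx [n E]. apply (f_equal Re) in E. rewrite !Re_RtoC in E. assert (T := pos_INR n). lra.
Qed.

(* For [tau = 2] the shift by [tau] is a double shift by 1, so the two functional equations
   together give [Gamma (1/2)], and with it Stirling's constant. *)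
Lemma stirling_constant (G L : C -> C) :
  is_barnes_double_gamma 2 G -> is_real_log_branch G L -> is_lim_seq stirling (ln (2 * PI) / 2).
Proof.
  intros [_ [c1 [c2 [_ [H1 H2]]]]] [HL _].
  assert (Hs := stirling_limit 2 Rlt_0_2). set (sigma := ln (2 * PI) / 2 - dF 2 2) in *.
  assert (E12 : (RtoC 1 / RtoC 2)%C = RtoC (/ 2)).
  { rewrite <- RtoC_div by lra. f_equal. field. }
  assert (E22 : (RtoC 2 / RtoC 2)%C = RtoC 1).
  { rewrite <- RtoC_div by lra. f_equal. field. }
  (* G(3) is computed twice: as Gamma(1) Gamma(1/2) G(1) by two unit shifts, and as (2 PI)^(1/2)
     2^(-1/2) Gamma(1) G(1) by one shift by 2. Comparison gives [sigma] - ln 2 / 2 = ln (2 PI) / 2 -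
     ln 2 / 2. *)
  assert (A1 := H1 (RtoC 1)). rewrite E12 in A1.
  specialize (A1 (not_Gamma_pole (/ 2) ltac:(lra))).
  assert (A2 := H1 (RtoC 2)). rewrite E22 in A2.
  specialize (A2 (not_Gamma_pole 1 ltac:(lra))).
  assert (A3 := H2 (RtoC 1) (not_Gamma_pole 1 ltac:(lra))).
  rewrite <- !RtoC_plus in *. rewrite <- RtoC_minus in A3.
  replace (1 + 1) with 2 in A1 by ring. replace (2 + 1) with 3 in A2 by ring.
  replace (1 + 2) with 3 in A3 by ring.
  rewrite A2, A1, Gamma_1 in A3.
  rewrite (Gamma_of_limit (/ 2) (sigma - ln 2 / 2)) in A3; [|lra|apply log_Gamma_seq_half; auto].
  rewrite Rcpow_real in A3. unfold Rpower in A3.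
  assert (NG : G (RtoC 1) <> 0%C).
  { rewrite <- (proj2 (HL (RtoC 1) Rlt_0_1)). apply Cexp_neq_0. }
  assert (A4 : RtoC (exp (sigma - ln 2 / 2)) = RtoC (exp ((2 - 1) / 2 * ln (2 * PI)) * exp ((1 / 2 - 1) * ln 2))).
  { rewrite RtoC_mult.
    replace (RtoC (exp (sigma - ln 2 / 2))) with (1 * (RtoC (exp (sigma - ln 2 / 2)) * G (RtoC 1)) / G (RtoC 1))%C by (field; auto).
    rewrite A3. field. auto. }
  apply RtoC_inj in A4. rewrite <- exp_plus in A4. apply exp_inv in A4.
  replace (ln (2 * PI) / 2) with sigma by lra. auto.
Qed.

Lemma Gamma_dF (tau x : R) : is_lim_seq stirling (ln (2 * PI) / 2) -> 0 < tau -> 0 < x ->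
  Gamma (RtoC x / RtoC tau)%C = RtoC (exp (dF tau x)).
Proof.
  intros Hs Ht Hx. rewrite <- RtoC_div by lra.
  assert (P : 0 < x / tau) by (apply Rdiv_lt_0_compat; lra).
  apply Gamma_of_limit; auto.
  assert (L := is_lim_seq_plus' _ _ _ _ (log_Gamma_seq_stirling tau (x / tau) Ht P) Hs).
  replace (tau * (x / tau)) with x in L by (field; lra).
  replace (dF tau x - ln (2 * PI) / 2 + ln (2 * PI) / 2) with (dF tau x) in L by ring.
  apply is_lim_seq_ext with (2 := L). intros n. ring.
Qed.

Lemma dF_tau (tau : R) : is_lim_seq stirling (ln (2 * PI) / 2) -> 0 < tau -> dF tau tau = 0.
Proof.
  intros Hs Ht. assert (L := stirling_limit tau Ht).
  apply is_lim_seq_unique in L. apply is_lim_seq_unique in Hs. rewrite Hs in L.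
  inversion L. lra.
Qed.

(** F satisfies the logarithm of the first functional equation exactly, by [Gamma_dF]. So the
    quadratic correction has zero unit difference, b + c (2x + 1) = 0 for every x > 0, and two
    values of x give b = c = 0. *)
Lemma log_barnes_const (tau : R) (G L : C -> C) :
  is_lim_seq stirling (ln (2 * PI) / 2) ->
  0 < tau -> is_barnes_double_gamma tau G -> is_real_log_branch G L ->
  exists a : R, forall z, 0 < Re z -> L z = (Ff tau z + RtoC a)%C.
Proof.
  intros Hs Ht HG HL.
  destruct (log_barnes_quadratic tau G L Ht HG HL) as [a [b [c E]]].
  destruct HG as [_ [c1 [c2 [_ [H1 _]]]]].
  assert (K : forall x, 0 < x -> b + c * (2 * x + 1) = 0).
  { intros x Hx.
    assert (Px : 0 < x / tau) by (apply Rdiv_lt_0_compat; lra).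
    assert (A := H1 (RtoC x)). rewrite (Gamma_dF tau x Hs Ht Hx), <- RtoC_plus in A.
    rewrite <- RtoC_div in A by lra. specialize (A (not_Gamma_pole _ Px)).
    assert (Hx1 : 0 < x + 1) by lra.
    rewrite <- (proj2 (proj1 HL (RtoC x) Hx)), <- (proj2 (proj1 HL (RtoC (x + 1)) Hx1)) in A.
    rewrite (E (RtoC x) Hx), (E (RtoC (x + 1)) Hx1), !Ff_RtoC in A by auto.
    rewrite <- !RtoC_pow, <- !RtoC_mult, <- !RtoC_plus, !Cexp_RtoC, <- RtoC_mult, <- exp_plus in A.
    apply RtoC_inj, exp_inv in A. unfold dF in A. lra. }
  assert (K1 := K 1 Rlt_0_1). assert (K2 := K 2 Rlt_0_2).
  assert (c = 0) by lra. assert (b = 0) by lra. subst b c.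
  exists a. intros z Hz. rewrite E by auto. ring.
Qed.

(** Meant for v the inverse of a lattice point: every logarithmic factor at x is nonnegative and at
    most x times its value at 1. The partial products at small x are thereby controlled by those at
    1, which are bounded because they converge. *)
Lemma barnes_log_term (x v : R) : 0 <= x <= 1 -> 0 <= v ->
  0 <= ln (1 + x * v) - x * v + (x * v) ^ 2 / 2 <= x * (ln (1 + v) - v + v ^ 2 / 2).
Proof.
  intros Hx Hv.
  assert (M : forall (k k' : R -> R), (forall u, 0 <= u -> is_derive k u (k' u)) ->
     (forall u, 0 <= u -> 0 <= k' u) -> k 0 = 0 -> forall u, 0 <= u -> 0 <= k u).
  { intros k k' D P0 E u Hu.
    destruct (MVT_gen k 0 u k') as [c [Hc Ec]].
    - intros t Ht. apply D. rewrite Rmin_left in Ht; lra.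
    - intros t Ht. rewrite Rmin_left in Ht by lra. apply derivable_continuous_pt.
      eexists. apply is_derive_Reals, D. lra.
    - rewrite Rmin_left in Hc by lra. assert (T := P0 c). nra. }
  split.
  - apply (M (fun u => ln (1 + u) - u + u ^ 2 / 2) (fun u => u ^ 2 / (1 + u))).
    + intros u Hu. auto_derive; [lra|]. field. lra.
    + intros u Hu. apply Rdiv_le_0_compat; [apply pow2_ge_0|lra].
    + rewrite Rplus_0_r, ln_1. field.
    + nra.
  - assert (H := M (fun v => x * (ln (1 + v) - v + v ^ 2 / 2) - (ln (1 + x * v) - x * v + (x * v) ^ 2 / 2))
       (fun v => x * v ^ 2 * ((1 + x * v - x ^ 2 * (1 + v)) / ((1 + v) * (1 + x * v))))).
    assert (R : 0 <= x * (ln (1 + v) - v + v ^ 2 / 2) - (ln (1 + x * v) - x * v + (x * v) ^ 2 / 2)); [|lra].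
    apply H; auto.
    + intros u Hu. assert (0 <= x * u) by nra. auto_derive; [repeat split; lra|]. field. lra.
    (* The numerator is (1 - x^2) + u (x - x^2), nonnegative for x in [0, 1]. *)
    + intros u Hu. assert (0 <= x * u) by nra. assert (x * x <= x) by nra. assert (0 <= u * (x - x * x)) by nra.
      apply Rmult_le_pos; [apply Rmult_le_pos; [lra|apply pow2_ge_0]|].
      apply Rdiv_le_0_compat; [nra|]. apply Rmult_lt_0_compat; lra.
    + rewrite !Rmult_0_r, Rplus_0_r, ln_1. field.
Qed.

Definition factor_log (tau x : R) (kl : nat * nat) : R :=
  ln (1 + x * / lattice tau kl) - x * / lattice tau kl + (x * / lattice tau kl) ^ 2 / 2.

Definition Rsum {I : Type} (f : I -> R) (s : list I) : R := fold_right Rplus 0 (map f s).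

Lemma Cprod_barnes_real (tau x : R) (s : list (nat * nat)) : 0 < tau -> 0 <= x ->
  (forall kl, In kl s -> kl <> (0%nat, 0%nat)) ->
  Cprod (barnes_factor tau (RtoC x)) s = RtoC (exp (Rsum (factor_log tau x) s)).
Proof.
  intros Ht Hx. unfold Cprod, Rsum. induction s as [|kl s IH]; intros H; simpl.
  - rewrite exp_0. reflexivity.
  - rewrite IH by (intros; apply H; simpl; auto).
    assert (Pw := lattice_pos tau kl Ht (H kl (or_introl eq_refl))).
    rewrite exp_plus, RtoC_mult. f_equal.
    unfold barnes_factor, factor_log. fold (lattice tau kl). set (w := lattice tau kl) in *.
    assert (0 < / w) by (apply Rinv_0_lt_compat; auto). assert (0 <= x * / w) by nra.
    unfold Rminus. rewrite Rplus_assoc, exp_plus, exp_ln by lra.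
    rewrite RtoC_mult, <- Cexp_RtoC, !RtoC_plus, RtoC_opp, RtoC_mult, RtoC_inv by lra.
    f_equal. f_equal.
    unfold Rdiv. rewrite RtoC_mult, RtoC_pow, RtoC_mult, !RtoC_inv by lra.
    field. apply RtoC_neq_0; lra.
Qed.

(** A bound M on the partial products at 1 bounds the sums of logarithms at x by x ln M, hence k =
    ln M. The consequence is P(x) -> 1 as x -> 0+, with no estimate of the lattice sum itself. *)
Lemma barnes_product_near_0 (tau : R) (P : C -> C) : 0 < tau ->
  (forall x, 0 < x -> is_unordered_prod (fun kl => kl <> (0%nat, 0%nat)) (barnes_factor tau (RtoC x)) (P (RtoC x))) ->
  exists k, forall x, 0 < x <= 1 -> Cmod (P (RtoC x) - 1) <= exp (k * x) - 1.
Proof.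
  intros Ht H.
  assert (L : forall x, 0 < x -> Clim (fun N => RtoC (exp (Rsum (factor_log tau x) (tl (square N))))) (P (RtoC x))).
  { intros x Hx. eapply Clim_ext; [|apply unordered_prod_squares, H; auto].
    intros N. apply Cprod_barnes_real; auto; [lra|]. apply square_not_0. }
  destruct (Clim_bounded _ _ (L 1 Rlt_0_1)) as [M [HM B]].
  exists (ln M). intros x Hx.
  apply (Clim_Cmod_le _ _ _ _ 0 (L x (proj1 Hx))). intros N _.
  set (s := tl (square N)).
  assert (Hs : forall kl, In kl s -> kl <> (0%nat, 0%nat)) by apply square_not_0.
  assert (K : 0 <= Rsum (factor_log tau x) s <= x * Rsum (factor_log tau 1) s).
  { clearbody s. unfold Rsum. induction s as [|kl s IH]; simpl; [lra|].
    assert (Pw := lattice_pos tau kl Ht (Hs kl (or_introl eq_refl))).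
    assert (Pi : 0 < / lattice tau kl) by (apply Rinv_0_lt_compat; auto).
    assert (T := barnes_log_term x (/ lattice tau kl) ltac:(lra) (Rlt_le _ _ Pi)).
    assert (IH' := IH (fun kl h => Hs kl (or_intror h))).
    assert (E1 : factor_log tau 1 kl = ln (1 + / lattice tau kl) - / lattice tau kl + (/ lattice tau kl) ^ 2 / 2)
      by (unfold factor_log; rewrite Rmult_1_l; ring).
    rewrite <- E1 in T. fold (factor_log tau x kl) in T. lra. }
  assert (B1 := B N). fold s in B1. rewrite Cmod_R, Rabs_right in B1 by (apply Rle_ge; left; apply exp_pos).
  assert (B2 : Rsum (factor_log tau 1) s <= ln M).
  { rewrite <- (ln_exp (Rsum _ _)). apply ln_le; [apply exp_pos|auto]. }
  rewrite <- RtoC_minus, Cmod_R. rewrite Rabs_right.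
  - assert (exp (Rsum (factor_log tau x) s) <= exp (ln M * x)) by (apply exp_le; nra). lra.
  - assert (T := exp_ineq1_le (Rsum (factor_log tau x) s)). lra.
Qed.

Lemma Rf_continuous (tau x : R) : 0 < tau -> 0 < x -> continuous (Rf tau) x.
Proof.
  intros Ht Hx.
  assert (D := hder_Ff tau Ht (RtoC 0) x).
  replace (RtoC 0 + RtoC x * 1)%C with (RtoC x) in D by ring.
  destruct (D Hx) as [D1 _].
  apply continuous_ext with (fun s => Re (Ff tau (RtoC 0 + RtoC s * 1)%C)).
  - intros s. unfold Rf. replace (RtoC 0 + RtoC s * 1)%C with (RtoC s) by ring. reflexivity.
  - apply (ex_derive_continuous (fun s => Re (Ff tau (RtoC 0 + RtoC s * 1)%C))). eexists; exact D1.
Qed.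

(* [G 1 = 1] is read off from [G (z + 1) = Gamma (z / tau) G z] and [G z ~ z / tau] as [z -> 0+]. *)
Lemma log_barnes_eq (tau : R) (G L : C -> C) :
  is_lim_seq stirling (ln (2 * PI) / 2) ->
  0 < tau -> is_barnes_double_gamma tau G -> is_real_log_branch G L ->
  forall z, 0 < Re z -> L z = (Ff tau z + RtoC (- Rf tau 1))%C.
Proof.
  intros Hs Ht HG HL.
  destruct (log_barnes_const tau G L Hs Ht HG HL) as [a E].
  destruct HG as [_ [c1 [c2 [HP [H1 _]]]]].
  set (e := fun z => Cexp (RtoC c1 * z / RtoC tau + RtoC c2 * z ^ 2 / (2 * RtoC tau ^ 2))).
  (* The hypothesis provides the value of the product separately for each z; dividing G by its
     prefactor names all these values by one function. *)
  set (P := fun z => (G z * RtoC tau / (z * e z))%C).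
  assert (NT : RtoC tau <> 0%C) by (apply RtoC_neq_0; lra).
  assert (HPe : forall x, 0 < x -> G (RtoC x) = (RtoC x / RtoC tau * e (RtoC x) * P (RtoC x))%C).
  { intros x Hx. unfold P. field. repeat split; auto; [apply Cexp_neq_0|apply RtoC_neq_0; lra]. }
  assert (HPc : forall x, 0 < x ->
    is_unordered_prod (fun kl => kl <> (0%nat, 0%nat)) (barnes_factor tau (RtoC x)) (P (RtoC x))).
  { intros x Hx. destruct (HP (RtoC x)) as [p [Hp Ep]].
    replace (P (RtoC x)) with p; auto. unfold P. rewrite Ep. fold (e (RtoC x)). field.
    repeat split; auto; [apply Cexp_neq_0|apply RtoC_neq_0; lra]. }
  destruct (barnes_product_near_0 tau P Ht HPc) as [k Hk].
  assert (Ea : a = - Rf tau 1); [|rewrite <- Ea; exact E].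
  set (x := fun n => / INR (S n)).
  assert (Px : forall n, 0 < x n <= 1).
  { intros n. unfold x. assert (T : 1 <= INR (S n)) by (rewrite S_INR; assert (T := pos_INR n); lra).
    split; [apply Rinv_0_lt_compat; lra|]. rewrite <- Rinv_1. apply Rinv_le_contravar; lra. }
  assert (Lx : is_lim_seq x 0) by (apply (is_lim_seq_incr_1 (fun n => / INR n)), is_lim_seq_inv_INR).
  assert (Hx : forall y, 0 < y -> is_lim_seq (fun n => Rf tau (y + x n)) (Rf tau y)).
  { intros y Hy. apply is_lim_seq_continuous; [apply continuity_pt_filterlim, Rf_continuous; auto|].
    replace (Finite y) with (Finite (y + 0)) by (f_equal; ring).
    apply is_lim_seq_plus'; [apply is_lim_seq_const|auto]. }
  assert (Hd : is_lim_seq (fun n => dF tau (x n + tau)) 0).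
  { assert (L1 := is_lim_seq_minus' _ _ _ _ (Hx (tau + 1) ltac:(lra)) (Hx tau Ht)).
    change (Rf tau (tau + 1) - Rf tau tau) with (dF tau tau) in L1. rewrite dF_tau in L1 by auto.
    apply is_lim_seq_ext with (2 := L1). intros n. unfold dF. f_equal; f_equal; ring. }
  set (q := fun n => c1 * x n / tau + c2 * x n ^ 2 / (2 * tau ^ 2)).
  assert (Lq : is_lim_seq q 0).
  { replace 0 with (c1 * 0 * / tau + c2 * (0 * 0) * / (2 * tau ^ 2)) by ring.
    apply is_lim_seq_ext with (fun n => c1 * x n * / tau + c2 * (x n * x n) * / (2 * tau ^ 2)).
    { intros n. unfold q. unfold Rdiv. simpl. ring. }
    apply is_lim_seq_plus'; (apply is_lim_seq_mult'; [apply is_lim_seq_mult'; [apply is_lim_seq_const|]|apply is_lim_seq_const]); auto.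
    apply is_lim_seq_mult'; auto. }
  assert (LP : Clim (fun n => P (RtoC (x n))) 1%C).
  { apply Clim_le_0 with (N := 0%nat) (v := fun n => exp (k * x n) - 1).
    - intros n _. apply Hk. specialize (Px n). lra.
    - replace 0 with (exp (k * 0) - 1) by (rewrite Rmult_0_r, exp_0; ring).
      apply is_lim_seq_minus'; [|apply is_lim_seq_const].
      apply (is_lim_seq_continuous exp); [apply derivable_continuous_pt, derivable_pt_exp|].
      apply is_lim_seq_mult'; [apply is_lim_seq_const|auto]. }
  (* Two limits of G(1 + x) as x -> 0+: from ln G = F + a it is exp (F(1) + a), and from the
     functional equation, in [L2], it is 1. *)
  assert (L1 : Clim (fun n => G (RtoC (1 + x n))) (Cexp (RtoC (Rf tau 1 + a)))).
  { apply Clim_ext with (fun n => Cexp (RtoC (Rf tau (1 + x n) + a))).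
    - intros n. specialize (Px n). assert (H : 0 < 1 + x n) by lra.
      rewrite <- (proj2 (proj1 HL (RtoC (1 + x n)) H)), (E (RtoC (1 + x n)) H), Ff_RtoC, RtoC_plus by auto.
      reflexivity.
    - apply Clim_Cexp, Clim_RtoC, is_lim_seq_plus'; [apply Hx; lra|apply is_lim_seq_const]. }
  assert (L2 : Clim (fun n => G (RtoC (1 + x n))) (Cexp (RtoC (0 + 0)) * 1)%C).
  { apply Clim_ext with (fun n => Cexp (RtoC (dF tau (x n + tau) + q n)) * P (RtoC (x n)))%C.
    - intros n. destruct (Px n) as [Pn _].
      assert (A := H1 (RtoC (x n))). rewrite (Gamma_dF tau (x n) Hs Ht Pn), <- RtoC_plus in A.
      rewrite <- RtoC_div in A by lra.
      specialize (A (not_Gamma_pole _ (Rdiv_lt_0_compat _ _ Pn Ht))).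
      rewrite (Rplus_comm 1), A, (HPe (x n) Pn). unfold e.
      assert (S := dF_step tau (x n) Ht Pn).
      (* The pole of Gamma(x / tau) at 0 is absorbed by the factor x / tau of G: dF(x) + ln (x /
         tau) = dF(x + tau), which tends to dF(tau) = 0. *)
      replace (dF tau (x n + tau)) with (dF tau (x n) + (ln (x n) - ln tau)) by lra.
      replace (RtoC c1 * RtoC (x n) / RtoC tau + RtoC c2 * RtoC (x n) ^ 2 / (2 * RtoC tau ^ 2))%C
        with (RtoC (q n)).
      + rewrite !Cexp_RtoC. unfold Rminus.
        rewrite !exp_plus, exp_Ropp, !exp_ln, !RtoC_mult, RtoC_inv by lra. unfold Cdiv. ring.
      + unfold q. rewrite RtoC_plus, !RtoC_div, !RtoC_mult, !RtoC_pow by nra. reflexivity.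
    - apply Clim_mult; auto. apply Clim_Cexp, Clim_RtoC, is_lim_seq_plus'; auto. }
  assert (U := Clim_unique _ _ _ L1 L2).
  rewrite Cmult_1_r, !Cexp_RtoC in U. apply RtoC_inj, exp_inv in U. lra.
Qed.

(** * The double Bernoulli polynomial *)

Definition exp_coef (n : nat) : C := RtoC (/ INR (fact n)).

Lemma Cder_pow (w : C) (n : nat) (t : R) :
  Cder (fun s => (RtoC s * w) ^ S n)%C t (RtoC (INR (S n)) * (w * (RtoC t * w) ^ n))%C.
Proof.
  induction n as [|n IH].
  - apply Cder_ext with (fun s => 0 + RtoC s * w)%C; [intros; simpl; ring|].
    eapply Cder_value; [apply Cder_line|]. simpl. ring.
  - apply Cder_ext with (fun s => (0 + RtoC s * w) * (RtoC s * w) ^ S n)%C; [intros; simpl; ring|].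
    eapply Cder_value; [apply Cder_mult; [apply Cder_line|apply IH]|].
    rewrite (S_INR (S n)), RtoC_plus. simpl Cpow. ring.
Qed.

Lemma Cder_psum_exp (w : C) (n : nat) (t : R) :
  Cder (fun s => psum exp_coef (RtoC s * w) (S n)) t (w * psum exp_coef (RtoC t * w) n)%C.
Proof.
  induction n as [|n IH].
  - apply Cder_ext with (fun _ => exp_coef 0); [intros; simpl; ring|].
    eapply Cder_value; [apply Cder_const|]. simpl. ring.
  - apply Cder_ext with (fun s => psum exp_coef (RtoC s * w) (S n) + exp_coef (S n) * (RtoC s * w) ^ S n)%C; [reflexivity|].
    eapply Cder_value; [apply Cder_plus; [apply IH|apply Cder_scal, Cder_pow]|].
    change (psum exp_coef (RtoC t * w) (S n)) with (psum exp_coef (RtoC t * w) n + exp_coef n * (RtoC t * w) ^ n)%C.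
    replace (exp_coef n) with (exp_coef (S n) * RtoC (INR (S n)))%C; [ring|].
    unfold exp_coef. rewrite <- RtoC_mult. f_equal.
    rewrite fact_simpl, mult_INR. field. split; [apply INR_fact_neq_0|apply not_0_INR; lia].
Qed.

(** Along s -> s w the derivative of the remainder of order n + 1 is w times the remainder of order
    n, so [Cder_le] carries the induction. *)
Lemma Cexp_taylor (n : nat) : forall w,
  Cmod (Cexp w - psum exp_coef w n) <= Cmod w ^ n / INR (fact n) * exp (Cmod w).
Proof.
  induction n as [|n IH]; intros w.
  - simpl. replace (Cexp w - 0)%C with (Cexp w) by ring. rewrite Cmod_Cexp.
    assert (exp (Re w) <= exp (Cmod w)).
    { apply exp_le. eapply Rle_trans; [apply Rle_abs|apply re_le_Cmod]. }
    lra.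
  - set (f := fun s => (Cexp (0 + RtoC s * w) - psum exp_coef (RtoC s * w) (S n))%C).
    set (K := Cmod w ^ S n / INR (fact (S n)) * exp (Cmod w)).
    assert (Pf := INR_fact_lt_0 n). assert (Pf' := INR_fact_lt_0 (S n)).
    assert (PS : 0 < INR (S n)) by (apply lt_0_INR; lia).
    assert (H := Cder_le f (fun s => w * (Cexp (0 + RtoC s * w) - psum exp_coef (RtoC s * w) n))%C
      (fun s => s ^ S n * K) (fun s => INR (S n) * s ^ n * K) 0 1 Rle_0_1).
    replace (f 1 - f 0)%C with (Cexp w - psum exp_coef w (S n))%C in H.
    + rewrite pow1, pow_i in H by lia. eapply Rle_trans; [apply H|lra].
      * intros t _. unfold f. eapply Cder_value.
        -- apply Cder_minus; [apply Cder_Cexp, Cder_line|apply Cder_psum_exp].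
        -- cbv beta. ring.
      * intros t _. auto_derive; auto.
        change (match n with 0%nat => 1 | S _ => INR n + 1 end) with (INR (S n)). simpl. ring.
      * intros t Ht. rewrite Cmod_mult.
        replace (0 + RtoC t * w)%C with (RtoC t * w)%C by ring.
        assert (B := IH (RtoC t * w)%C). rewrite Cmod_mult, Cmod_R, Rabs_right in B by lra.
        assert (T := Cmod_ge_0 w).
        apply Rle_trans with (Cmod w * ((t * Cmod w) ^ n / INR (fact n) * exp (Cmod w))).
        -- apply Rmult_le_compat_l; auto. eapply Rle_trans; [apply B|].
           apply Rmult_le_compat_l; [|apply exp_le; nra].
           apply Rdiv_le_0_compat; [apply pow_le; nra|auto].
        -- right. unfold K. rewrite Rpow_mult_distr, fact_simpl, mult_INR. simpl pow. field. lra.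
    + unfold f. replace (0 + RtoC 1 * w)%C with w by ring. replace (RtoC 1 * w)%C with w by ring.
      replace (0 + RtoC 0 * w)%C with (RtoC 0) by ring. replace (RtoC 0 * w)%C with (RtoC 0) by ring.
      rewrite Cexp_0.
      assert (E : psum exp_coef 0 (S n) = 1%C); [|rewrite E; ring].
      { clear. induction n as [|n IH]; [simpl; unfold exp_coef; simpl; rewrite Rinv_1; ring|].
        change (psum exp_coef 0 (S (S n))) with (psum exp_coef 0 (S n) + exp_coef (S n) * 0 ^ S n)%C.
        rewrite IH. simpl. ring. }
Qed.

Lemma Cexp_psum (w : C) : Clim (psum exp_coef w) (Cexp w).
Proof.
  apply Clim_le_0 with (N := 0%nat) (v := fun n => Cmod w ^ n / INR (fact n) * exp (Cmod w)).
  - intros n _. rewrite Cmod_minus_sym. apply Cexp_taylor.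
  - replace 0 with (0 * exp (Cmod w)) by ring.
    apply is_lim_seq_mult'; [|apply is_lim_seq_const].
    apply is_lim_seq_Reals. apply cv_speed_pow_fact.
Qed.

(** A quadratic expansion as t -> 0+ along real t. It determines its coefficients and can be
    multiplied, which is all that reading off B_{2,2} takes. *)
Definition expansion2 (f : R -> C) (a b c : C) : Prop :=
  exists K r, 0 < r <= 1 /\ 0 <= K /\ forall t, 0 < t < r ->
    Cmod (f t - (a + b * RtoC t + c * RtoC (t ^ 2))) <= K * t ^ 3.

Lemma expansion2_mult (f g : R -> C) (a b c a' b' c' : C) :
  expansion2 f a b c -> expansion2 g a' b' c' ->
  expansion2 (fun t => f t * g t)%C (a * a') (a * b' + b * a') (a * c' + b * b' + c * a').
Proof.
  intros [K [r [Hr [HK H]]]] [K' [r' [Hr' [HK' H']]]].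
  set (M := Cmod a + Cmod b + Cmod c). set (M' := Cmod a' + Cmod b' + Cmod c').
  assert (Pa := Cmod_ge_0 a). assert (Pb := Cmod_ge_0 b). assert (Pc := Cmod_ge_0 c).
  assert (Pa' := Cmod_ge_0 a'). assert (Pb' := Cmod_ge_0 b'). assert (Pc' := Cmod_ge_0 c').
  set (N := Cmod (b * c' + c * b') + Cmod (c * c')).
  assert (PN : 0 <= N) by (unfold N; assert (T1 := Cmod_ge_0 (b * c' + c * b')); assert (T2 := Cmod_ge_0 (c * c')); lra).
  exists (K * K' + K * M' + M * K' + N), (Rmin r r').
  split; [split; [apply Rmin_pos; lra|eapply Rle_trans; [apply Rmin_l|lra]]|].
  split; [unfold M, M'; nra|].
  intros t Ht.
  assert (Ht1 : 0 < t < r) by (split; [lra|eapply Rlt_le_trans; [apply Ht|apply Rmin_l]]).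
  assert (Ht2 : 0 < t < r') by (split; [lra|eapply Rlt_le_trans; [apply Ht|apply Rmin_r]]).
  specialize (H t Ht1). specialize (H' t Ht2).
  assert (Bd : forall x y z : C, Cmod (x + y * RtoC t + z * RtoC (t ^ 2)) <= Cmod x + Cmod y + Cmod z).
  { intros x y z. eapply Rle_trans; [apply Cmod_triangle|]. apply Rplus_le_compat.
    - eapply Rle_trans; [apply Cmod_triangle|]. apply Rplus_le_compat_l.
      rewrite Cmod_mult, Cmod_R, Rabs_right by lra. assert (T := Cmod_ge_0 y). nra.
    - rewrite Cmod_mult, Cmod_R, Rabs_right by (apply Rle_ge, pow2_ge_0). assert (T := Cmod_ge_0 z).
      assert (t ^ 2 <= 1) by nra. nra. }
  set (p := (a + b * RtoC t + c * RtoC (t ^ 2))%C) in *.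
  set (q := (a' + b' * RtoC t + c' * RtoC (t ^ 2))%C) in *.
  assert (Bp : Cmod p <= M) by apply Bd. assert (Bq : Cmod q <= M') by apply Bd.
  replace (f t * g t - (a * a' + (a * b' + b * a') * RtoC t + (a * c' + b * b' + c * a') * RtoC (t ^ 2)))%C
    with ((f t - p) * (g t - q) + (f t - p) * q + p * (g t - q)
          + RtoC (t ^ 3) * ((b * c' + c * b') + c * c' * RtoC t))%C
    by (unfold p, q; rewrite !RtoC_pow; ring).
  assert (P3 : 0 < t ^ 3) by (apply pow_lt; lra).
  assert (L3 : t ^ 3 <= 1) by (assert (t ^ 2 <= 1) by nra; simpl in *; nra).
  assert (U1 := Cmod_ge_0 (f t - p)). assert (U2 := Cmod_ge_0 (g t - q)).
  assert (U3 := Cmod_ge_0 p). assert (U4 := Cmod_ge_0 q).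
  assert (T1 : Cmod ((f t - p) * (g t - q)) <= K * K' * t ^ 3).
  { rewrite Cmod_mult. apply Rle_trans with (K * t ^ 3 * (K' * t ^ 3)); [apply Rmult_le_compat; auto|].
    replace (K * t ^ 3 * (K' * t ^ 3)) with (K * K' * t ^ 3 * t ^ 3) by ring.
    assert (0 <= K * K' * t ^ 3) by (apply Rmult_le_pos; nra). nra. }
  assert (T2 : Cmod ((f t - p) * q) <= K * M' * t ^ 3).
  { rewrite Cmod_mult. replace (K * M' * t ^ 3) with (K * t ^ 3 * M') by ring. apply Rmult_le_compat; auto. }
  assert (T3 : Cmod (p * (g t - q)) <= M * K' * t ^ 3).
  { rewrite Cmod_mult. replace (M * K' * t ^ 3) with (M * (K' * t ^ 3)) by ring. apply Rmult_le_compat; auto. }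
  assert (T4 : Cmod (RtoC (t ^ 3) * ((b * c' + c * b') + c * c' * RtoC t)) <= N * t ^ 3).
  { rewrite Cmod_mult, Cmod_R, Rabs_right, Rmult_comm by lra. apply Rmult_le_compat_r; [lra|].
    eapply Rle_trans; [apply Cmod_triangle|]. unfold N. apply Rplus_le_compat_l.
    rewrite Cmod_mult, Cmod_R, Rabs_right by lra. assert (T := Cmod_ge_0 (c * c')). nra. }
  eapply Rle_trans; [apply Cmod_triangle|].
  assert (T5 := Cmod_triangle ((f t - p) * (g t - q) + (f t - p) * q) (p * (g t - q))).
  assert (T6 := Cmod_triangle ((f t - p) * (g t - q)) ((f t - p) * q)). lra.
Qed.

Lemma Cmod_le_linear_0 (a : C) (K r : R) : 0 < r -> 0 <= K -> (forall t, 0 < t < r -> Cmod a <= K * t) -> a = 0%C.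
Proof.
  intros Hr HK H. apply Cmod_eq_0. apply Rle_antisym; [|apply Cmod_ge_0].
  apply Rnot_lt_le. intros P.
  set (t := Rmin (r / 2) (Cmod a / (2 * (K + 1)))).
  assert (Pt : 0 < t) by (apply Rmin_pos; [lra|apply Rdiv_lt_0_compat; lra]).
  assert (t <= r / 2) by apply Rmin_l.
  assert (T : t <= Cmod a / (2 * (K + 1))) by apply Rmin_r.
  specialize (H t ltac:(lra)).
  assert (K * t <= (K + 1) * (Cmod a / (2 * (K + 1)))) by (apply Rmult_le_compat; lra).
  replace ((K + 1) * (Cmod a / (2 * (K + 1)))) with (Cmod a / 2) in H1 by (field; lra). lra.
Qed.

Lemma expansion2_unique (f : R -> C) (a b c a' b' c' : C) :
  expansion2 f a b c -> expansion2 f a' b' c' -> a = a' /\ b = b' /\ c = c'.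
Proof.
  intros [K [r [Hr [HK H]]]] [K' [r' [Hr' [HK' H']]]].
  set (x := (a - a')%C). set (y := (b - b')%C). set (z := (c - c')%C).
  set (s := Rmin r r'). set (L := K + K').
  assert (Ps : 0 < s) by (apply Rmin_pos; lra). assert (Ls : s <= 1) by (eapply Rle_trans; [apply Rmin_l|lra]).
  assert (D : forall t, 0 < t < s -> Cmod (x + y * RtoC t + z * RtoC (t ^ 2)) <= L * t ^ 3).
  { intros t Ht.
    assert (Ht1 : 0 < t < r) by (split; [lra|eapply Rlt_le_trans; [apply Ht|apply Rmin_l]]).
    assert (Ht2 : 0 < t < r') by (split; [lra|eapply Rlt_le_trans; [apply Ht|apply Rmin_r]]).
    specialize (H t Ht1). specialize (H' t Ht2).
    replace (x + y * RtoC t + z * RtoC (t ^ 2))%C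
      with ((f t - (a' + b' * RtoC t + c' * RtoC (t ^ 2))) - (f t - (a + b * RtoC t + c * RtoC (t ^ 2))))%C
      by (unfold x, y, z; ring).
    eapply Rle_trans; [apply Cmod_triangle|]. rewrite Cmod_opp. unfold L. lra. }
  assert (Py := Cmod_ge_0 y). assert (Pz := Cmod_ge_0 z).
  assert (PL : 0 <= L) by (unfold L; lra).
  assert (X0 : x = 0%C).
  { apply (Cmod_le_linear_0 x (L + Cmod y + Cmod z) s); [lra|lra|]. intros t Ht. specialize (D t Ht).
    replace x with ((x + y * RtoC t + z * RtoC (t ^ 2)) - RtoC t * (y + z * RtoC t))%C by (rewrite RtoC_pow; ring).
    eapply Rle_trans; [apply Cmod_triangle|]. rewrite Cmod_opp, Cmod_mult, Cmod_R, Rabs_right by lra.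
    assert (T := Cmod_triangle y (z * RtoC t)). rewrite (Cmod_mult z), Cmod_R, Rabs_right in T by lra.
    assert (t ^ 2 <= 1) by nra. assert (t ^ 3 <= t) by (simpl in *; nra).
    assert (L * t ^ 3 <= L * t) by (apply Rmult_le_compat_l; auto).
    assert (t * Cmod (y + z * RtoC t) <= t * (Cmod y + Cmod z)) by (apply Rmult_le_compat_l; nra). lra. }
  assert (Y0 : y = 0%C).
  { apply (Cmod_le_linear_0 y (L + Cmod z) s); [lra|lra|]. intros t Ht. specialize (D t Ht).
    rewrite X0 in D.
    replace (0 + y * RtoC t + z * RtoC (t ^ 2))%C with (RtoC t * (y + z * RtoC t))%C in D by (rewrite RtoC_pow; ring).
    rewrite Cmod_mult, Cmod_R, Rabs_right in D by lra.
    assert (D2 : Cmod (y + z * RtoC t) <= L * t ^ 2).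
    { apply Rmult_le_reg_l with t; [lra|]. eapply Rle_trans; [apply D|]. right; ring. }
    replace y with ((y + z * RtoC t) - z * RtoC t)%C by ring.
    eapply Rle_trans; [apply Cmod_triangle|]. rewrite Cmod_opp, Cmod_mult, Cmod_R, Rabs_right by lra.
    assert (t ^ 2 <= t) by nra. assert (L * t ^ 2 <= L * t) by (apply Rmult_le_compat_l; auto). lra. }
  assert (Z0 : z = 0%C).
  { apply (Cmod_le_linear_0 z L s); [lra|lra|]. intros t Ht. specialize (D t Ht).
    rewrite X0, Y0 in D.
    replace (0 + 0 * RtoC t + z * RtoC (t ^ 2))%C with (z * RtoC (t ^ 2))%C in D by ring.
    rewrite Cmod_mult, Cmod_R, Rabs_right in D by (apply Rle_ge, pow2_ge_0).
    assert (0 < t ^ 2) by (apply pow_lt; lra).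
    apply Rmult_le_reg_r with (t ^ 2); [lra|]. eapply Rle_trans; [apply D|]. right; ring. }
  unfold x, y, z in *. repeat split.
  - replace a with (a - a' + a')%C by ring. rewrite X0. ring.
  - replace b with (b - b' + b')%C by ring. rewrite Y0. ring.
  - replace c with (c - c' + c')%C by ring. rewrite Z0. ring.
Qed.

Lemma expansion2_ext (f g : R -> C) (a b c : C) (r : R) : 0 < r ->
  (forall t, 0 < t < r -> f t = g t) -> expansion2 f a b c -> expansion2 g a b c.
Proof.
  intros Hr E [K [s [Hs [HK H]]]]. exists K, (Rmin r s).
  split; [split; [apply Rmin_pos; lra|eapply Rle_trans; [apply Rmin_r|lra]]|]. split; auto.
  intros t Ht. rewrite <- E.
  - apply H. split; [lra|eapply Rlt_le_trans; [apply Ht|apply Rmin_r]].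
  - split; [lra|eapply Rlt_le_trans; [apply Ht|apply Rmin_l]].
Qed.

Lemma expansion2_exp (z : C) : expansion2 (fun t => Cexp (z * RtoC t)) 1 z (z ^ 2 / 2).
Proof.
  exists (Cmod z ^ 3 / 6 * exp (Cmod z)), 1. split; [lra|].
  assert (T := Cmod_ge_0 z).
  assert (P0 : 0 <= Cmod z ^ 3 / 6) by (apply Rdiv_le_0_compat; [apply pow_le; auto|lra]).
  split; [apply Rmult_le_pos; [auto|left; apply exp_pos]|].
  intros t Ht. assert (H := Cexp_taylor 3 (z * RtoC t)).
  replace (1 + z * RtoC t + z ^ 2 / 2 * RtoC (t ^ 2))%C with (psum exp_coef (z * RtoC t) 3).
  - eapply Rle_trans; [apply H|]. rewrite Cmod_mult, Cmod_R, Rabs_right, Rpow_mult_distr by lra.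
    simpl (fact 3). replace (INR 6) with 6 by (simpl; ring).
    assert (exp (Cmod z * t) <= exp (Cmod z)) by (apply exp_le; nra).
    assert (0 < t ^ 3) by (apply pow_lt; lra).
    replace (Cmod z ^ 3 * t ^ 3 / 6 * exp (Cmod z * t)) with (Cmod z ^ 3 / 6 * t ^ 3 * exp (Cmod z * t)) by field.
    replace (Cmod z ^ 3 / 6 * exp (Cmod z) * t ^ 3) with (Cmod z ^ 3 / 6 * t ^ 3 * exp (Cmod z)) by ring.
    apply Rmult_le_compat_l; auto. nra.
  - simpl psum. unfold exp_coef. simpl fact. simpl INR.
    rewrite !Rinv_1, RtoC_pow. replace (1 + 1) with 2 by ring. rewrite RtoC_inv by lra.
    unfold Cdiv. simpl. ring.
Qed.

Lemma expansion2_expm1 (tau : R) : 0 < tau ->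
  expansion2 (fun t => (Cexp (RtoC tau * RtoC t) - 1) / RtoC t)%C (RtoC tau) (RtoC (tau ^ 2 / 2)) (RtoC (tau ^ 3 / 6)).
Proof.
  intros Htau. exists (tau ^ 4 / 24 * exp tau), 1. split; [lra|].
  assert (P0 : 0 <= tau ^ 4 / 24) by (apply Rdiv_le_0_compat; [apply pow_le; lra|lra]).
  split; [apply Rmult_le_pos; [auto|left; apply exp_pos]|].
  intros t Ht. assert (Nt : RtoC t <> 0%C) by (apply RtoC_neq_0; lra).
  assert (H := Cexp_taylor 4 (RtoC tau * RtoC t)).
  replace ((Cexp (RtoC tau * RtoC t) - 1) / RtoC t - (RtoC tau + RtoC (tau ^ 2 / 2) * RtoC t + RtoC (tau ^ 3 / 6) * RtoC (t ^ 2)))%C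
    with ((Cexp (RtoC tau * RtoC t) - psum exp_coef (RtoC tau * RtoC t) 4) / RtoC t)%C.
  - rewrite Cmod_div, Cmod_R, (Rabs_right t) by (auto; lra).
    apply Rmult_le_reg_r with t; [lra|]. unfold Rdiv at 1. rewrite Rmult_assoc, Rinv_l, Rmult_1_r by lra.
    eapply Rle_trans; [apply H|]. rewrite <- RtoC_mult, Cmod_R, Rabs_right, Rpow_mult_distr by nra.
    simpl (fact 4). replace (INR 24) with 24 by (simpl; ring).
    assert (exp (tau * t) <= exp tau) by (apply exp_le; nra).
    assert (0 < t ^ 4) by (apply pow_lt; lra).
    replace (tau ^ 4 * t ^ 4 / 24 * exp (tau * t)) with (tau ^ 4 / 24 * t ^ 4 * exp (tau * t)) by field.
    replace (tau ^ 4 / 24 * exp tau * t ^ 3 * t) with (tau ^ 4 / 24 * t ^ 4 * exp tau) by ring.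
    apply Rmult_le_compat_l; auto. nra.
  - simpl psum. unfold exp_coef. simpl fact.
    replace (INR 6) with 6 by (simpl; ring). replace (INR 2) with 2 by (simpl; ring).
    replace (INR 1) with 1 by reflexivity.
    rewrite !Rinv_1. rewrite !RtoC_div by lra. rewrite !RtoC_pow, !RtoC_inv by lra.
    field. auto.
Qed.

(** The generating function times (e^t - 1) / t and (e^(tau t) - 1) / t is e^(zt). Comparing
    expansions gives a triangular system for the coefficients of index 0, 1, 2, solved in [V0],
    [V1], [V2]. *)
Lemma barnes_P_bernoulli (B : nat -> C -> R -> C) : is_double_bernoulli B ->
  forall (tau : R) (z : C), 0 < tau -> barnes_P tau z = (RtoC (1 / 2) * B 2%nat z tau)%C.
Proof.
  intros HB tau z Ht. destruct (HB tau z Ht) as [r [Hr H]].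
  set (b := fun k => (B k z tau / RtoC (INR (fact k)))%C) in *.
  set (f := fun t => (RtoC t ^ 2 * Cexp (z * RtoC t) / ((Cexp (RtoC t) - 1) * (Cexp (RtoC tau * RtoC t) - 1)))%C).
  assert (Hf : forall t, 0 < t < r -> Clim (psum b (RtoC t)) (f t)).
  { intros t Htt. apply is_pseries_Clim, H.
    - apply RtoC_neq_0; lra.
    - rewrite Cmod_R, Rabs_right; lra. }
  assert (Ef : expansion2 f (b 0%nat) (b 1%nat) (b 2%nat)).
  { destruct (psum_terms_bounded b (RtoC (r / 2)) (f (r / 2))) as [M [HM Bd]]; [apply Hf; lra|].
    rewrite Cmod_R, Rabs_right in Bd by lra.
    exists (M * (2 / r) ^ 3 * 2), (Rmin 1 (r / 4)).
    assert (R2 : 0 < 2 / r) by (apply Rdiv_lt_0_compat; lra).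
    split; [split; [apply Rmin_pos; lra|apply Rmin_l]|]. split.
    { apply Rmult_le_pos; [|lra]. apply Rmult_le_pos; [lra|]. apply pow_le; lra. }
    intros t Htt. assert (Ht4 : t < r / 4) by (eapply Rlt_le_trans; [apply Htt|apply Rmin_r]).
    set (th := t * (2 / r)).
    assert (Hth : 0 <= th <= / 2).
    { unfold th. split; [nra|]. replace (/ 2) with (r / 4 * (2 / r)) by (field; lra). apply Rmult_le_compat_r; lra. }
    replace (b 0%nat + b 1%nat * RtoC t + b 2%nat * RtoC (t ^ 2))%C with (psum b (RtoC t) 3) by (simpl psum; rewrite RtoC_pow; simpl; ring).
    eapply Rle_trans; [apply (psum_tail_le b (RtoC t) (f t) M (r / 2) th 3); auto; try lra|].
    - rewrite Cmod_R, Rabs_right by lra. unfold th. right. field. lra.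
    - apply Hf; lra.
    - unfold Rdiv at 1. replace (M * (2 / r) ^ 3 * 2 * t ^ 3) with (M * th ^ 3 * 2) by (unfold th; ring).
      apply Rmult_le_compat_l; [apply Rmult_le_pos; [lra|apply pow_le; lra]|].
      rewrite <- (Rinv_inv 2). apply Rinv_le_contravar; lra. }
  assert (E3 := expansion2_mult _ _ _ _ _ _ _ _ Ef
    (expansion2_mult _ _ _ _ _ _ _ _ (expansion2_expm1 1 Rlt_0_1) (expansion2_expm1 tau Ht))).
  (* The placeholders take the coefficients that [expansion2_mult] produced in [E3]. *)
  assert (E4 : expansion2 (fun t => Cexp (z * RtoC t)) _ _ _) by
   (refine (expansion2_ext _ _ _ _ _ 1 Rlt_0_1 _ E3);
    intros t Htt; unfold f;
    assert (N1 : RtoC t <> 0%C) by (apply RtoC_neq_0; lra);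
    assert (G1 : forall s, 0 < s -> (Cexp (RtoC s * RtoC t) - 1)%C <> 0%C) by
     (intros s Hs; rewrite <- RtoC_mult, Cexp_RtoC, <- RtoC_minus; apply RtoC_neq_0;
      assert (Tx := exp_ineq1_le (s * t)); nra);
    assert (N2 := G1 1 Rlt_0_1); assert (N3 := G1 tau Ht);
    replace (RtoC 1 * RtoC t)%C with (RtoC t) in * by ring;
    field; auto).
  destruct (expansion2_unique _ _ _ _ _ _ _ E4 (expansion2_exp z)) as [U1 [U2 U3]].
  assert (NT : RtoC tau <> 0%C) by (apply RtoC_neq_0; lra).
  assert (N2 := RtoC_2_neq_0).
  replace (1 ^ 2 / 2) with (/ 2) in * by field. replace (1 ^ 3 / 6) with (/ 6) in * by field.
  rewrite !RtoC_div, !RtoC_pow, !RtoC_inv in * by lra.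
  assert (V0 : b 0%nat = (1 / RtoC tau)%C).
  { replace (b 0%nat) with (b 0%nat * (1 * RtoC tau) / RtoC tau)%C by (field; auto). rewrite U1. reflexivity. }
  assert (N6 : RtoC 6 <> 0%C) by (apply RtoC_neq_0; lra).
  assert (V1 : b 1%nat = ((z - b 0%nat * (1 * (RtoC tau ^ 2 / 2) + / 2 * RtoC tau)) / RtoC tau)%C).
  { rewrite <- U2. field. auto. }
  assert (V2 : b 2%nat = ((z ^ 2 / 2 - b 0%nat * (1 * (RtoC tau ^ 3 / 6) + / 2 * (RtoC tau ^ 2 / 2) + / 6 * RtoC tau)
     - b 1%nat * (1 * (RtoC tau ^ 2 / 2) + / 2 * RtoC tau)) / RtoC tau)%C).
  { rewrite <- U3. field. auto. }
  replace (B 2%nat z tau) with (b 2%nat * 2)%C.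
  2: { unfold b. simpl fact. replace (INR 2) with 2 by (simpl; ring). field. }
  rewrite V2, V1, V0. unfold barnes_P.
  rewrite !RtoC_div, !RtoC_plus, !RtoC_mult, RtoC_pow by nra.
  replace (RtoC 12) with (2 * 6)%C by (rewrite <- RtoC_mult; f_equal; ring).
  replace (RtoC 6) with (2 * 3)%C in * by (rewrite <- RtoC_mult; f_equal; ring).
  replace (RtoC 3) with (1 + 2)%C in * by (rewrite <- RtoC_plus; f_equal; ring).
  field. auto.
Qed.

(** * Vitali's theorem *)

Lemma has_ps_plus (f g : C -> C) (c : C) (r : R) (a b : nat -> C) :
  has_ps f c r a -> has_ps g c r b -> has_ps (fun s => f s + g s)%C c r (fun n => a n + b n)%C.
Proof.
  intros Hf Hg w Hw. apply Clim_ext with (fun n => psum a w n + psum b w n)%C.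
  - intros n. induction n as [|n IH]; simpl; [ring|]. rewrite <- IH. ring.
  - apply Clim_plus; auto.
Qed.

Lemma has_ps_scal (k : C) (f : C -> C) (c : C) (r : R) (a : nat -> C) :
  has_ps f c r a -> has_ps (fun s => k * f s)%C c r (fun n => k * a n)%C.
Proof.
  intros Hf w Hw. apply Clim_ext with (fun n => k * psum a w n)%C.
  - intros n. induction n as [|n IH]; simpl; [ring|]. rewrite <- IH. ring.
  - apply Clim_mult; [apply Clim_const|]; auto.
Qed.

Definition shift_coef (a : nat -> C) (n : nat) : C :=
  match n with O => RtoC 0 | S n => a n end.

Lemma has_ps_mult_id (f : C -> C) (c : C) (r : R) (a : nat -> C) :
  has_ps f c r a -> has_ps (fun s => s * f s)%C c r (fun n => c * a n + shift_coef a n)%C.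
Proof.
  intros Hf w Hw. apply Clim_incr_1.
  apply Clim_ext with (fun n => c * psum a w (S n) + w * psum a w n)%C.
  - intros n. induction n as [|n IH].
    + simpl. ring.
    + change (psum (fun n => c * a n + shift_coef a n)%C w (S (S n)))
        with (psum (fun n => c * a n + shift_coef a n)%C w (S n) + (c * a (S n) + a n) * w ^ (S n))%C.
      rewrite <- IH. simpl. ring.
  - replace ((c + w) * f (c + w))%C with (c * f (c + w) + w * f (c + w))%C by ring.
    apply Clim_plus; (apply Clim_mult; [apply Clim_const|]); [apply (Clim_incr_1 (psum a w))|]; auto.
Qed.

Lemma psum_exp_scale (k l w : C) (n : nat) :
  psum (fun n => k * (l ^ n * exp_coef n))%C w n = (k * psum exp_coef (l * w) n)%C.
Proof.
  induction n as [|n IH]; simpl; [ring|]. rewrite IH, Cpow_mult_l. ring.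
Qed.

Lemma has_ps_Cexp (l c : C) (r : R) :
  has_ps (fun s => Cexp (l * s)) c r (fun n => Cexp (l * c) * (l ^ n * exp_coef n))%C.
Proof.
  intros w Hw. apply Clim_ext with (fun n => Cexp (l * c) * psum exp_coef (l * w) n)%C.
  - intros n. symmetry. apply psum_exp_scale.
  - replace (l * (c + w))%C with (l * c + l * w)%C by ring. rewrite Cexp_plus.
    apply Clim_mult; [apply Clim_const|apply Cexp_psum].
Qed.

Lemma Cexp_mult_INR (w : C) (n : nat) : Cexp (RtoC (INR n) * w) = (Cexp w ^ n)%C.
Proof.
  induction n as [|n IH].
  - replace (RtoC (INR 0) * w)%C with (RtoC 0) by (simpl; ring). apply Cexp_0.
  - rewrite S_INR, RtoC_plus, Cmult_plus_distr_r, Cexp_plus, IH. simpl. rewrite Cmult_1_l. ring.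
Qed.

Lemma Cexp_2PI (n : nat) : Cexp (RtoC (INR n) * (Ci * RtoC (2 * PI)))%C = 1%C.
Proof.
  rewrite Cexp_mult_INR. replace (Cexp (Ci * RtoC (2 * PI))) with (RtoC 1); [apply Cpow_1_l|].
  unfold Cexp. rewrite Re_mult, Im_mult; simpl.
  replace (0 * (2 * PI) - 1 * 0) with 0 by ring. replace (0 * 0 + 1 * (2 * PI)) with (2 * PI) by ring.
  rewrite exp_0, cos_2PI, sin_2PI. apply C_ext; simpl; ring.
Qed.

(** * Cauchy's estimate for coefficients *)

Definition circle (rr t : R) : C := (RtoC rr * Cexp (RtoC t * Ci))%C.

Definition twist (k : nat) (t : R) : C := Cexp (- (RtoC (INR k) * (RtoC t * Ci)))%C.

(* Termwise antiderivative of [psum a (circle rr t) n * twist k t]; only the term of index [k] has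
   a nonzero increment over [0, 2 PI]. *)
Fixpoint cauchy_primitive (a : nat -> C) (rr : R) (k n : nat) (t : R) : C :=
  match n with
  | O => 0%C
  | S j => (cauchy_primitive a rr k j t + a j * RtoC (rr ^ j) *
      (if Nat.eqb j k then RtoC t
       else Cexp (RtoC t * (Ci * RtoC (INR j - INR k))) / (Ci * RtoC (INR j - INR k))))%C
  end.

Lemma circle_pow (rr t : R) (j k : nat) :
  (circle rr t ^ j * twist k t = RtoC (rr ^ j) * Cexp (RtoC t * (Ci * RtoC (INR j - INR k))))%C.
Proof.
  unfold circle, twist. rewrite Cpow_mult_l, <- Cexp_mult_INR, <- RtoC_pow, <- Cmult_assoc, <- Cexp_plus.
  f_equal. f_equal. rewrite RtoC_minus. ring.
Qed.

Lemma Ci_mult_neq_0 (x : R) : x <> 0 -> (Ci * RtoC x)%C <> 0%C.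
Proof.
  intros H. apply Cmult_neq_0; [|apply RtoC_neq_0; auto].
  intros E. apply (f_equal Im) in E. simpl in E. lra.
Qed.

Lemma Cder_cauchy_primitive (a : nat -> C) (rr : R) (k n : nat) (t : R) :
  Cder (cauchy_primitive a rr k n) t (psum a (circle rr t) n * twist k t)%C.
Proof.
  induction n as [|n IH].
  - eapply Cder_value; [apply Cder_const|]. simpl. ring.
  - simpl psum. replace ((psum a (circle rr t) n + a n * circle rr t ^ n) * twist k t)%C
      with (psum a (circle rr t) n * twist k t + a n * (circle rr t ^ n * twist k t))%C by ring.
    rewrite circle_pow. simpl cauchy_primitive. apply Cder_plus; [apply IH|].
    rewrite Cmult_assoc. apply Cder_scal.
    destruct (Nat.eqb_spec n k) as [E|N].
    + eapply Cder_value; [apply Cder_RtoC with (l := 1); apply @is_derive_id|].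
      rewrite E, Rminus_diag. replace (RtoC t * (Ci * RtoC 0))%C with (RtoC 0) by ring.
      symmetry. apply Cexp_0.
    + set (d := (Ci * RtoC (INR n - INR k))%C).
      assert (Nd : d <> 0%C).
      { apply Ci_mult_neq_0. intros E. apply N. apply INR_eq. lra. }
      apply Cder_ext with (fun s => / d * Cexp (0 + RtoC s * d))%C.
      { intros s. replace (0 + RtoC s * d)%C with (RtoC s * d)%C by ring. unfold Cdiv. ring. }
      eapply Cder_value; [apply Cder_scal, Cder_Cexp, Cder_line|].
      cbv beta. replace (0 + RtoC t * d)%C with (RtoC t * d)%C by ring. field. auto.
Qed.

Lemma cauchy_primitive_increment (a : nat -> C) (rr : R) (k n : nat) :
  (cauchy_primitive a rr k n (2 * PI) - cauchy_primitive a rr k n 0)%C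
  = if Nat.ltb k n then (a k * RtoC (rr ^ k) * RtoC (2 * PI))%C else 0%C.
Proof.
  induction n as [|n IH]; [simpl; ring|].
  simpl cauchy_primitive.
  match goal with |- (?p + ?q - (?p' + ?q'))%C = _ =>
    replace (p + q - (p' + q'))%C with ((p - p') + (q - q'))%C by ring end.
  rewrite IH. destruct (Nat.eqb_spec n k) as [E|N].
  - subst k. rewrite (proj2 (Nat.ltb_ge n n)), (proj2 (Nat.ltb_lt n (S n))) by lia. ring.
  - replace (Nat.ltb k (S n)) with (Nat.ltb k n).
    2: { destruct (Nat.ltb_spec k n), (Nat.ltb_spec k (S n)); auto; lia. }
    replace (Cexp (RtoC (2 * PI) * (Ci * RtoC (INR n - INR k)))) with (RtoC 1).
    + replace (RtoC 0 * (Ci * RtoC (INR n - INR k)))%C with (RtoC 0) by ring. rewrite Cexp_0. ring.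
    + replace (RtoC (2 * PI) * (Ci * RtoC (INR n - INR k)))%C
        with (RtoC (INR n) * (Ci * RtoC (2 * PI)) - RtoC (INR k) * (Ci * RtoC (2 * PI)))%C
        by (rewrite RtoC_minus; ring).
      rewrite Cexp_minus, !Cexp_2PI. field.
Qed.

Lemma Cmod_circle (rr t : R) : 0 <= rr -> Cmod (circle rr t) = rr.
Proof.
  intros H. unfold circle. rewrite Cmod_mult, Cmod_Cexp, Cmod_R, Rabs_right by lra.
  rewrite Re_mult. simpl. replace (t * 0 - 0 * 1) with 0 by ring. rewrite exp_0. ring.
Qed.

Lemma Cmod_twist (k : nat) (t : R) : Cmod (twist k t) = 1.
Proof.
  unfold twist. rewrite Cmod_Cexp, Re_opp, !Re_mult, Im_mult; simpl.
  replace (- _) with 0 by ring. apply exp_0.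
Qed.

(** Instead of integrating over the circle, the explicit primitive is compared with K t by
    [Cder_le]: its increment over [0, 2 PI] is 2 PI a_k rr^k, and its derivative has modulus at most
    K. *)
Lemma cauchy_estimate_psum (a : nat -> C) (rr K : R) (k n : nat) : 0 <= rr -> (k < n)%nat ->
  (forall w, Cmod w = rr -> Cmod (psum a w n) <= K) -> Cmod (a k) * rr ^ k <= K.
Proof.
  intros Hr Hk H. assert (P := PI_RGT_0).
  assert (E := Cder_le (cauchy_primitive a rr k n) (fun t => psum a (circle rr t) n * twist k t)%C
    (fun t => K * t) (fun _ => K) 0 (2 * PI) ltac:(lra)).
  rewrite cauchy_primitive_increment, (proj2 (Nat.ltb_lt k n) Hk) in E.
  rewrite !Cmod_mult, !Cmod_R, (Rabs_right (2 * PI)), Rabs_right in E by (try apply Rle_ge, pow_le; lra).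
  apply Rmult_le_reg_r with (2 * PI); [lra|].
  eapply Rle_trans; [apply E|lra].
  - intros t _. apply Cder_cauchy_primitive.
  - intros t _. auto_derive; auto. ring.
  - intros t _. rewrite Cmod_mult, Cmod_twist, Rmult_1_r. apply H, Cmod_circle; auto.
Qed.

(** Partial sums converge uniformly on the circle of radius [rr], by geometric comparison with a
    slightly larger radius, so the estimate for polynomials passes to the limit. *)
Lemma cauchy_estimate (f : C -> C) (c : C) (r rr K : R) (a : nat -> C) (k : nat) :
  has_ps f c r a -> 0 < rr < r -> (forall w, Cmod w = rr -> Cmod (f (c + w)%C) <= K) ->
  Cmod (a k) * rr ^ k <= K.
Proof.
  intros H Hr B.
  set (r1 := (rr + r) / 2). set (th := rr / r1).
  assert (Hr1 : rr < r1 < r) by (unfold r1; lra).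
  destruct (has_ps_bounded f c r r1 a H ltac:(lra)) as [M [HM Bd]].
  assert (Hth : 0 <= th < 1).
  { unfold th. split; [apply Rdiv_le_0_compat; lra|].
    apply Rmult_lt_reg_r with r1; [lra|]. unfold Rdiv. rewrite Rmult_assoc, Rinv_l; lra. }
  assert (L : is_lim_seq (fun n => M * th ^ n / (1 - th)) 0).
  { replace 0 with (M * 0 * / (1 - th)) by ring.
    apply is_lim_seq_mult'; [apply is_lim_seq_mult'; [apply is_lim_seq_const|]|apply is_lim_seq_const].
    apply is_lim_seq_geom. rewrite Rabs_right; lra. }
  apply Rnot_lt_le. intros Hlt.
  destruct (proj1 (is_lim_seq_Reals _ _) L (Cmod (a k) * rr ^ k - K) ltac:(lra)) as [N HN].
  set (n := Nat.max N (S k)). specialize (HN n ltac:(lia)).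
  unfold R_dist in HN. rewrite Rminus_0_r in HN.
  assert (T := Rle_abs (M * th ^ n / (1 - th))).
  assert (E := cauchy_estimate_psum a rr (K + M * th ^ n / (1 - th)) k n ltac:(lra) ltac:(lia)).
  assert (E2 : Cmod (a k) * rr ^ k <= K + M * th ^ n / (1 - th)); [|lra].
  apply E. intros w Hw.
  assert (E3 := psum_tail_le a w (f (c + w)%C) M r1 th n Hth ltac:(lra)).
  assert (E4 : Cmod (f (c + w)%C - psum a w n) <= M * th ^ n / (1 - th)).
  { apply E3; auto.
    - rewrite Hw. unfold th. right. field. lra.
    - apply H. lra. }
  replace (psum a w n) with (f (c + w)%C - (f (c + w)%C - psum a w n))%C by ring.
  eapply Rle_trans; [apply Cmod_triangle|]. rewrite Cmod_opp.
  specialize (B w Hw). lra.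
Qed.

Lemma Clim_psum_0 (a : nat -> nat -> C) (w : C) (k : nat) :
  (forall i, (i < k)%nat -> Clim (fun M => a M i) 0%C) -> Clim (fun M => psum (a M) w k) 0%C.
Proof.
  induction k as [|k IH]; intros H.
  - apply Clim_const.
  - simpl. replace (RtoC 0) with (0 + 0 * w ^ k)%C by ring.
    apply Clim_plus; [apply IH; intros; apply H; lia|].
    apply Clim_mult; [apply H; lia|apply Clim_const].
Qed.

Lemma Clim_0_eps (u : nat -> C) :
  (forall eps, 0 < eps -> exists N, forall n, (N <= n)%nat -> Cmod (u n) < eps) -> Clim u 0%C.
Proof.
  intros H. apply Clim_Cmod, is_lim_seq_Reals. intros eps He. destruct (H eps He) as [N HN].
  exists N. intros n Hn. unfold R_dist. rewrite Rminus_0_r, Rabs_right by apply Rle_ge, Cmod_ge_0.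
  replace (u n - 0)%C with (u n) by ring. apply HN; lia.
Qed.

Lemma Clim_0_elim (u : nat -> C) : Clim u 0%C ->
  forall eps, 0 < eps -> exists N, forall n, (N <= n)%nat -> Cmod (u n) < eps.
Proof.
  intros H eps He. apply Clim_Cmod, is_lim_seq_Reals in H. destruct (H eps He) as [N HN].
  exists N. intros n Hn. specialize (HN n ltac:(lia)).
  unfold R_dist in HN. rewrite Rminus_0_r, Rabs_right in HN by apply Rle_ge, Cmod_ge_0.
  replace (u n - 0)%C with (u n) in HN by ring. auto.
Qed.

(* Vitali's theorem for power series that share a Cauchy bound. *)
Lemma vitali (a : nat -> nat -> C) (h : nat -> C -> C) (rr K : R) : 0 < rr -> 0 < K ->
  (forall M k, Cmod (a M k) * rr ^ k <= K) ->
  (forall M w, Cmod w < rr -> Clim (psum (a M) w) (h M w)) ->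
  (forall eps, 0 < eps -> exists w, 0 < Cmod w < eps /\ Clim (fun M => h M w) 0%C) ->
  (forall k, Clim (fun M => a M k) 0%C) /\
  (forall w, Cmod w <= rr / 2 -> Clim (fun M => h M w) 0%C).
Proof.
  intros Hr HK Ha Hh Hz.
  assert (Tail : forall M w n, Cmod w <= rr / 2 ->
     Cmod (h M w - psum (a M) w n) <= 2 * K * (Cmod w / rr) ^ n).
  { intros M w n Hw. assert (T := Cmod_ge_0 w). set (th := Cmod w / rr).
    assert (Hth : 0 <= th <= / 2).
    { unfold th. split; [apply Rdiv_le_0_compat; lra|].
      apply Rmult_le_reg_r with rr; auto. unfold Rdiv. rewrite Rmult_assoc, Rinv_l; lra. }
    eapply Rle_trans; [apply (psum_tail_le (a M) w (h M w) K rr th n); auto; try lra|].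
    - unfold th. right. field. lra.
    - apply Hh. lra.
    - unfold Rdiv. rewrite Rmult_assoc, (Rmult_comm 2), Rmult_assoc. apply Rmult_le_compat_l; [lra|].
      rewrite Rmult_comm. apply Rmult_le_compat_r; [apply pow_le; lra|].
      rewrite <- (Rinv_inv 2). apply Rinv_le_contravar; lra. }
  assert (Hk : forall k, Clim (fun M => a M k) 0%C).
  { intros k. induction k as [k IH] using (well_founded_ind Nat.lt_wf_0).
    apply Clim_0_eps. intros eps He.
    assert (Prk : 0 < rr ^ S k) by (apply pow_lt; auto).
    (* For |w| < d the tail beyond index k is at most eps / 2 * |w|^k. The coefficients below k
       already tend to 0 by induction, and h(w) tends to 0 at the chosen w, so a_k w^k is all that
       is left to bound. *)
    set (d := Rmin (rr / 2) (eps * rr ^ S k / (4 * K))).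
    assert (Pd : 0 < d) by (apply Rmin_pos; [lra|apply Rdiv_lt_0_compat; [nra|lra]]).
    destruct (Hz d Pd) as [w [Hw Zw]].
    assert (W1 : Cmod w <= rr / 2) by (left; eapply Rlt_le_trans; [apply Hw|apply Rmin_l]).
    assert (W2 : Cmod w < eps * rr ^ S k / (4 * K)) by (eapply Rlt_le_trans; [apply Hw|apply Rmin_r]).
    assert (Pk : 0 < Cmod w ^ k) by (apply pow_lt; lra).
    destruct (Clim_0_elim _ Zw (eps / 4 * Cmod w ^ k)) as [N1 HN1]; [nra|].
    destruct (Clim_0_elim _ (Clim_psum_0 a w k IH) (eps / 4 * Cmod w ^ k)) as [N2 HN2]; [nra|].
    exists (Nat.max N1 N2). intros M HM.
    specialize (HN1 M ltac:(lia)). specialize (HN2 M ltac:(lia)).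
    assert (T1 := Tail M w (S k) W1).
    assert (T2 : Cmod (a M k * w ^ k) < eps * Cmod w ^ k).
    { replace (a M k * w ^ k)%C with (h M w - (h M w - psum (a M) w (S k)) - psum (a M) w k)%C by (simpl; ring).
      eapply Rle_lt_trans; [apply Cmod_triangle|]. rewrite Cmod_opp.
      assert (T3 := Cmod_triangle (h M w) (- (h M w - psum (a M) w (S k)))). rewrite Cmod_opp in T3.
      assert (T4 : 2 * K * (Cmod w / rr) ^ S k <= eps / 2 * Cmod w ^ k).
      { unfold Rdiv at 1. rewrite Rpow_mult_distr, pow_inv by lra.
        apply Rmult_le_reg_r with (rr ^ S k); auto.
        replace (2 * K * (Cmod w ^ S k * / rr ^ S k) * rr ^ S k) with (2 * K * Cmod w ^ S k) by (field; lra).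
        apply Rmult_lt_compat_r with (r := 4 * K) in W2; [|lra].
        replace (eps * rr ^ S k / (4 * K) * (4 * K)) with (eps * rr ^ S k) in W2 by (field; lra).
        replace (2 * K * Cmod w ^ S k) with (Cmod w ^ k * (Cmod w * (4 * K)) / 2) by (simpl; field).
        replace (eps / 2 * Cmod w ^ k * rr ^ S k) with (Cmod w ^ k * (eps * rr ^ S k) / 2) by field.
        apply Rmult_le_compat_r; [lra|]. apply Rmult_le_compat_l; lra. }
      unfold Cminus in *. lra. }
    rewrite Cmod_mult, Cmod_pow in T2. apply Rmult_lt_reg_r with (Cmod w ^ k); auto. }
  split; auto.
  intros w Hw. apply Clim_0_eps. intros eps He.
  assert (T := Cmod_ge_0 w). set (th := Cmod w / rr).
  assert (Hth : 0 <= th <= / 2).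
  { unfold th. split; [apply Rdiv_le_0_compat; lra|].
    apply Rmult_le_reg_r with rr; auto. unfold Rdiv. rewrite Rmult_assoc, Rinv_l; lra. }
  assert (L : is_lim_seq (fun n => 2 * K * th ^ n) (2 * K * 0)).
  { apply is_lim_seq_mult'; [apply is_lim_seq_const|]. apply is_lim_seq_geom. rewrite Rabs_right; lra. }
  rewrite Rmult_0_r in L.
  destruct (proj1 (is_lim_seq_Reals _ _) L (eps / 2) ltac:(lra)) as [n Hn]. specialize (Hn n (le_n _)).
  unfold R_dist in Hn. rewrite Rminus_0_r in Hn. assert (T2 := Rle_abs (2 * K * th ^ n)).
  destruct (Clim_0_elim _ (Clim_psum_0 a w n (fun i _ => Hk i)) (eps / 2)) as [N HN]; [lra|].
  exists N. intros M HM. specialize (HN M HM). assert (T1 := Tail M w n Hw). fold th in T1.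
  replace (h M w) with ((h M w - psum (a M) w n) + psum (a M) w n)%C by ring.
  eapply Rle_lt_trans; [apply Cmod_triangle|]. lra.
Qed.

(** * Euler-Maclaurin expansion of zeta *)

(** This is (n + 1)^(- s); with this shift [zeta_partial n] sums k^(- s) over 1 <= k <= n. *)
Definition npow (n : nat) (s : C) : C := Cexp (RtoC (- ln (INR (S n))) * s).

(* Euler-Maclaurin approximation of [(s - 1) * sum_(k >= n + 1) k ^ (- s)]. *)
Definition em_main (n : nat) (s : C) : C :=
  let m := RtoC (INR (S n)) in
  ((m - / 2) * npow n s + / 2 * (s * npow n s) + / (12 * m) * (s * (s * npow n s) + - (1) * (s * npow n s)))%C.

Fixpoint zeta_partial (n : nat) (s : C) : C :=
  match n with O => 0%C | S n => (zeta_partial n s + npow n s)%C end.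

(** The remainder of Euler-Maclaurin multiplied by s - 1, which clears the denominator of the term
    m^(1 - s) / (s - 1). It is written with sums, constant factors and multiplication by s only, the
    operations for which [has_ps] has rules. *)
Definition zeta_rem (zeta : C -> C) (M : nat) (s : C) : C :=
  (s * (zeta s + - (1) * zeta_partial M s) + - (1) * (zeta s + - (1) * zeta_partial M s) + - (1) * em_main M s)%C.

(* One step of Euler-Maclaurin: [H] interpolates between consecutive remainders, and its
   derivative is a cubic Bernoulli kernel times [y ^ (- s - 3)]. *)
Lemma zeta_rem_step (zeta : C -> C) (M : nat) (s : C) (S0 : R) : - (3 / 2) <= Re s -> Cmod s <= S0 ->
  Cmod (zeta_rem zeta (S M) s - zeta_rem zeta M s)
    <= (S0 + 2) ^ 4 * (exp (- ln (INR (S M)) / 2) - exp (- ln (INR (S (S M))) / 2)).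
Proof.
  intros Hs HS.
  set (m := INR (S M)).
  assert (Hm : 1 <= m) by (unfold m; rewrite S_INR; assert (T := pos_INR M); lra).
  set (y := fun t : R => RtoC (m + t)).
  set (E := fun t => Cexp (- s * Cln (y t))%C).
  (* The Bernoulli polynomials B_1, B_2 / 2 and B_3 / 6, each the derivative of the next. [b3]
     vanishes at 0 and 1, so its term contributes nothing at the endpoints, while in the derivative
     of [F] everything but the [b3] term cancels. *)
  set (b1 := fun t => t - / 2). set (b2 := fun t => t ^ 2 / 2 - t / 2 + / 12).
  set (b3 := fun t => t ^ 3 / 6 - t ^ 2 / 4 + t / 12).
  set (K := (s * (s + 1) * (s + 2) * (s - 1))%C).
  set (F := fun t => (E t * (y t + (s - 1) * (RtoC (b1 t) + s * RtoC (b2 t) * / y t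
       + s * (s + 1) * RtoC (b3 t) * (/ y t * / y t))))%C).
  assert (Dy : forall t, Cder y t 1%C).
  { intros t. apply Cder_RtoC with (l := 1). auto_derive; auto. }
  assert (Py : forall t, 0 <= t -> 0 < m + t) by (intros; lra).
  assert (Ny : forall t, 0 <= t -> y t <> 0%C).
  { intros t Ht. apply RtoC_neq_0. specialize (Py t Ht). lra. }
  assert (DE : forall t, 0 <= t -> Cder E t (- s * (1 / y t) * E t)%C).
  { intros t Ht. apply Cder_Cexp, Cder_scal, Cder_Cln; [apply Dy|apply Py; auto]. }
  assert (Db : forall (b : R -> R) t l, is_derive b t l -> Cder (fun u => RtoC (b u)) t (RtoC l))
    by (intros; apply Cder_RtoC; auto).
  assert (H := Cder_le F (fun t => - (K * RtoC (b3 t) * (E t * (/ y t * (/ y t * / y t)))))%C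
    (fun t => - ((S0 + 2) ^ 4) * exp (- ln (m + t) / 2))
    (fun t => (S0 + 2) ^ 4 / 2 * (exp (- ln (m + t) / 2) / (m + t))) 0 1 Rle_0_1).
  replace (F 1 - F 0)%C with (zeta_rem zeta M s - zeta_rem zeta (S M) s)%C in H.
  - assert (Em : INR (S (S M)) = m + 1) by (unfold m; rewrite (S_INR (S M)); reflexivity).
    rewrite Em, Cmod_minus_sym. eapply Rle_trans; [apply H|right; rewrite Rplus_0_r; ring]; clear H.
    + intros t Ht.
      assert (D3 : Cder (fun t => RtoC (b3 t)) t (RtoC (b2 t))).
      { apply Db. unfold b3, b2. auto_derive; auto. field. }
      assert (D2 : Cder (fun t => RtoC (b2 t)) t (RtoC (b1 t))).
      { apply Db. unfold b2, b1. auto_derive; auto. field. }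
      assert (D1 : Cder (fun t => RtoC (b1 t)) t (RtoC 1)).
      { apply Db. unfold b1. auto_derive; auto. }
      assert (Di := Cder_inv y t 1%C (Dy t) (Ny t (proj1 Ht))).
      eapply Cder_value.
      * unfold F. apply Cder_mult; [apply DE, Ht|]. apply Cder_plus; [apply Dy|].
        apply Cder_scal. apply Cder_plus; [apply Cder_plus|].
        -- apply D1.
        -- apply Cder_mult; [apply Cder_scal, D2|apply Di].
        -- apply Cder_mult; [apply Cder_scal, D3|apply Cder_mult; apply Di].
      * assert (N := Ny t (proj1 Ht)).
        unfold K. cbv beta. clearbody E y b1 b2 b3. field. auto.
    + intros t Ht. specialize (Py t (proj1 Ht)). auto_derive; [lra|]. unfold Rdiv. field. lra.
    + intros t Ht. specialize (Py t (proj1 Ht)).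
      rewrite Cmod_opp, !Cmod_mult, Cmod_R.
      assert (Iy : Cmod (/ y t) = / (m + t)).
      { unfold y. rewrite <- RtoC_inv by lra. rewrite Cmod_R, Rabs_right; auto.
        apply Rle_ge; left; apply Rinv_0_lt_compat; auto. }
      rewrite Iy.
      assert (P0 := Cmod_ge_0 s).
      assert (BK : Cmod K <= (S0 + 2) ^ 4).
      { unfold K. rewrite !Cmod_mult.
        assert (A1 := Cmod_triangle s 1). assert (A2 := Cmod_triangle s 2). assert (A3 := Cmod_triangle s (- (1))).
        rewrite Cmod_opp in A3. rewrite !Cmod_R in A1, A2, A3.
        rewrite !Rabs_right in A1, A2, A3 by lra.
        replace ((S0 + 2) ^ 4) with ((S0 + 2) * (S0 + 2) * (S0 + 2) * (S0 + 2)) by ring.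
        unfold Cminus.
        repeat (apply Rmult_le_compat; [repeat apply Rmult_le_pos; apply Cmod_ge_0|apply Cmod_ge_0| |lra]).
        lra. }
      assert (B3 : Rabs (b3 t) <= / 2).
      { apply Rabs_le. unfold b3. destruct Ht as [Ht0 Ht1].
        assert (0 <= t ^ 2 <= 1) by (split; nra). assert (0 <= t ^ 3 <= 1) by (split; simpl in *; nra). lra. }
      (* Here Re s >= - 3/2 enters: |y^(- s)| / y <= y^(1/2), so the kernel is O(y^(- 3/2)), the
         derivative of a multiple of y^(- 1/2), and the bounds of successive steps telescope. *)
      assert (BE : Cmod (E t) * / (m + t) <= exp (- ln (m + t) / 2) * (m + t)).
      { assert (Rl : 0 <= ln (m + t)) by (rewrite <- ln_1; apply ln_le; lra).
        unfold E, y. rewrite Cln_RtoC, Cmod_Cexp by auto.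
        replace (/ (m + t)) with (exp (- ln (m + t))) by (rewrite exp_Ropp, exp_ln; auto).
        replace (exp (- ln (m + t) / 2) * (m + t)) with (exp (- ln (m + t) / 2 + ln (m + t)))
          by (rewrite exp_plus, exp_ln; auto).
        rewrite <- !exp_plus. apply exp_le.
        rewrite Re_mult, Re_opp, Im_RtoC, Re_RtoC. nra. }
      assert (PE := Cmod_ge_0 (E t)). assert (PK := Cmod_ge_0 K). assert (P3 := Rabs_pos (b3 t)).
      assert (Pi : 0 < / (m + t)) by (apply Rinv_0_lt_compat; auto).
      apply Rle_trans with ((S0 + 2) ^ 4 * / 2 * (exp (- ln (m + t) / 2) * (m + t) * (/ (m + t) * / (m + t)))).
      * apply Rmult_le_compat.
        -- apply Rmult_le_pos; auto.
        -- apply Rmult_le_pos; auto. repeat apply Rmult_le_pos; lra.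
        -- apply Rmult_le_compat; auto.
        -- rewrite <- Rmult_assoc. apply Rmult_le_compat_r; [apply Rmult_le_pos; lra|auto].
      * right. field. lra.
  - assert (EE : forall n t, INR (S n) = m + t -> 0 <= t -> npow n s = E t).
    { intros n t En Ht. unfold npow, E, y. rewrite En, Cln_RtoC by (apply Py; auto).
      f_equal. rewrite RtoC_opp. ring. }
    assert (E0 : npow M s = E 0) by (apply EE; [unfold m; ring|lra]).
    assert (E1 : npow (S M) s = E 1) by (apply EE; [unfold m; rewrite (S_INR (S M)); ring|lra]).
    unfold zeta_rem. simpl zeta_partial. unfold em_main.
    rewrite E1, E0. unfold F.
    replace (RtoC (INR (S (S M)))) with (y 1) by (unfold y, m; rewrite (S_INR (S M)); reflexivity).
    replace (RtoC (INR (S M))) with (y 0) by (unfold y, m; f_equal; ring).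
    replace (b1 1) with (/ 2) by (unfold b1; field). replace (b1 0) with (- / 2) by (unfold b1; field).
    replace (b2 1) with (/ 12) by (unfold b2; field). replace (b2 0) with (/ 12) by (unfold b2; field).
    replace (b3 1) with 0 by (unfold b3; field). replace (b3 0) with 0 by (unfold b3; field).
    assert (N0 := Ny 0 (Rle_refl 0)). assert (N1 := Ny 1 Rle_0_1).
    rewrite RtoC_opp, !RtoC_inv by lra.
    assert (Ey : y 1 = (y 0 + 1)%C) by (unfold y; rewrite !RtoC_plus; ring).
    replace (RtoC 12) with (2 * 2 * (1 + 2))%C by (rewrite <- RtoC_plus, <- !RtoC_mult; f_equal; ring).
    assert (N3 : (1 + 2)%C <> 0%C) by (rewrite <- RtoC_plus; apply RtoC_neq_0; lra).
    assert (N2 := RtoC_2_neq_0).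
    clearbody E y. field. auto.
Qed.

Lemma has_ps_is_derive (f : C -> C) (c : C) (r : R) (a : nat -> C) : 0 < r -> has_ps f c r a ->
  @is_derive C_AbsRing C_NormedModule f c (a 1%nat).
Proof.
  intros Hr H. destruct (has_ps_taylor1 f c r a Hr H) as [d [K [Hd [HK B]]]].
  split; [apply is_linear_scal_l|]. intros x Hx eps.
  assert (E := is_filter_lim_locally_unique (V := AbsRing_NormedModule C_AbsRing) c x Hx).
  rewrite <- E. clear x Hx E.
  assert (Pe := cond_pos eps).
  assert (Pd : 0 < Rmin d (eps / (K + 1))) by (apply Rmin_pos; auto; apply Rdiv_lt_0_compat; lra).
  assert (Main : forall y : C, Cmod (y - c) < Rmin d (eps / (K + 1)) ->
    Cmod ((f y - f c) - (y - c) * a 1%nat) <= eps * Cmod (y - c)).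
  { intros y Hy. set (w := (y - c)%C) in *.
    assert (W1 : Cmod w < d) by (eapply Rlt_le_trans; [apply Hy|apply Rmin_l]).
    assert (W2 : Cmod w < eps / (K + 1)) by (eapply Rlt_le_trans; [apply Hy|apply Rmin_r]).
    specialize (B w W1). replace (c + w)%C with y in B by (unfold w; ring).
    rewrite (Cmult_comm w). eapply Rle_trans; [apply B|].
    apply Rmult_lt_compat_r with (r := K + 1) in W2; [|lra].
    replace (eps / (K + 1) * (K + 1)) with (pos eps) in W2 by (field; lra).
    assert (T := Cmod_ge_0 w). nra. }
  exists (mkposreal _ Pd). exact Main.
Qed.

Lemma has_ps_Cder (f : C -> C) (c : C) (r : R) (a : nat -> C) : 0 < r -> has_ps f c r a ->
  Cder (fun u => f (c + RtoC u)%C) 0 (a 1%nat).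
Proof.
  intros Hr H. destruct (has_ps_taylor1 f c r a Hr H) as [d [K [Hd [HK B]]]].
  apply (Cder_of_quadratic _ 0 (a 1%nat) d K); auto.
  intros u Hu. rewrite Rplus_0_l. replace (c + RtoC 0)%C with c by ring.
  rewrite (Cmult_comm (RtoC u)). rewrite <- (pow2_abs u), <- Cmod_R. apply B. rewrite Cmod_R. auto.
Qed.

Definition times_coef (c : C) (a : nat -> C) (n : nat) : C := (c * a n + shift_coef a n)%C.

Definition npow_coef (c : C) (M n : nat) : C :=
  let l := RtoC (- ln (INR (S M))) in (Cexp (l * c) * (l ^ n * exp_coef n))%C.

Fixpoint partial_coef (c : C) (M n : nat) : C :=
  match M with O => 0%C | S M => (partial_coef c M n + npow_coef c M n)%C end.

Definition zeta_rem_coef (c : C) (z : nat -> C) (M n : nat) : C :=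
  let m := RtoC (INR (S M)) in
  let u n := (z n + - (1) * partial_coef c M n)%C in
  let q := npow_coef c M in
  (times_coef c u n + - (1) * u n + - (1) * ((m - / 2) * q n + / 2 * times_coef c q n
     + / (12 * m) * (times_coef c (times_coef c q) n + - (1) * times_coef c q n)))%C.

Lemma zeta_rem_has_ps_coef (zeta : C -> C) (c : C) (r : R) (z : nat -> C) (M : nat) :
  has_ps zeta c r z -> has_ps (zeta_rem zeta M) c r (zeta_rem_coef c z M).
Proof.
  intros Hz.
  assert (Hq : has_ps (npow M) c r (npow_coef c M)) by apply has_ps_Cexp.
  assert (Hp : has_ps (zeta_partial M) c r (partial_coef c M)).
  { clear Hq. induction M as [|M IH].
    - intros w _. apply Clim_ext with (fun _ => RtoC 0); [|apply Clim_const].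
      intros n. induction n as [|n IHn]; [reflexivity|].
      change (psum (partial_coef c 0) w (S n)) with (psum (partial_coef c 0) w n + 0 * w ^ n)%C.
      rewrite <- IHn. ring.
    - apply (has_ps_plus (zeta_partial M) (npow M)); [apply IH|apply has_ps_Cexp]. }
  assert (H1 := has_ps_plus _ _ _ _ _ _ Hz (has_ps_scal (- (1))%C _ _ _ _ Hp)).
  assert (H2 := has_ps_mult_id _ _ _ _ Hq).
  unfold zeta_rem, em_main, zeta_rem_coef.
  apply has_ps_plus; [apply has_ps_plus; [apply has_ps_mult_id, H1|apply has_ps_scal, H1]|].
  apply has_ps_scal. apply has_ps_plus; [apply has_ps_plus|].
  - apply has_ps_scal, Hq.
  - apply has_ps_scal, H2.
  - apply has_ps_scal, has_ps_plus; [apply has_ps_mult_id, H2|apply has_ps_scal, H2].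
Qed.

(** The bounds of [zeta_rem_step] telescope to less than (S0 + 2)^4, uniformly in M. All dependence
    on zeta sits in the remainder with M = 0, a fixed analytic function near each centre. *)
Lemma zeta_rem_bounded (zeta : C -> C) (M : nat) (s : C) (S0 : R) : - (3 / 2) <= Re s -> Cmod s <= S0 ->
  Cmod (zeta_rem zeta M s) <= Cmod (zeta_rem zeta 0 s) + (S0 + 2) ^ 4.
Proof.
  intros Hs HS.
  assert (PS : 0 <= (S0 + 2) ^ 4) by (apply pow_le; assert (T := Cmod_ge_0 s); lra).
  assert (K : Cmod (zeta_rem zeta M s - zeta_rem zeta 0 s)
     <= (S0 + 2) ^ 4 * (1 - exp (- ln (INR (S M)) / 2))).
  { induction M as [|M IH].
    - replace (zeta_rem zeta 0 s - zeta_rem zeta 0 s)%C with (RtoC 0) by ring.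
      rewrite Cmod_0. change (INR 1) with 1. rewrite ln_1.
      replace (- 0 / 2) with 0 by field. rewrite exp_0. lra.
    - replace (zeta_rem zeta (S M) s - zeta_rem zeta 0 s)%C
        with ((zeta_rem zeta (S M) s - zeta_rem zeta M s) + (zeta_rem zeta M s - zeta_rem zeta 0 s))%C by ring.
      eapply Rle_trans; [apply Cmod_triangle|].
      assert (T := zeta_rem_step zeta M s S0 Hs HS). lra. }
  replace (zeta_rem zeta M s) with ((zeta_rem zeta M s - zeta_rem zeta 0 s) + zeta_rem zeta 0 s)%C by ring.
  eapply Rle_trans; [apply Cmod_triangle|].
  assert (P := exp_pos (- ln (INR (S M)) / 2)). nra.
Qed.

Lemma is_lim_seq_INR_S : is_lim_seq (fun n => INR (S n)) p_infty.
Proof. apply -> (is_lim_seq_incr_1 INR). apply is_lim_seq_INR. Qed.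

Lemma zeta_rem_lim_right (zeta : C -> C) (s : C) : 1 < Re s ->
  @is_series C_AbsRing C_NormedModule (fun n => / Rcpow (INR (S n)) s)%C (zeta s) ->
  Clim (fun M => zeta_rem zeta M s) 0%C.
Proof.
  intros Hs H. apply is_series_Clim in H.
  assert (Hp : Clim (fun M => zeta_partial M s) (zeta s)).
  { apply Clim_ext with (2 := H). intros M. induction M as [|M IH]; [reflexivity|].
    change (zeta_partial (S M) s) with (zeta_partial M s + npow M s)%C. rewrite <- IH.
    set (a := fun n : nat => (/ Rcpow (INR (S n)) s)%C).
    change (psum a 1 (S M)) with (psum a 1 M + a M * 1 ^ M)%C. unfold a at 2.
    rewrite Cpow_1_l, Cmult_1_r. f_equal.
    unfold npow, Rcpow. rewrite <- Cexp_opp. f_equal. rewrite RtoC_opp. ring. }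
  set (X := fun M => (RtoC (INR (S M)) * npow M s)%C).
  set (v := fun M => (/ RtoC (INR (S M)))%C).
  assert (Pm : forall M, 0 < INR (S M)) by (intros; apply lt_0_INR; lia).
  assert (LX : Clim X 0%C).
  { apply Clim_le_0 with (N := 0%nat) (v := fun M => exp ((1 - Re s) * ln (INR (S M)))).
    - intros M _. replace (X M - 0)%C with (X M) by ring. unfold X, npow.
      rewrite Cmod_mult, Cmod_R, Rabs_right, Cmod_Cexp by (apply Rle_ge, Rlt_le, Pm).
      rewrite <- (exp_ln (INR (S M))) at 1 by apply Pm. rewrite <- exp_plus. right. f_equal.
      rewrite Re_mult. simpl (Im (RtoC _)). rewrite Re_RtoC. ring.
    - apply filterlim_comp with (G := Rbar_locally m_infty); [|apply (is_lim_exp_m)].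
      assert (L := is_lim_seq_scal_l (fun M => ln (INR (S M))) (1 - Re s) p_infty).
      replace m_infty with (Rbar_mult (1 - Re s) p_infty).
      + apply L. apply filterlim_comp with (G := Rbar_locally p_infty); [apply is_lim_seq_INR_S|apply is_lim_ln_p].
      + clear L. assert (Pn : 1 - Re s < 0) by lra. revert Pn. generalize (1 - Re s). intros k Pn. simpl.
        destruct (Rle_dec 0 k); [exfalso; lra|reflexivity]. }
  assert (Lv : Clim v 0%C).
  { apply Clim_ext with (fun M => RtoC (/ INR (S M))).
    - intros M. apply RtoC_inv. apply Rgt_not_eq, Pm.
    - apply Clim_RtoC. apply (is_lim_seq_inv _ p_infty); [apply is_lim_seq_INR_S|discriminate]. }
  assert (Le : Clim (fun M => em_main M s) 0%C).
  { apply Clim_ext with (fun M => X M * (1 + (s - 1) / 2 * v M + (s * s - s) / 12 * (v M * v M)))%C.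
    - intros M. unfold X, v, em_main.
      assert (N : RtoC (INR (S M)) <> 0%C) by (apply RtoC_neq_0, Rgt_not_eq, Pm).
      assert (N2 := RtoC_2_neq_0). assert (N12 : RtoC 12 <> 0%C) by (apply RtoC_neq_0; lra).
      field. auto.
    - replace (RtoC 0) with (0 * (1 + (s - 1) / 2 * 0 + (s * s - s) / 12 * (0 * 0)))%C by ring.
      apply Clim_mult; [exact LX|]. apply Clim_plus; [apply Clim_plus; [apply Clim_const|]|].
      + apply Clim_mult; [apply Clim_const|exact Lv].
      + apply Clim_mult; [apply Clim_const|]. apply Clim_mult; exact Lv. }
  replace (RtoC 0) with (s * (zeta s + - (1) * zeta s) + - (1) * (zeta s + - (1) * zeta s) + - (1) * 0)%C by ring.
  assert (Lz : Clim (fun M => zeta s + - (1) * zeta_partial M s)%C (zeta s + - (1) * zeta s)%C).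
  { apply Clim_plus; [apply Clim_const|]. apply Clim_mult; [apply Clim_const|exact Hp]. }
  unfold zeta_rem. apply Clim_plus; [apply Clim_plus|]; (apply Clim_mult; [apply Clim_const|]); assumption.
Qed.

(** One step of continuation: the uniform bound on a circle becomes, through [cauchy_estimate], the
    coefficient bound that [vitali] asks for. If the remainders vanish in the limit at points
    accumulating at c, they do so on a whole disk. *)
Lemma zeta_rem_local (zeta : C -> C) (c : C) (r : R) (z : nat -> C) :
  0 < r -> has_ps zeta c r z -> - 1 <= Re c ->
  exists rr, 0 < rr /\
   ((forall eps, 0 < eps -> exists w, 0 < Cmod w < eps /\ Clim (fun M => zeta_rem zeta M (c + w)%C) 0%C) ->
    (forall k, Clim (fun M => zeta_rem_coef c z M k) 0%C) /\
    (forall w, Cmod w <= rr -> Clim (fun M => zeta_rem zeta M (c + w)%C) 0%C)).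
Proof.
  intros Hr Hz Hc.
  (* A radius below r and at most 1/2, so that Re c >= -1 keeps the circle in Re s >= - 3/2. *)
  set (p := Rmin r 1 / 2).
  assert (M1 := Rmin_l r 1). assert (M2 := Rmin_r r 1). assert (M3 : 0 < Rmin r 1) by (apply Rmin_pos; lra).
  assert (Hp : 0 < p < r) by (unfold p; lra). assert (Hp2 : p <= / 2) by (unfold p; lra).
  assert (H0 := zeta_rem_has_ps_coef zeta c r z 0 Hz).
  destruct (has_ps_bounded _ _ _ ((p + r) / 2) _ H0 ltac:(lra)) as [M0 [PM0 B0]].
  set (th := p / ((p + r) / 2)).
  assert (Hth : 0 <= th < 1).
  { unfold th. split; [apply Rdiv_le_0_compat; lra|].
    apply Rmult_lt_reg_r with ((p + r) / 2); [lra|]. unfold Rdiv at 1. rewrite Rmult_assoc, Rinv_l; lra. }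
  set (S0 := Cmod c + 1).
  assert (PS0 : 0 < (S0 + 2) ^ 4) by (apply pow_lt; unfold S0; assert (T := Cmod_ge_0 c); lra).
  set (K := M0 / (1 - th) + (S0 + 2) ^ 4).
  assert (PK : 0 < K) by (unfold K; assert (0 < M0 / (1 - th)) by (apply Rdiv_lt_0_compat; lra); lra).
  assert (Bd : forall M w, Cmod w = p -> Cmod (zeta_rem zeta M (c + w)%C) <= K).
  { intros M w Hw. eapply Rle_trans; [apply (zeta_rem_bounded zeta M (c + w)%C S0)|].
    - rewrite Re_plus. assert (T := re_le_Cmod w). rewrite Hw in T. apply Rabs_le_between in T. lra.
    - unfold S0. eapply Rle_trans; [apply Cmod_triangle|]. lra.
    - unfold K. apply Rplus_le_compat_r.
      assert (T := psum_tail_le _ w _ M0 ((p + r) / 2) th 0 Hth ltac:(lra)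
         ltac:(rewrite Hw; unfold th; right; field; lra) B0 (H0 w ltac:(lra))).
      simpl psum in T. rewrite pow_O, Rmult_1_r in T.
      replace (zeta_rem zeta 0 (c + w)%C - 0)%C with (zeta_rem zeta 0 (c + w)%C) in T by ring. auto. }
  exists (p / 2). split; [lra|]. intros Hacc.
  apply (vitali (zeta_rem_coef c z) (fun M w => zeta_rem zeta M (c + w)%C) p K); auto; try lra.
  - intros M k. apply (cauchy_estimate _ c r p K _ k (zeta_rem_has_ps_coef zeta c r z M Hz)); auto.
  - intros M w Hw. apply (zeta_rem_has_ps_coef zeta c r z M Hz). lra.
Qed.

Definition seg (t : R) : C := (2 - 3 * t, 1 - t).

Lemma Cmod_seg_diff (t u : R) : Cmod (seg t - seg u) <= 4 * Rabs (t - u).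
Proof.
  eapply Rle_trans; [apply Cmod_le_abs|]. rewrite Re_minus, Im_minus. unfold seg, Re, Im; simpl.
  replace (2 - 3 * t - (2 - 3 * u)) with (- (3 * (t - u))) by ring.
  replace (1 - t - (1 - u)) with (- (t - u)) by ring.
  rewrite !Rabs_Ropp, Rabs_mult, (Rabs_right 3) by lra. lra.
Qed.

Lemma seg_neq (t u : R) : t <> u -> 0 < Cmod (seg t - seg u).
Proof.
  intros H. apply Cmod_gt_0. intros E. apply H. apply (f_equal Im) in E.
  rewrite Im_minus in E. unfold seg, Im in E; simpl in E. lra.
Qed.

(* The segment from [2 + i] to [-1] avoids the pole at 1. *)
Lemma zeta_rem_coef_lim (zeta : C -> C) (r : R) (z : nat -> C) : is_riemann_zeta zeta ->
  0 < r -> has_ps zeta (RtoC (-1)) r z ->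
  forall k, Clim (fun M => zeta_rem_coef (RtoC (-1)) z M k) 0%C.
Proof.
  intros [H1 H2] Hr Hz.
  set (Z := fun t => Clim (fun M => zeta_rem zeta M (seg t)) 0%C).
  set (E := fun t => 0 <= t <= 1 /\ forall u, 0 <= u <= t -> Z u).
  assert (HR : forall t, 0 <= t <= 1 -> - 1 <= Re (seg t)) by (intros t Ht; unfold seg, Re; simpl; lra).
  (* Up to t = 1/6 the real part of [seg t] is at least 3/2, inside the half-plane of the series. *)
  assert (H16 : E (1 / 6)).
  { split; [lra|]. intros u Hu. apply zeta_rem_lim_right; [|apply H1]; unfold seg, Re; simpl; lra. }
  (* Connectedness of [0, 1]. The points just before the supremum [T] accumulate at [seg T], so the
     local step applies there and would pass beyond [T] if [T] were less than 1. *)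
  destruct (completeness E) as [T [HU HL]].
  { exists 1. intros t [Ht _]. lra. }
  { exists (1 / 6). exact H16. }
  assert (T16 : 1 / 6 <= T) by (apply HU; exact H16).
  assert (T1 : T <= 1) by (apply HL; intros t [Ht _]; lra).
  assert (ZT : forall u, 0 <= u < T -> Z u).
  { intros u Hu. destruct (Rle_dec T u) as [L|L]; [lra|].
    assert (N : ~ is_upper_bound E u) by (intros B; assert (X := HL u B); lra).
    destruct (Classical_Prop.classic (exists t, E t /\ u < t)) as [[t [[_ Ht] Hut]]|No].
    - apply Ht; lra.
    - exfalso. apply N. intros t Ht. apply Rnot_lt_le. intros Hut. apply No. exists t; auto. }
  assert (Acc : forall eps, 0 < eps ->
     exists w, 0 < Cmod w < eps /\ Clim (fun M => zeta_rem zeta M (seg T + w)%C) 0%C).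
  { intros eps He. set (d := Rmin (T / 2) (eps / 8)).
    assert (Pd : 0 < d) by (apply Rmin_pos; lra).
    assert (D1 : d <= T / 2) by apply Rmin_l. assert (D2 : d <= eps / 8) by apply Rmin_r.
    exists (seg (T - d) - seg T)%C. split; [split|].
    - apply seg_neq. lra.
    - eapply Rle_lt_trans; [apply Cmod_seg_diff|]. replace (T - d - T) with (- d) by ring.
      rewrite Rabs_Ropp, Rabs_right; lra.
    - replace (seg T + (seg (T - d) - seg T))%C with (seg (T - d)) by ring. apply ZT. lra. }
  assert (HT1 : T = 1).
  { destruct (Req_dec T 1) as [e|N]; auto. exfalso.
    assert (Nz : seg T <> 1%C).
    { intros e. apply (f_equal Im) in e. unfold seg, Im in e; simpl in e. lra. }
    destruct (analytic_has_ps zeta (seg T) (H2 _ Nz)) as [a [r' [Hr' Ha]]].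
    destruct (zeta_rem_local zeta (seg T) r' a Hr' Ha (HR T ltac:(lra))) as [rr [Prr Hloc]].
    destruct (Hloc Acc) as [_ Hz'].
    set (d := Rmin (rr / 4) (1 - T)).
    assert (Pd : 0 < d) by (apply Rmin_pos; lra).
    assert (D1 : d <= rr / 4) by apply Rmin_l. assert (D2 : d <= 1 - T) by apply Rmin_r.
    assert (Ed : E (T + d)).
    { split; [lra|]. intros u Hu. destruct (Rlt_dec u T) as [L|L]; [apply ZT; lra|].
      unfold Z. replace (seg u) with (seg T + (seg u - seg T))%C by ring. apply Hz'.
      eapply Rle_trans; [apply Cmod_seg_diff|]. rewrite Rabs_right; lra. }
    assert (X := HU _ Ed). lra. }
  assert (Es : seg T = RtoC (-1)).
  { rewrite HT1. unfold seg, RtoC. f_equal; ring. }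
  rewrite Es in Acc.
  destruct (zeta_rem_local zeta (RtoC (-1)) r z Hr Hz ltac:(rewrite Re_RtoC; lra)) as [rr [_ Hloc]].
  apply Hloc. exact Acc.
Qed.

(** * The derivative of zeta at -1 *)

Fixpoint sum_n_ln (M : nat) : R :=
  match M with O => 0 | S M => sum_n_ln M + INR (S M) * ln (INR (S M)) end.

Lemma npow_m1 (n : nat) : npow n (RtoC (-1)) = RtoC (INR (S n)).
Proof.
  unfold npow. rewrite <- RtoC_mult, Cexp_RtoC.
  replace (- ln (INR (S n)) * -1) with (ln (INR (S n))) by ring.
  rewrite exp_ln; auto. apply lt_0_INR; lia.
Qed.

Lemma zeta_partial_m1 (M : nat) : zeta_partial M (RtoC (-1)) = RtoC (INR M * (INR M + 1) / 2).
Proof.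
  induction M as [|M IH].
  - simpl. f_equal. field.
  - change (zeta_partial (S M) (RtoC (-1))) with (zeta_partial M (RtoC (-1)) + npow M (RtoC (-1)))%C.
    rewrite IH, npow_m1, <- RtoC_plus. f_equal. rewrite !S_INR. field.
Qed.

Lemma Cder_npow (n : nat) :
  Cder (fun u => npow n (RtoC (-1) + RtoC u)%C) 0 (RtoC (- (INR (S n) * ln (INR (S n))))).
Proof.
  unfold npow. set (l := RtoC (- ln (INR (S n)))).
  apply Cder_ext with (fun u => Cexp (l * (RtoC (-1) + RtoC u * 1)))%C.
  { intros u. f_equal. f_equal. ring. }
  eapply Cder_value; [apply Cder_Cexp, Cder_scal, Cder_line|]. cbv beta.
  replace (RtoC (-1) + RtoC 0 * 1)%C with (RtoC (-1)) by ring.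
  fold (npow n (RtoC (-1))). change (Cexp (l * RtoC (-1))) with (npow n (RtoC (-1))).
  rewrite npow_m1. unfold l. rewrite !RtoC_opp, RtoC_mult. ring.
Qed.

Lemma Cder_zeta_partial (M : nat) :
  Cder (fun u => zeta_partial M (RtoC (-1) + RtoC u)%C) 0 (RtoC (- sum_n_ln M)).
Proof.
  induction M as [|M IH].
  - simpl. rewrite Ropp_0. apply Cder_const.
  - change (fun u => zeta_partial (S M) (RtoC (-1) + RtoC u)%C)
      with (fun u => (zeta_partial M (RtoC (-1) + RtoC u) + npow M (RtoC (-1) + RtoC u))%C).
    eapply Cder_value; [apply Cder_plus; [apply IH|apply Cder_npow]|].
    change (sum_n_ln (S M)) with (sum_n_ln M + INR (S M) * ln (INR (S M))).
    rewrite !RtoC_opp, RtoC_plus. ring.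
Qed.

(** The Glaisher-Kinkelin expansion, in the variable m = M + 1. The sum stops at m - 1, which
    accounts for the sign of m / 2. It is the coefficient of index 1 of the remainder at -1, tending
    to 0. *)
Lemma zeta_derivative_limit (zeta : C -> C) : is_riemann_zeta zeta ->
  Clim (fun M => C_derive zeta (RtoC (-1)) + RtoC (sum_n_ln M
     - ((INR (S M) ^ 2 / 2 - INR (S M) / 2 + / 12) * ln (INR (S M)) - INR (S M) ^ 2 / 4 + / 12)))%C 0%C.
Proof.
  intros Hzeta.
  assert (N1 : RtoC (-1) <> 1%C) by (intros E; apply RtoC_inj in E; lra).
  destruct (analytic_has_ps zeta _ (proj2 Hzeta _ N1)) as [z [r [Hr Hz]]].
  assert (L := zeta_rem_coef_lim zeta r z Hzeta Hr Hz).
  rewrite (is_C_derive_unique zeta _ _ (has_ps_is_derive _ _ _ _ Hr Hz)).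
  assert (Dz := has_ps_Cder _ _ _ _ Hr Hz).
  assert (NM : forall M, RtoC (INR (S M)) <> 0%C) by (intros; apply RtoC_neq_0, not_0_INR; lia).
  assert (N2 := RtoC_2_neq_0). assert (N12 : RtoC 12 <> 0%C) by (apply RtoC_neq_0; lra).
  (* At s = -1 the remainder does not depend on M: it is - 2 (zeta(-1) + 1/12). Its limit 0
     therefore gives the value of zeta(-1), which occurs in the derivative below. *)
  assert (Z0 : zeta (RtoC (-1)) = RtoC (- / 12)).
  { apply (Clim_unique (fun _ => zeta (RtoC (-1)))); [apply Clim_const|].
    replace (RtoC (- / 12)) with (- / 2 * 0 + RtoC (- / 12))%C by ring.
    apply Clim_ext with (fun M => - / 2 * zeta_rem_coef (RtoC (-1)) z M 0 + RtoC (- / 12))%C.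
    - intros M. rewrite <- (has_ps_0 _ _ _ _ Hr (zeta_rem_has_ps_coef zeta _ r z M Hz)).
      unfold zeta_rem, em_main. rewrite npow_m1, zeta_partial_m1.
      specialize (NM M).
      replace (INR M * (INR M + 1) / 2) with ((INR (S M) - 1) * INR (S M) / 2) by (rewrite S_INR; field).
      set (m := INR (S M)) in *. clearbody m.
      rewrite !RtoC_opp, !RtoC_inv, RtoC_div, RtoC_mult, RtoC_minus by lra.
      replace (RtoC 12) with (2 * 2 * (1 + 2))%C in * by (rewrite <- RtoC_plus, <- !RtoC_mult; f_equal; ring).
      assert (N3 : (1 + 2)%C <> 0%C) by (rewrite <- RtoC_plus; apply RtoC_neq_0; lra).
      field. auto.
    - apply Clim_plus; [|apply Clim_const]. apply Clim_mult; [apply Clim_const|apply L]. }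
  replace (RtoC 0) with (- / 2 * 0)%C by ring.
  (* The factor - 1/2 undoes s - 1 = - 2 in front of zeta'(-1). *)
  apply Clim_ext with (fun M => - / 2 * zeta_rem_coef (RtoC (-1)) z M 1)%C.
  2: { apply Clim_mult; [apply Clim_const|apply L]. }
  intros M.
  assert (D1 := has_ps_Cder _ _ _ _ Hr (zeta_rem_has_ps_coef zeta _ r z M Hz)).
  set (m := RtoC (INR (S M))).
  assert (Did : Cder (fun u => RtoC (-1) + RtoC u)%C 0 1%C).
  { apply Cder_ext with (fun u => RtoC (-1) + RtoC u * 1)%C; [intros; ring|apply Cder_line]. }
  (* The coefficient of index 1 is evaluated as a derivative in the real direction rather than
     through the recursive formula [zeta_rem_coef]. *)
  assert (D2 : Cder (fun u => zeta_rem zeta M (RtoC (-1) + RtoC u)%C) 0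
     (zeta (RtoC (-1)) - RtoC (INR M * (INR M + 1) / 2) - 2 * (z 1%nat + RtoC (sum_n_ln M))
      + RtoC (ln (INR (S M))) * (m * m - m + / 6) - m / 2 + / 2 * / 2)%C).
  { unfold zeta_rem, em_main. fold m.
    assert (Dp := Cder_zeta_partial M). assert (Dn := Cder_npow M).
    assert (Du := Cder_plus _ _ _ _ _ Dz (Cder_scal (- (1))%C _ _ _ Dp)).
    assert (Dsn := Cder_mult _ _ _ _ _ Did Dn).
    eapply Cder_value.
    - apply Cder_plus; [apply Cder_plus; [apply (Cder_mult _ _ _ _ _ Did Du)|apply Cder_scal, Du]|].
      apply Cder_scal. apply Cder_plus; [apply Cder_plus; [apply Cder_scal, Dn|apply Cder_scal, Dsn]|].
      apply Cder_scal. apply Cder_plus; [apply (Cder_mult _ _ _ _ _ Did Dsn)|apply Cder_scal, Dsn].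
    - cbv beta. replace (RtoC (-1) + RtoC 0)%C with (RtoC (-1)) by ring.
      rewrite npow_m1, zeta_partial_m1. fold m. rewrite !RtoC_opp, RtoC_mult. fold m.
      specialize (NM M). fold m in NM.
      set (tri := RtoC (INR M * (INR M + 1) / 2)). clearbody m tri.
      replace (RtoC 12) with (2 * 2 * (1 + 2))%C in * by (rewrite <- RtoC_plus, <- !RtoC_mult; f_equal; ring).
      replace (RtoC 6) with (2 * (1 + 2))%C in * by (rewrite <- RtoC_plus, <- !RtoC_mult; f_equal; ring).
      assert (N3 : (1 + 2)%C <> 0%C) by (rewrite <- RtoC_plus; apply RtoC_neq_0; lra).
      field. auto. }
  rewrite (Cder_unique _ _ _ _ D1 D2), Z0.
  replace (INR M * (INR M + 1) / 2) with ((INR (S M) - 1) * INR (S M) / 2) by (rewrite S_INR; field).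
  unfold m. set (x := INR (S M)). set (l := ln x). clearbody l x. set (k := sum_n_ln M). clearbody k.
  replace (RtoC (- / 12) - RtoC ((x - 1) * x / 2) - 2 * (z 1%nat + RtoC k) + RtoC l * (RtoC x * RtoC x - RtoC x + / 6) - RtoC x / 2 + / 2 * / 2)%C
    with (- (2) * z 1%nat + RtoC (- / 12 - (x - 1) * x / 2 - 2 * k + l * (x * x - x + / 6) - x / 2 + / 2 * / 2))%C.
  - replace (- / 2 * (- (2) * z 1%nat + RtoC (- / 12 - (x - 1) * x / 2 - 2 * k + l * (x * x - x + / 6) - x / 2 + / 2 * / 2)))%C
      with (z 1%nat + RtoC (- / 2 * (- / 12 - (x - 1) * x / 2 - 2 * k + l * (x * x - x + / 6) - x / 2 + / 2 * / 2)))%C.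
    + f_equal. f_equal. field.
    + rewrite (RtoC_mult (- / 2)), RtoC_opp, RtoC_inv by lra. field. auto.
  - rewrite !RtoC_plus, !RtoC_minus, !RtoC_plus, !RtoC_minus, !RtoC_mult, !RtoC_plus, !RtoC_minus, !RtoC_mult.
    rewrite ?RtoC_div, ?RtoC_opp, ?RtoC_inv by lra. rewrite ?RtoC_mult, ?RtoC_minus, ?RtoC_inv by lra. ring.
Qed.

(** * The constant b_0(1) *)

Lemma ln_1p_taylor3 (u : R) : 0 <= u -> Rabs (ln (1 + u) - (u - u ^ 2 / 2 + u ^ 3 / 3)) <= u ^ 4.
Proof.
  intros Hu.
  assert (H := Cder_le (fun t => RtoC (ln (1 + t) - (t - t ^ 2 / 2 + t ^ 3 / 3)))
    (fun t => RtoC (- (t ^ 3 / (1 + t)))) (fun t => t ^ 4 / 4) (fun t => t ^ 3) 0 u Hu).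
  cbv beta in H. rewrite <- RtoC_minus, Cmod_R in H.
  replace (ln (1 + 0) - (0 - 0 ^ 2 / 2 + 0 ^ 3 / 3)) with 0 in H by (rewrite Rplus_0_r, ln_1; field).
  rewrite Rminus_0_r in H.
  assert (P4 : 0 <= u ^ 4) by (apply pow_le; auto).
  eapply Rle_trans; [apply H|lra].
  - intros t Ht. apply Cder_RtoC. auto_derive; [lra|]. field. lra.
  - intros t Ht. auto_derive; auto. field.
  - intros t Ht. assert (P3 : 0 <= t ^ 3) by (apply pow_le; lra).
    rewrite Cmod_R, Rabs_Ropp, Rabs_right by (apply Rle_ge, Rdiv_le_0_compat; lra).
    apply Rmult_le_reg_r with (1 + t); [lra|]. unfold Rdiv. rewrite Rmult_assoc, Rinv_l by lra. nra.
Qed.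

Lemma is_lim_seq_inv_INR_S : is_lim_seq (fun n => / INR (S n)) 0.
Proof. apply (is_lim_seq_inv _ p_infty); [apply is_lim_seq_INR_S|discriminate]. Qed.

(** The cubic is (m - 1) P(m + 1) at tau = 1, the coefficient of ln (m + 1) in [sum_n_ln_Rf]. Its
    degree requires ln (1 + 1/m) up to an error O(m^(-4)), as provided by [ln_1p_taylor3]. *)
Lemma lim_cubic_ln : is_lim_seq (fun n => let m := INR (S n) in
  (m ^ 3 / 2 - m ^ 2 / 2 - m / 12 + / 12) * (ln (m + 1) - ln m) - m ^ 2 / 2 + 3 / 4 * m) (/ 3).
Proof.
  assert (LI := is_lim_seq_inv_INR_S).
  set (v := fun n => / INR (S n)) in LI.
  set (p := fun m => m ^ 3 / 2 - m ^ 2 / 2 - m / 12 + / 12).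
  set (e := fun n => ln (INR (S n) + 1) - ln (INR (S n)) - (v n - v n ^ 2 / 2 + v n ^ 3 / 3)).
  assert (Pm : forall n, 1 <= INR (S n)) by (intros n; rewrite S_INR; assert (T := pos_INR n); lra).
  assert (L1 : is_lim_seq (fun n => p (INR (S n)) * e n) 0).
  { apply is_lim_seq_abs_0.
    apply is_lim_seq_le_le with (u := fun _ => 0) (w := fun n => 2 * v n).
    - intros n. split; [apply Rabs_pos|]. specialize (Pm n).
      assert (He : Rabs (e n) <= v n ^ 4).
      { unfold e. replace (ln (INR (S n) + 1) - ln (INR (S n))) with (ln (1 + v n)).
        - apply ln_1p_taylor3. unfold v. left; apply Rinv_0_lt_compat; lra.
        - replace (INR (S n) + 1) with (INR (S n) * (1 + v n)) by (unfold v; field; lra).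
          assert (0 < v n) by (unfold v; apply Rinv_0_lt_compat; lra).
          rewrite ln_mult by lra. ring. }
      rewrite Rabs_mult.
      apply Rle_trans with (2 * INR (S n) ^ 3 * v n ^ 4).
      + apply Rmult_le_compat; auto using Rabs_pos. set (m := INR (S n)) in *.
        assert (1 <= m ^ 2) by (apply pow_R1_Rle; auto). assert (m ^ 2 <= m ^ 3) by (simpl in *; nra).
        assert (m <= m ^ 3) by (simpl in *; nra).
        unfold p. apply Rabs_le. lra.
      + right. unfold v. field. lra.
    - apply is_lim_seq_const.
    - replace 0 with (2 * 0) by ring. apply is_lim_seq_mult'; [apply is_lim_seq_const|auto]. }
  assert (L := is_lim_seq_plus' _ _ _ _ (is_lim_seq_plus' _ _ _ _ L1 (is_lim_seq_const (/ 3)))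
    (is_lim_seq_mult' _ _ _ _ LI (is_lim_seq_plus' _ _ _ _ (is_lim_seq_const (- / 24))
       (is_lim_seq_plus' _ _ _ _ (is_lim_seq_mult' _ _ _ _ (is_lim_seq_const (- (5 / 72))) LI)
         (is_lim_seq_mult' _ _ _ _ (is_lim_seq_const (/ 36)) (is_lim_seq_mult' _ _ _ _ LI LI)))))).
  replace (0 + / 3 + 0 * (- / 24 + (- (5 / 72) * 0 + / 36 * (0 * 0)))) with (/ 3) in L by ring.
  apply is_lim_seq_ext with (2 := L). intros n. cbv zeta. unfold e, p, v. specialize (Pm n).
  set (m := INR (S n)) in *. field. lra.
Qed.

Lemma Rf_1_eq (x : R) : 0 < x ->
  Rf 1 x = (x ^ 2 / 2 - x + 5 / 12) * ln x - 3 / 4 * x ^ 2 + (ln (2 * PI) / 2 + 1) * x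
    - Re (Lap (f3ext 1) (RtoC x)).
Proof.
  intros Hx. unfold Rf, Ff. rewrite Re_minus. apply (f_equal (fun y => y - _)).
  unfold Sf. rewrite (barnes_P_eq 1 Rlt_0_1), barnes_Q_eq, Cln_RtoC by auto.
  rewrite <- ?RtoC_mult, <- ?RtoC_plus, <- ?RtoC_mult, <- ?RtoC_plus, <- ?RtoC_mult, <- ?RtoC_plus, Re_RtoC.
  rewrite ln_1. replace (2 * PI * 1) with (2 * PI) by ring. field.
Qed.

(** The transform alone is only O(1/x), too weak against the weight m in [lim_Lap_f3_weighted]. The
    difference is the transform of (1 - exp (- t)) f_3(t), and 1 - exp (- t) <= t gains a power of
    x. *)
Lemma Lap_f3_difference : exists K, 0 <= K /\ forall x, 1 <= x ->
  Cmod (Lap (f3ext 1) (RtoC x) - Lap (f3ext 1) (RtoC (x + 1))) <= K / x ^ 2.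
Proof.
  destruct (f3ext_bounded 1 Rlt_0_1) as [K [HK B]].
  exists (4 * K). split; [lra|]. intros x Hx.
  assert (Tf := tame_f3ext 1 Rlt_0_1).
  assert (E1 : (Lap (f3ext 1) (RtoC x) - Lap (f3ext 1) (RtoC (x + 1)))%C
     = Lap (fun t => (1 - exp (- t)) * f3ext 1 t) (RtoC x)).
  { symmetry. apply Lap_eq.
    apply CInt_ext with (fun t => lap_fun (f3ext 1) (RtoC x) t - lap_fun (f3ext 1) (RtoC (x + 1)) t)%C.
    - intros t _. unfold lap_fun. rewrite RtoC_plus.
      replace (- ((RtoC x + 1) * RtoC t))%C with (- (RtoC x * RtoC t) + RtoC (- t))%C by (rewrite RtoC_opp; ring).
      rewrite Cexp_plus, Cexp_RtoC, RtoC_mult, RtoC_minus. ring.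
    - apply CInt_minus; apply CInt_lap; auto; rewrite Re_RtoC; lra. }
  rewrite E1.
  (* The bound K t <= (2 K / x) exp (x t / 2) spends half of the decay; the other half gives a
     second factor 2 / x. *)
  destruct (CInt_lap_bounded (fun t => (1 - exp (- t)) * f3ext 1 t) (RtoC x) (K / (x / 2)) (x / 2)) as [_ H].
  - intros t. apply (continuous_mult (fun t => 1 - exp (- t)) (f3ext 1)); [|apply Tf].
    apply (ex_derive_continuous (fun t => 1 - exp (- t))). auto_derive. auto.
  - rewrite Re_RtoC. lra.
  - intros t Ht. rewrite Rabs_mult. specialize (B t Ht).
    assert (H1 := exp_ineq1_le (- t)).
    assert (H2 : exp (- t) <= 1) by (rewrite <- exp_0; apply exp_le; lra).
    rewrite Rabs_right by lra.
    assert (H3 := exp_ineq1_le (x / 2 * t)).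
    apply Rle_trans with (t * K).
    + apply Rmult_le_compat; [lra|apply Rabs_pos|lra|auto].
    + apply Rle_trans with (K / (x / 2) * (x / 2 * t)).
      * right. field. lra.
      * apply Rmult_le_compat_l; [apply Rdiv_le_0_compat; lra|lra].
  - eapply Rle_trans; [apply H|]. rewrite Re_RtoC. right. field. lra.
Qed.

Lemma lim_Lap_f3_weighted : is_lim_seq (fun n => INR (S n) * Re (Lap (f3ext 1) (RtoC (INR (S n))))
   - (INR (S n) - 1) * Re (Lap (f3ext 1) (RtoC (INR (S n) + 1)))) 0.
Proof.
  destruct Lap_f3_difference as [K [HK B]].
  assert (Pm : forall n, 1 <= INR (S n)) by (intros n; rewrite S_INR; assert (T := pos_INR n); lra).
  assert (L1 : is_lim_seq (fun n => INR (S n) * (Re (Lap (f3ext 1) (RtoC (INR (S n))))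
     - Re (Lap (f3ext 1) (RtoC (INR (S n) + 1))))) 0).
  { apply is_lim_seq_abs_0.
    apply is_lim_seq_le_le with (u := fun _ => 0) (w := fun n => K * / INR (S n)).
    - intros n. split; [apply Rabs_pos|]. specialize (Pm n). specialize (B _ Pm).
      rewrite <- Re_minus, Rabs_mult, (Rabs_right (INR (S n))) by lra.
      apply Rle_trans with (INR (S n) * (K / INR (S n) ^ 2)).
      + apply Rmult_le_compat_l; [lra|]. eapply Rle_trans; [apply re_le_Cmod|exact B].
      + right. field. lra.
    - apply is_lim_seq_const.
    - replace 0 with (K * 0) by ring. apply is_lim_seq_mult'; [apply is_lim_seq_const|apply is_lim_seq_inv_INR_S]. }
  assert (L2 : Clim (fun n => Lap (f3ext 1) (RtoC (INR (S n) + 1))) 0%C).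
  { apply (Lap_f3_lim 1 Rlt_0_1 (fun n => RtoC (INR (S n) + 1))).
    - intros n. rewrite Re_RtoC. specialize (Pm n). lra.
    - apply is_lim_seq_le_p_loc with (fun n => INR (S n)); [|apply is_lim_seq_INR_S].
      exists 0%nat. intros n _. rewrite Re_RtoC. lra. }
  destruct L2 as [L2 _]. rewrite Re_RtoC in L2.
  assert (L := is_lim_seq_plus' _ _ _ _ L1 L2). rewrite Rplus_0_r in L.
  apply is_lim_seq_ext with (2 := L). intros n. ring.
Qed.

(* For [tau = 1] the second difference of [Rf 1] is [ln], so two summations by parts give [sum k ln k]. *)
Lemma sum_n_ln_Rf (M : nat) : sum_n_ln M =
  (INR (S M) - 1) * (Rf 1 (INR (S M) + 1) - Rf 1 1) - INR (S M) * (Rf 1 (INR (S M)) - Rf 1 1).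
Proof.
  induction M as [|M IH].
  - simpl. ring.
  - change (sum_n_ln (S M)) with (sum_n_ln M + INR (S M) * ln (INR (S M))). rewrite IH.
    rewrite (S_INR (S M)). set (m := INR (S M)).
    assert (Pm : 0 < m) by (apply lt_0_INR; lia).
    assert (E := dF_step 1 m Rlt_0_1 Pm). rewrite ln_1 in E. unfold dF in E.
    assert (E2 : m * ln m = m * (Rf 1 (m + 1 + 1) - Rf 1 (m + 1) - (Rf 1 (m + 1) - Rf 1 m))) by (rewrite E; ring).
    rewrite E2. ring.
Qed.

(** The sum of k ln k has one expansion through F and one through zeta. Their growing parts agree,
    and the constants F(1) - ln (2 PI) / 2 and - zeta'(-1) must be equal. *)
Lemma Rf_1_1_zeta (zeta : C -> C) : is_riemann_zeta zeta ->
  RtoC (- Rf 1 1) = (C_derive zeta (RtoC (-1)) - RtoC (ln (2 * PI) / 2))%C.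
Proof.
  intros Hz. assert (L := zeta_derivative_limit zeta Hz).
  set (z1 := C_derive zeta (RtoC (-1))) in *.
  assert (K : is_lim_seq (fun M => sum_n_ln M
     - ((INR (S M) ^ 2 / 2 - INR (S M) / 2 + / 12) * ln (INR (S M)) - INR (S M) ^ 2 / 4 + / 12))
     (/ 3 + 0 + (Rf 1 1 - / 3 - ln (2 * PI) / 2))).
  { assert (L2 := is_lim_seq_plus' _ _ _ _ (is_lim_seq_plus' _ _ _ _ lim_cubic_ln lim_Lap_f3_weighted)
      (is_lim_seq_const (Rf 1 1 - / 3 - ln (2 * PI) / 2))).
    apply is_lim_seq_ext with (2 := L2). intros M. rewrite sum_n_ln_Rf. cbv zeta.
    assert (Pm : 0 < INR (S M)) by (apply lt_0_INR; lia).
    set (m := INR (S M)) in *. rewrite (Rf_1_eq m), (Rf_1_eq (m + 1)) by lra. field. }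
  assert (U := Clim_unique _ _ _ L (Clim_plus _ _ _ _ (Clim_const z1) (Clim_RtoC _ _ K))).
  replace z1 with (0 - RtoC (/ 3 + 0 + (Rf 1 1 - / 3 - ln (2 * PI) / 2)))%C by (rewrite U; ring).
  rewrite <- !RtoC_minus. f_equal. field.
Qed.

(** * The integral of the statement, and the theorem *)

Lemma CInt_integrand (tau : R) (z : C) : 0 < tau -> 0 < Re z ->
  CInt (integrand tau z) (Lap (f3ext tau) z).
Proof.
  intros Ht Hz. apply CInt_ext with (lap_fun (f3ext tau) z).
  - intros x Hx. unfold lap_fun, integrand. rewrite f3ext_barnes_f3; auto.
  - apply CInt_lap; auto. apply tame_f3ext; auto.
Qed.

Lemma barnes_rhs_eq (tau b : R) (z : C) : 0 < tau -> 0 < Re z ->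
  barnes_rhs tau b z = (Ff tau z + RtoC b)%C.
Proof.
  intros Ht Hz. unfold barnes_rhs, Ff, Sf.
  rewrite (CInt_RInt_gen _ _ (CInt_integrand tau z Ht Hz)).
  unfold barnes_Q. ring.
Qed.

Theorem lemma2p3
  (G lnG : R -> C -> C) (B : nat -> C -> R -> C) (zeta : C -> C)
  (hG : forall tau : R, (0 < tau)%R -> is_barnes_double_gamma tau (G tau))
  (hlnG : forall tau : R, (0 < tau)%R -> is_real_log_branch (G tau) (lnG tau))
  (hB : is_double_bernoulli B)
  (hzeta : is_riemann_zeta zeta) :
  exists b0 : R -> R,
    (forall (tau : R) (z : C), (0 < tau)%R -> (0 < Re z)%R ->
       @ex_RInt_gen C_R_NormedModule (integrand tau z)
         (at_point 0%R) (Rbar_locally p_infty) /\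
       lnG tau z = barnes_rhs tau (b0 tau) z) /\
    (forall (tau : R) (z : C), (0 < tau)%R ->
       barnes_P tau z = (RtoC (1 / 2) * B 2%nat z tau)%C) /\
    (forall tau b : R, (0 < tau)%R ->
       (Cexp (barnes_rhs tau b (RtoC 1)) = RtoC 1 <-> b = b0 tau)) /\
    RtoC (b0 1%R) = (C_derive zeta (RtoC (-1)) - RtoC (ln (2 * PI) / 2))%C.
Proof.
  (* The case tau = 2 supplies Stirling's constant for every tau. *)
  assert (Hs := stirling_constant _ _ (hG 2 Rlt_0_2) (hlnG 2 Rlt_0_2)).
  (* The value of b for which the right-hand side vanishes at z = 1. *)
  exists (fun tau => - Rf tau 1). split; [|split; [|split]].
  - intros tau z Ht Hz. split.
    + exists (Lap (f3ext tau) z). exact (CInt_integrand tau z Ht Hz).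
    + rewrite barnes_rhs_eq by auto.
      exact (log_barnes_eq tau _ _ Hs Ht (hG tau Ht) (hlnG tau Ht) z Hz).
  - intros tau z Ht. apply barnes_P_bernoulli; auto.
  (* At z = 1 the right-hand side is the real number F(1) + b, so its exponential is 1 for exactly
     one real b. *)
  - intros tau b Ht. rewrite barnes_rhs_eq by (auto using Rlt_0_1; exact Rlt_0_1).
    rewrite Ff_RtoC, <- RtoC_plus, Cexp_RtoC by (auto using Rlt_0_1). split.
    + intros E. apply RtoC_inj in E. apply (f_equal ln) in E. rewrite ln_exp, ln_1 in E. lra.
    + intros ->. rewrite Rplus_opp_r, exp_0. reflexivity.
  - apply Rf_1_1_zeta, hzeta.
Qed.
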